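(* Let $D:=\operatorname{supp}(\varepsilon-I_3)\cap\Omega$, and for $l=1,\dots,N$ let $\mathbf{u}(\cdot,l)$ be the $\alpha$-quasiperiodic scattered field generated by the $\alpha$-quasiperiodic incident field $\mathbf{E}^{in}(\cdot,l)$, with total field $\mathbf{E}(\cdot,l)=\mathbf{E}^{in}(\cdot,l)+\mathbf{u}(\cdot,l)$ and Rayleigh coefficients $\mathbf{u}_j^\pm(l)\in\mathbb{C}^3$, $j\in\mathbb{Z}^2$ (third components $u_{3,j}^\pm(l)$). For $p>0$ define the imaging functional $$ \mathcal{I}(\mathbf{z}) := \sum_{l = 1}^N\Bigg| \sum_{j\in\mathbb{Z}^2} \Bigg( \left( \mathbf{h}_j^+(\mathbf{z}) - 2\operatorname{Re}(\beta_j)\, \mathbf{g}^+_j(\mathbf{z})\right)^*\mathbf{u}_j^+(l) + u^+_{3,j}(l)\,\mathbf{g}^+_j(\mathbf{z})^*\begin{bmatrix} \alpha_{1,j} \\ \alpha_{2,j} \\ \beta_j \end{bmatrix} - \left( \mathbf{h}_j^-(\mathbf{z}) + 2\operatorname{Re}(\beta_j)\, \mathbf{g}^-_j(\mathbf{z})\right)^*\mathbf{u}_j^-(l) - u^-_{3,j}(l)\, \mathbf{g}^-_j(\mathbf{z})^* \begin{bmatrix} \alpha_{1,j} \\ \alpha_{2,j} \\ -\beta_j \end{bmatrix} \Bigg) \Bigg|^p . $$ Then for all $\mathbf{z}\in\Omega$, $$ \mathcal{I}(\mathbf{z}) = \sum_{l = 1}^N \left| \frac{k^2}{2\pi^2}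 \int_D \mathbb{F}(\mathbf{z},\mathbf{y})\, (\varepsilon(\mathbf{y}) - I_3)\,\mathbf{E}(\mathbf{y},l)\, d\mathbf{y} \right|^p, $$ where $$ \mathbb{F}(\mathbf{x},\mathbf{y}) = F(\mathbf{x},\mathbf{y})I_3 + \frac{1}{k^2} \nabla_{\mathbf{x}} \operatorname{div}_{\mathbf{x}}(F(\mathbf{x},\mathbf{y})I_3), $$ $$ F(\mathbf{x},\mathbf{y}) = \frac{k}{4\pi} j_0(k|\mathbf{x}-\mathbf{y}|) + \sum_{ 0 \neq j \in \mathbb{Z}^2} \frac{k\,e^{-i2\pi\alpha \cdot j}}{4\pi}\, j_0\left(k \left | \mathbf{x}-\mathbf{y} + (2\pi j_1, 2\pi j_2, 0)^\top \right| \right), $$ and $j_0$ is the spherical Bessel function of the first kind of order $0$.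
   Context: **Direct problem.** Let $k>0$ and $\alpha=(\alpha_1,\alpha_2)\in\mathbb{R}^2$. Let $\varepsilon$ be a bounded $3\times3$ matrix-valued function on $\mathbb{R}^3$, $2\pi$-periodic in $x_1$ and in $x_2$, and equal to the identity $I_3$ outside a compact set in each period cell. A function $\mathbf{f}:\mathbb{R}^3\to\mathbb{C}^3$ is $\alpha$-quasiperiodic if $\mathbf{f}(x_1+2\pi m_1,x_2+2\pi m_2,x_3)=e^{2\pi i(\alpha_1m_1+\alpha_2m_2)}\mathbf{f}(x_1,x_2,x_3)$ for all $m_1,m_2\in\mathbb{Z}$. Fix $h>0$ with $h>\sup\{|x_3|:\mathbf{x}\in\operatorname{supp}(\varepsilon-I_3)\}$ and set $\Omega=(-\pi,\pi)^2\times\mathbb{R}$, $\Omega_h=(-\pi,\pi)^2\times(-h,h)$, $\Gamma_{\pm r}=(-\pi,\pi)^2\times\{\pm r\}$. For $j=(j_1,j_2)\in\mathbb{Z}^2$ put $\alpha_{1,j}=\alpha_1+j_1$, $\alpha_{2,j}=\alpha_2+j_2$, $\alpha_j=(\alpha_{1,j},\alpha_{2,j},0)^\top$, and $\beta_j=\sqrt{k^2-|\alpha_j|^2}$ if $|\alpha_j|\le k$, $\beta_j=i\sqrt{|\alpha_j|^2-k^2}$ if $|\alpha_j|>k$. Standing assumption: $\beta_j\ne0$ for all $j\in\mathbb{Z}^2$. The $\alpha$-quasiperiodic incident fields $\mathbf{E}^{in}(\cdot,l)$, $l=1,\dots,N$, satisfy $\operatorname{curl}\operatorname{curl}\mathbf{E}^{in}(\cdot,l)-k^2\mathbf{E}^{in}(\cdot,l)=\mathbf{J}(\cdot,l)$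 for given sources $\mathbf{J}(\cdot,l)$. The scattered field $\mathbf{u}=\mathbf{u}(\cdot,l)$ is the weak $\alpha$-quasiperiodic solution of $$\operatorname{curl}\operatorname{curl}\mathbf{u}-k^2\mathbf{u}=k^2(\varepsilon-I_3)(\mathbf{u}+\mathbf{E}^{in}(\cdot,l))$$ satisfying the Rayleigh radiation condition $$\mathbf{u}(\mathbf{x},l)=\begin{cases}\sum_{j\in\mathbb{Z}^2}\mathbf{u}_j^+(l)\,e^{i(\alpha_{1,j}x_1+\alpha_{2,j}x_2+\beta_j(x_3-h))}, & x_3>h,\\ \sum_{j\in\mathbb{Z}^2}\mathbf{u}_j^-(l)\,e^{i(\alpha_{1,j}x_1+\alpha_{2,j}x_2-\beta_j(x_3+h))}, & x_3<-h.\end{cases}$$ The coefficients are $\mathbf{u}_j^{\pm}(l)=\frac{1}{4\pi^2}\int_{\Gamma_{\pm r}}\mathbf{u}(\mathbf{x},l)e^{-i(\alpha_{1,j}x_1+\alpha_{2,j}x_2\pm\beta_j(x_3\mp h))}\,ds(\mathbf{x})$ for any $r\ge h$. Precisely, $\mathbf{u}\in H_{\alpha,\mathrm{loc}}(\operatorname{curl},\Omega)$, the space of $\mathbf{w}\in[L^2_{\mathrm{loc}}(\Omega)]^3$ with $\operatorname{curl}\mathbf{w}\in[L^2_{\mathrm{loc}}(\Omega)]^3$ that are restrictions to $\Omega$ of $\alpha$-quasiperiodic functions, and $$\int_\Omega \operatorname{curl}\mathbf{u}\cdot\operatorname{curl}\overline{\mathbf{v}}-k^2\mathbf{u}\cdot\overline{\mathbf{v}}\,d\mathbf{x}=k^2\int_D(\varepsilon-I_3)(\mathbf{u}+\mathbf{E}^{in}(\cdot,l))\cdot\overline{\mathbf{v}}\,d\mathbf{x}$$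 for all compactly supported $\mathbf{v}\in H_\alpha(\operatorname{curl},\Omega_h)$ (the analogous space on $\Omega_h$ with $L^2$ in place of $L^2_{\mathrm{loc}}$). Standing assumption: this direct problem is well-posed. It is known (and may be assumed) that it is equivalent to the volume integro-differential equation $$\mathbf{u}(\mathbf{x})=(k^2+\nabla_{\mathbf{x}}\operatorname{div}_{\mathbf{x}})\int_D\Phi(\mathbf{x},\mathbf{y})(\varepsilon(\mathbf{y})-I_3)\mathbf{E}(\mathbf{y})\,d\mathbf{y},$$ where $\Phi$ is the scalar $\alpha$-quasiperiodic Green's function $$\Phi(\mathbf{x},\mathbf{y})=\frac{i}{8\pi^2}\sum_{j\in\mathbb{Z}^2}\frac1{\beta_j}e^{i(\alpha_{1,j}(x_1-y_1)+\alpha_{2,j}(x_2-y_2)+\beta_j|x_3-y_3|)}.$$ **Notation in the imaging functional.** Let $r_j^\pm(\mathbf{z})=\frac{i}{8\pi^2\beta_j}e^{-i\alpha_{1,j}z_1-i\alpha_{2,j}z_2+i\beta_j(h\mp z_3)}$; $\gamma^\pm_{1,j}=\alpha_{1,j}$, $\gamma^\pm_{2,j}=\alpha_{2,j}$, $\gamma^\pm_{3,j}=\pm\beta_j$; and $(g^\pm_{mn})_j(\mathbf{z})=\left(\delta_{mn}-\gamma^\pm_{m,j}\gamma^\pm_{n,j}/k^2\right)r_j^\pm(\mathbf{z})$ for $m,n\in\{1,2,3\}$. Then $\mathbf{g}_j^\pm(\mathbf{z})$ is the $3\times3$ matrix with entries $(g^\pm_{mn})_j(\mathbf{z})$, and $\mathbf{h}_j^\pm(\mathbf{z})$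 is the $3\times 3$ matrix with $(m,n)$ entry $\gamma^\pm_{m,j}(g^\pm_{3n})_j(\mathbf{z})$. $\mathbf{A}^*$ is the conjugate transpose of $\mathbf{A}$, and $|\cdot|$ of a vector is its Euclidean norm. **Conventions.** For a scalar function $f$, $\nabla_{\mathbf{x}}\operatorname{div}_{\mathbf{x}}(f I_3)$ is the $3\times3$ matrix with $(m,n)$ entry $\partial^2 f/\partial x_m\partial x_n$ (divergence columnwise, gradient componentwise). The non-absolutely convergent lattice series in $F$ is summed in the same sense as in the standard lattice-sum representation of the quasiperiodic Green's function, $$\Phi(\mathbf{x},\mathbf{y})=\sum_{j\in\mathbb{Z}^2}e^{-i2\pi\alpha\cdot j}\,\frac{e^{ik|\mathbf{x}-\mathbf{y}+(2\pi j_1,2\pi j_2,0)^\top|}}{4\pi|\mathbf{x}-\mathbf{y}+(2\pi j_1,2\pi j_2,0)^\top|},\qquad x_3\ne y_3 .$$ *)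

(* Defs.v *)
From HB Require Import structures.
From mathcomp Require Import all_boot all_order all_algebra finmap.
From mathcomp Require Import all_classical all_reals all_analysis.
From mathcomp Require Import complex.
From mathcomp Require summability.

Set Implicit Arguments.
Unset Strict Implicit.
Unset Printing Implicit Defensive.

Import Order.TTheory GRing.Theory Num.Theory.
Import numFieldNormedType.Exports.

Local Open Scope classical_set_scope.
Local Open Scope ring_scope.
Local Open Scope complex_scope.
Local Open Scope sesquilinear_scope.

Notation Re := complex.Re.
Notation Im := complex.Im.

(* ((x1, x2), x3); as a product type it carries both the product
   sigma-algebra and the normed-space structure. *)
Notation space3 R := (R * R * R)%type.
Notation field3 R := (space3 R -> 'cV[R[i]]_3).

Definition ix1 : 'I_3 := @Ordinal 3 0 isT.
Definition ix2 : 'I_3 := @Ordinal 3 1 isT.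
Definition ix3 : 'I_3 := @Ordinal 3 2 isT.

Section Calculus.
Context {R : realType}.
Local Notation C := R[i].
Local Notation pt := (space3 R).
Implicit Types (x y z : pt) (f : pt -> C) (w : field3 R).

Definition vec3 (a b c : C) : 'cV[C]_3 := \col_(m < 3) [:: a; b; c]`_m.

(* Bilinear: no conjugation. *)
Definition dot (a b : 'cV[C]_3) : C := \sum_m a m 0 * b m 0.

Definition conjv (a : 'cV[C]_3) : 'cV[C]_3 := map_mx Num.conj a.

Definition cnormsq (a : 'cV[C]_3) : R :=
  \sum_m (Re (a m 0) ^+ 2 + Im (a m 0) ^+ 2).

Definition cnorm (a : 'cV[C]_3) : R := Num.sqrt (cnormsq a).

Definition pnorm x : R := Num.sqrt (x.1.1 ^+ 2 + x.1.2 ^+ 2 + x.2 ^+ 2).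

(* The entire function e^{i t}, with t complex. *)
Definition expi (t : C) : C :=
  (expR (- Im t) * cos (Re t)) +i* (expR (- Im t) * sin (Re t)).

(* Spherical Bessel function of the first kind of order 0. *)
Definition j0 (t : R) : R := if t == 0 then 1 else sin t / t.

Definition unitpt (m : 'I_3) : pt :=
  ((m == ix1)%:R, (m == ix2)%:R, (m == ix3)%:R).

Definition partial (m : 'I_3) f : pt -> C := fun x =>
  ('D_(unitpt m) (fun y => Re (f y)) x) +i* ('D_(unitpt m) (fun y => Im (f y)) x).

Definition curl w : field3 R := fun x =>
  let d m n := partial m (fun y => w y n 0) x in
  vec3 (d ix2 ix3 - d ix3 ix2) (d ix3 ix1 - d ix1 ix3) (d ix1 ix2 - d ix2 ix1).

Definition nabla_div f : pt -> 'M[C]_3 := fun x =>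
  \matrix_(m, n) partial m (partial n f) x.

Definition smooth f := forall (s : seq 'I_3) x,
  differentiable (fun y => Re (foldr partial f s y)) x /\
  differentiable (fun y => Im (foldr partial f s y)) x.

Definition cube (r : R) : set pt :=
  [set x | [/\ `|x.1.1| <= r, `|x.1.2| <= r & `|x.2| <= r]].

Definition test_field w :=
  (forall m, smooth (fun x => w x m 0)) /\
  (exists r, forall x, ~ cube r x -> w x = 0).

Definition mu2 := (@lebesgue_measure R \x @lebesgue_measure R)%E.
Definition mu3 := (mu2 \x @lebesgue_measure R)%E.

Definition integral2 (A : set (R * R)) (f : R * R -> C) : C :=
  (\int[mu2]_(q in A) Re (f q))%R +i* (\int[mu2]_(q in A) Im (f q))%R.

Definition integral3 (A : set pt) f : C :=
  (\int[mu3]_(x in A) Re (f x))%R +i* (\int[mu3]_(x in A) Im (f x))%R.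

Definition vintegral3 (A : set pt) w : 'cV[C]_3 :=
  \col_m integral3 A (fun x => w x m 0).

Definition measurable_cfun f :=
  measurable_fun [set: pt] (fun x => Re (f x)) /\
  measurable_fun [set: pt] (fun x => Im (f x)).

Definition Lp_on (p : nat) (A : set pt) w :=
  (forall m, measurable_cfun (fun x => w x m 0)) /\
  mu3.-integrable A (fun x => (cnorm (w x) ^+ p)%:E).

Definition Lp_loc (p : nat) w := forall r, Lp_on p (cube r) w.

(* c is the distributional curl of w on the whole space. *)
Definition weak_curl w c := forall phi, test_field phi ->
  integral3 setT (fun x => dot (w x) (curl phi x)) =
  integral3 setT (fun x => dot (c x) (phi x)).

Definition converges (u : nat -> C) (l : C) :=
  (fun n => Re (u n)) @ \oo --> Re l /\ (fun n => Im (u n)) @ \oo --> Im l.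

Definition clim (u : nat -> C) : C :=
  lim ((fun n => Re (u n)) @ \oo) +i* lim ((fun n => Im (u n)) @ \oo).

End Calculus.

Notation lattice := (int * int)%type.

(* Unconditional summation over the lattice: limits along the directed set of
   finite subsets. *)
Definition lattice_has_sum {R : realType} (a : lattice -> R[i]) (l : R[i]) :=
  (fun A => Re (summability.partial_sum a A)) @ summability.totally --> Re l /\
  (fun A => Im (summability.partial_sum a A)) @ summability.totally --> Im l.

Definition lattice_sum {R : realType} (a : lattice -> R[i]) : R[i] :=
  lim ((fun A => Re (summability.partial_sum a A)) @ summability.totally) +i*
  lim ((fun A => Im (summability.partial_sum a A)) @ summability.totally).

Section Scattering.
Context {R : realType}.
Local Notation C := R[i].
Local Notation pt := (space3 R).
Variables (k : R) (alpha : R * R) (h : R) (eps : pt -> 'M[C]_3).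
Implicit Types (x y z : pt) (j : lattice) (w v : field3 R).

Definition cell2 : set (R * R) :=
  [set q | (- pi < q.1 < pi) && (- pi < q.2 < pi)].

Definition Omega : set pt := [set x | cell2 x.1].

Definition Omega_r (r : R) : set pt := [set x | cell2 x.1 /\ - r < x.2 < r].

Definition shift j : pt := (pi *+ 2 * j.1%:~R, pi *+ 2 * j.2%:~R, 0).

Definition phase j : C := expi (pi *+ 2 * (alpha.1 * j.1%:~R + alpha.2 * j.2%:~R))%:C.

Definition quasiperiodic w :=
  forall (j : lattice) x, w (x + shift j) = phase j *: w x.

Definition alpha1 j : R := alpha.1 + j.1%:~R.
Definition alpha2 j : R := alpha.2 + j.2%:~R.
Definition alpha_norm j : R := Num.sqrt (alpha1 j ^+ 2 + alpha2 j ^+ 2).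

Definition beta j : C :=
  if alpha_norm j <= k then (Num.sqrt (k ^+ 2 - alpha_norm j ^+ 2)) +i* 0
  else 0 +i* (Num.sqrt (alpha_norm j ^+ 2 - k ^+ 2)).

Definition green x y : C :=
  'i / (8 * pi ^+ 2)%:C * lattice_sum (fun j => (beta j)^-1 *
    expi ((alpha1 j * (x.1.1 - y.1.1) + alpha2 j * (x.1.2 - y.1.2))%:C
          + beta j * `|x.2 - y.2|%:C)).

(* S n is an increasing exhaustion of the lattice by finite sets invariant
   under j |-> - j. *)
Definition lattice_exhaustion (S : nat -> {fset lattice}) :=
  [/\ forall n, (S n `<=` S n.+1)%fset,
      forall j, exists n, j \in S n
    & forall n j, (- j \in S n) = (j \in S n)].

(* The lattice series is only conditionally convergent, so that its sum depends
   on the order of summation.  An admissible order is an exhaustion along which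
   the spherical-wave representation of the quasiperiodic Green's function
   holds; F below is summed along the same exhaustion. *)
Definition lattice_representation (S : nat -> {fset lattice}) :=
  lattice_exhaustion S /\
  forall x y, x.2 != y.2 ->
    converges (fun n => \sum_(j <- S n) (phase j)^-1 *
        (expi (k * pnorm (x - y + shift j))%:C /
          (4 * pi * pnorm (x - y + shift j))%:C))
      (green x y).

Definition Fker (S : nat -> {fset lattice}) x y : C :=
  (k / (4 * pi) * j0 (k * pnorm (x - y)))%:C +
  clim (fun n => \sum_(j <- S n | j != 0)
    k%:C * (phase j)^-1 / (4 * pi)%:C * (j0 (k * pnorm (x - y + shift j)))%:C).

Definition FFker (S : nat -> {fset lattice}) x y : 'M[C]_3 :=
  (Fker S x y)%:M + (k ^+ 2)%:C^-1 *: nabla_div (fun x' => Fker S x' y) x.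

Definition supp_contrast : set pt := closure [set x | eps x != 1%:M].

Definition D : set pt := supp_contrast `&` Omega.

Record medium : Prop := Medium {
  medium_measurable : forall m n, measurable_cfun (fun x => eps x m n);
  medium_bounded : exists M, forall x m n, `|eps x m n| <= M%:C;
  medium_periodic : forall x j, eps (x + shift j) = eps x;
  medium_compact : exists2 K : set pt, compact K &
    forall x, Omega x -> ~ K x -> eps x = 1%:M }.

(* The supremum is taken in the extended reals: it is -oo for an empty support
   and +oo for an unbounded one. *)
Definition supp_height : \bar R :=
  ereal_sup [set `|x.2|%:E | x in supp_contrast].

(* w belongs to H_{alpha,loc}(curl, Omega) and c is its curl.  The fields are
   taken on the whole space, so that the curl has no jump part on the lateral
   boundary of the period cell. *)
Definition Hcurl_loc w c :=
  [/\ quasiperiodic w, Lp_loc 2 w, Lp_loc 2 c & weak_curl w c].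

(* Compact support is understood modulo the periodicity: v vanishes outside a
   slab |x3| < r, with no condition near the lateral boundary of the cell.
   Every slab is allowed, so that the equation is tested across |x3| = h. *)
Definition test_Hcurl v c :=
  Hcurl_loc v c /\ exists r, forall x, r <= `|x.2| -> v x = 0.

Record incident (E J : field3 R) : Prop := Incident {
  incident_quasiperiodic : quasiperiodic E;
  incident_L1loc : Lp_loc 1 E;
  incident_L2 : Lp_on 2 D E;
  source_L1loc : Lp_loc 1 J;
  incident_eq : forall phi, test_field phi ->
    integral3 setT (fun x => dot (E x) (curl (curl phi) x)
                             - (k ^+ 2)%:C * dot (E x) (phi x)) =
    integral3 setT (fun x => dot (J x) (phi x)) }.

Definition maxwell (E u c : field3 R) :=
  Hcurl_loc u c /\
  forall v cv, test_Hcurl v cv ->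
    integral3 Omega (fun x => dot (c x) (conjv (cv x))
                              - (k ^+ 2)%:C * dot (u x) (conjv (v x))) =
    (k ^+ 2)%:C * integral3 D (fun x =>
      dot ((eps x - 1%:M) *m (u x + E x)) (conjv (v x))).

Definition rayleigh (u : field3 R) (up um : lattice -> 'cV[C]_3) :=
  (forall x m, h < x.2 -> lattice_has_sum (fun j => up j m 0 *
      expi ((alpha1 j * x.1.1 + alpha2 j * x.1.2)%:C + beta j * (x.2 - h)%:C))
    (u x m 0)) /\
  (forall x m, x.2 < - h -> lattice_has_sum (fun j => um j m 0 *
      expi ((alpha1 j * x.1.1 + alpha2 j * x.1.2)%:C - beta j * (x.2 + h)%:C))
    (u x m 0)).

Definition rayleigh_coefficients (u : field3 R) (up um : lattice -> 'cV[C]_3) :=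
  forall r j m, h <= r ->
  up j m 0 = (4 * pi ^+ 2)%:C^-1 * integral2 cell2 (fun q => u (q, r) m 0 *
    expi (- ((alpha1 j * q.1 + alpha2 j * q.2)%:C + beta j * (r - h)%:C))) /\
  um j m 0 = (4 * pi ^+ 2)%:C^-1 * integral2 cell2 (fun q => u (q, - r) m 0 *
    expi (- ((alpha1 j * q.1 + alpha2 j * q.2)%:C - beta j * (- r + h)%:C))).

Record scattered (E u : field3 R) (up um : lattice -> 'cV[C]_3) : Prop :=
  Scattered {
    scattered_maxwell : exists c, maxwell E u c;
    scattered_rayleigh : rayleigh u up um;
    scattered_coefficients : rayleigh_coefficients u up um }.

(* Well-posedness in the sense of Hadamard; fields are identified when equal
   almost everywhere. *)
Definition well_posed :=
  [/\ forall E J, incident E J -> exists u up um, scattered E u up um,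
      forall E J u u' up up' um um', incident E J ->
        scattered E u up um -> scattered E u' up' um' ->
        {ae mu3, forall x, u x = u' x}
    & forall r, exists M, forall E J u c up um, incident E J ->
        scattered E u up um -> maxwell E u c ->
        (\int[mu3]_(x in Omega_r r) (cnormsq (u x) + cnormsq (c x)) <=
         M * \int[mu3]_(x in D) cnormsq (E x))%R].

(* b = true stands for the superscript +, b = false for -. *)
Definition pm (b : bool) : R := if b then 1 else - 1.

Definition gam (b : bool) j : 'cV[C]_3 :=
  vec3 (alpha1 j)%:C (alpha2 j)%:C ((pm b)%:C * beta j).

Definition rcoef (b : bool) j z : C :=
  'i / ((8 * pi ^+ 2)%:C * beta j) *
  expi (- (alpha1 j * z.1.1)%:C - (alpha2 j * z.1.2)%:C
        + beta j * (h - pm b * z.2)%:C).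

Definition gmat (b : bool) j z : 'M[C]_3 := \matrix_(m, n)
  (((m == n)%:R - gam b j m 0 * gam b j n 0 / (k ^+ 2)%:C) * rcoef b j z).

Definition hmat (b : bool) j z : 'M[C]_3 := \matrix_(m, n)
  (gam b j m 0 * gmat b j z ix3 n).

Definition imaging_term (up um : lattice -> 'cV[C]_3) z j : 'cV[C]_3 :=
  let re2 := (2 * Re (beta j))%:C in
  (hmat true j z - re2 *: gmat true j z)^t* *m up j
  + up j ix3 0 *: ((gmat true j z)^t* *m vec3 (alpha1 j)%:C (alpha2 j)%:C (beta j))
  - (hmat false j z + re2 *: gmat false j z)^t* *m um j
  - um j ix3 0 *: ((gmat false j z)^t* *m vec3 (alpha1 j)%:C (alpha2 j)%:C (- beta j)).

Definition imaging (N : nat) (up um : 'I_N -> lattice -> 'cV[C]_3) (p : R) z : R :=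
  \sum_(l < N)
    cnorm (\col_m lattice_sum (fun j => imaging_term (up l) (um l) z j m 0)) `^ p.

End Scattering.

(* Main.v *)
(** Testing the weak formulation against cut-off plane waves with wave vector
    gamma_j^b and transversal amplitude v shows that the Rayleigh coefficients
    U_j^b satisfy gamma_j^b . U_j^b = 0 and that U_j^b . v is k^2 times the
    integral over D of r_j^b times the v-component of (eps - 1) E.
    Transversality makes the h-terms of the imaging functional cancel the
    u_3-terms, for evanescent modes too, so that only the finitely many
    propagating modes remain, with weight 2 Re beta_j.  On the other side F is
    (Phi(x,y) - conj Phi(y,x)) / 2i; in the plane-wave expansion of this
    difference the evanescent terms cancel, so that for x3 <> y3 the kernel F is
    the sum over the propagating modes of e^(i gamma_j^b . (x - y)) / (16 pi^2
    beta_j).  The plane y3 = z3, where this is not available, is a null set. *)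
Require Import Defs.
From HB Require Import structures.
From mathcomp Require Import all_boot all_order all_algebra finmap.
From mathcomp Require Import all_classical all_reals all_analysis.
From mathcomp Require Import measurable_realfun complex zify ring lra.
From mathcomp Require summability.
Import Order.TTheory GRing.Theory Num.Theory.
Import numFieldNormedType.Exports.

Set Implicit Arguments.
Unset Strict Implicit.
Unset Printing Implicit Defensive.

Local Open Scope classical_set_scope.
Local Open Scope ring_scope.
Local Open Scope complex_scope.

Local Notation Re := complex.Re.
Local Notation Im := complex.Im.
Local Existing Instance summability.totally_filter.

(** What is known about u outside the source region are its integrals over the slices of the period
    cell at |x3| >= h. The cut-off plane waves are therefore built so that their Maxwell residual
    vanishes for |x3| < h: on the left-hand side the unknown inner field drops out, and Fubini
    leaves an integral in x3 alone. Its integrand is an exact derivative, so that only boundary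
    values at x3 = h and x3 = -h survive. The prefactor i / (8 pi^2 beta_j) of r_j is the inverse of
    4 pi^2, the area of the cell, times -2 i beta_j.

    A mode has no lateral decay, whereas the curl of u is a distribution tested against compactly
    supported fields. The passage to one period cell uses a lateral cutoff whose derivative is a
    difference of two translates by a period: against a periodic integrand it contributes nothing.

    The subtracted Green's function is conj Phi(y,x), not conj Phi(x,y), because conjugation inverts
    the quasiperiodicity phase; exchanging x and y restores it after j is replaced by -j, which is
    why the partial sums must run over symmetric sets. *)

(** * Translation invariance of Lebesgue measure on R^3 *)

Section MeasurePreserving.
Local Open Scope ereal_scope.
Context d1 d2 (T1 : measurableType d1) (T2 : measurableType d2) {R : realType}.
Variable m1 : {sigma_finite_measure set T1 -> \bar R}.
Variable m2 : {sigma_finite_measure set T2 -> \bar R}.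
Variables (f1 : T1 -> T1) (f2 : T2 -> T2).
Hypothesis mf1 : measurable_fun setT f1.
Hypothesis mf2 : measurable_fun setT f2.
Hypothesis pf1 : forall A, measurable A -> m1 (f1 @^-1` A) = m1 A.
Hypothesis pf2 : forall A, measurable A -> m2 (f2 @^-1` A) = m2 A.
Let f (x : T1 * T2) := (f1 x.1, f2 x.2).

Lemma measurable_prod_map : measurable_fun setT f.
Proof.
by apply/measurable_fun_pair; [exact: (measurableT_comp mf1 measurable_fst)|
  exact: (measurableT_comp mf2 measurable_snd)].
Qed.

(** The pushforward of the product measure agrees with it on rectangles, hence everywhere by
    uniqueness of product measures. *)
Lemma product_measure_preserving A : measurable A ->
  (m1 \x m2) (f @^-1` A) = (m1 \x m2) A.
Proof.
move=> mA; have := measurable_prod_map => mf.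
rewrite [RHS](@product_measure_unique _ _ _ _ _ _ _ (pushforward (m1 \x m2) f))//.
move=> B C mB mC; rewrite -(pf1 mB) -(pf2 mC).
rewrite -product_measure1E//.
  by rewrite -[X in measurable X]setTI; exact: mf1.
by rewrite -[X in measurable X]setTI; exact: mf2.
Qed.

End MeasurePreserving.

Section SigmaFiniteProduct.
Context {R : realType}.
Local Notation mR := (measurableTypeR R).

(** The same set function as [mu2], typed as a measure. Its structure and its sigma-finiteness are
    attached to the constant [mu2] below, so that product-measure and Fubini results apply to
    [mu3]. *)
Let mu2M : {measure set (mR * mR) -> \bar R} :=
  (@lebesgue_measure R \x @lebesgue_measure R)%E.

Let mu2_sigma_finite : sigma_finite setT mu2M.
Proof.
have /sigma_finiteP[F [TF ndF Foo]] := sigma_finiteT (@lebesgue_measure R).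
exists (fun n => F n `*` F n).
  rewrite -setXTT TF predeqE => -[x y]; split.
    move=> [/= [n _ Fnx] [k _ Fky]]; exists (maxn n k) => //; split.
    - by move: x Fnx; exact/subsetPset/ndF/leq_maxl.
    - by move: y Fky; exact/subsetPset/ndF/leq_maxr.
  by move=> [n _ []/= ? ?]; split; exists n.
move=> k; have [? ?] := Foo k; split; first exact: measurableX.
have -> : mu2M (F k `*` F k) = (lebesgue_measure (F k) * lebesgue_measure (F k))%E.
  exact: product_measure1E.
by rewrite lte_mul_pinfty// ge0_fin_numE.
Qed.

HB.instance Definition _ := Measure.copy (@mu2 R) mu2M.
HB.instance Definition _ := Measure_isSigmaFinite.Build _ _ _ (@mu2 R) mu2_sigma_finite.

End SigmaFiniteProduct.

Section Translation.
Context {R : realType}.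
Local Notation pt := (space3 R).
Local Notation mR := (measurableTypeR R).

Lemma measurable_translate (a : R) : measurable_fun setT (fun x : R => x + a).
Proof. by apply: measurable_funD => //; exact: measurable_cst. Qed.

Lemma lebesgue_measure_translate (a : R) (A : set R) : measurable A ->
  lebesgue_measure ((fun x => x + a) @^-1` A) = lebesgue_measure A.
Proof.
move=> mA; pose m := pushforward (@lebesgue_measure R)
  (fun x : measurableTypeR R => (x + a : measurableTypeR R)).
have mf : measurable_fun setT (fun x : measurableTypeR R => (x + a : measurableTypeR R)).
  exact: measurable_translate.
apply/esym/(@lebesgue_measure_unique _ m) => //= _ [[b c]] _ <-.
rewrite /m /pushforward/=.
rewrite (_ : _ @^-1` _ = `](b - a), (c - a)]%classic); last first.
  by apply/seteqP; split => x /=; rewrite !in_itv/= ltrBlDr lerBrDr.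
rewrite !lebesgue_measure_itv/= !lte_fin ltrD2r; case: ifP => // _.
by rewrite -!EFinB; congr (_%:E); lra.
Qed.

Lemma measurable_translate3 (v : pt) : measurable_fun setT (fun x : pt => x + v).
Proof.
case: v => [[a b] c].
exact: (measurable_prod_map (measurable_prod_map (measurable_translate a)
  (measurable_translate b)) (measurable_translate c)).
Qed.

Let preserving3 (v : pt) (A : set (mR * mR * mR)) : measurable A ->
  mu3 ((fun x : pt => x + v) @^-1` A) = mu3 A.
Proof.
case: v => [[a b] c].
have H2 : forall B : set (mR * mR), measurable B -> mu2 ((fun x : R * R => (x.1 + a, x.2 + b)) @^-1` B) = @mu2 R B.
  move=> B mB.
  apply: (@product_measure_preserving _ _ mR mR R lebesgue_measure lebesgue_measure (fun x => x + a) (fun x => x + b) _ _ _ _ B mB);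
  [exact: measurable_translate|exact: measurable_translate|exact: lebesgue_measure_translate|exact: lebesgue_measure_translate].
move=> mA.
have := @product_measure_preserving _ _ (mR * mR)%type mR R mu2 lebesgue_measure (fun x : R * R => (x.1 + a, x.2 + b)) (fun x => x + c) _ _ H2 _ A mA.
apply.
- exact: (measurable_prod_map (measurable_translate a) (measurable_translate b)).
- exact: measurable_translate.
- exact: lebesgue_measure_translate.
Qed.

Lemma integral_translate (v : pt) (f : mR * mR * mR -> \bar R) :
  mu3.-integrable setT f ->
  mu3.-integrable setT (fun x : mR * mR * mR => f ((x : pt) + v)) /\
  (\int[mu3]_x f ((x : pt) + v)%R = \int[mu3]_x f x)%E.
Proof.
move=> fint; have mf := measurable_int _ fint.
case/integrableP : fint => _ fi.
pose t (x : mR * mR * mR) : mR * mR * mR := (x : pt) + v.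
have mt : measurable_fun setT t by exact: measurable_translate3.
have eqm (f' : mR * mR * mR -> \bar R) : (\int[pushforward mu3 t]_x f' x = \int[mu3]_x f' x)%E.
  by apply: eq_measure_integral => A mA _; exact: preserving3.
have i2 : mu3.-integrable setT (f \o t).
  apply/integrableP; split; first exact: measurableT_comp mf mt.
  move: fi; rewrite -eqm ge0_integral_pushforward//.
  exact: measurableT_comp.
by split => //; rewrite -[RHS]eqm (integral_pushforward mt mf i2).
Qed.

End Translation.

(** * Complex moduli and complex-valued integrals *)

Section ComplexScalars.
Context {R : realType}.
Implicit Types (z w : R[i]) (a b : R).

Lemma cReD z w : Re (z + w) = Re z + Re w. Proof. by move: z w => [a b] [c d]. Qed.
Lemma cImD z w : Im (z + w) = Im z + Im w. Proof. by move: z w => [a b] [c d]. Qed.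
Lemma cReN z : Re (- z) = - Re z. Proof. by case: z. Qed.
Lemma cImN z : Im (- z) = - Im z. Proof. by case: z. Qed.
Lemma cReM z w : Re (z * w) = Re z * Re w - Im z * Im w.
Proof. by move: z w => [a b] [c d]. Qed.
Lemma cImM z w : Im (z * w) = Re z * Im w + Im z * Re w.
Proof. by move: z w => [a b] [c d]. Qed.
Lemma complex_ext z w : Re z = Re w -> Im z = Im w -> z = w.
Proof. by case: z; case: w => ? ? ? ? /= -> ->. Qed.

(** The modulus as an element of [R]: the norm on [R[i]] takes its values in [R[i]]. *)
Definition cabs z : R := Num.sqrt (Re z ^+ 2 + Im z ^+ 2).

Lemma normE z : `|z| = (cabs z)%:C. Proof. by rewrite normc_def. Qed.

Lemma cabs_ge0 z : 0 <= cabs z. Proof. exact: Num.Theory.sqrtr_ge0. Qed.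

Lemma cabsM z w : cabs (z * w) = cabs z * cabs w.
Proof. by apply: (@complexI R); move: (normrM z w); rewrite !normE -rmorphM. Qed.

Lemma cabsD z w : cabs (z + w) <= cabs z + cabs w.
Proof. by move: (ler_normD z w); rewrite !normE -rmorphD lecR. Qed.

Lemma cabsN z : cabs (- z) = cabs z.
Proof. by rewrite /cabs cReN cImN !sqrrN. Qed.

Lemma cabs0 : cabs (0 : R[i]) = 0.
Proof. by rewrite /cabs /= expr0n/= addr0 sqrtr0. Qed.

Lemma cabs_real a : cabs a%:C = `|a|.
Proof. by rewrite /cabs /= expr0n/= addr0 sqrtr_sqr. Qed.

Lemma Re_le_cabs z : `|Re z| <= cabs z.
Proof. by rewrite -sqrtr_sqr ler_sqrt// ?lerDl ?addr_ge0 ?sqr_ge0. Qed.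

Lemma Im_le_cabs z : `|Im z| <= cabs z.
Proof. by rewrite -sqrtr_sqr ler_sqrt// ?lerDr ?addr_ge0 ?sqr_ge0. Qed.

Lemma cabs_le z : cabs z <= `|Re z| + `|Im z|.
Proof.
rewrite -[leRHS]ger0_norm ?addr_ge0// -sqrtr_sqr ler_sqrt ?sqr_ge0//.
rewrite sqrrD !real_normK ?num_real// -addrA lerD2l lerDr.
by rewrite mulrn_wge0// mulr_ge0.
Qed.

End ComplexScalars.

Section ComplexIntegral.
Context d (T : measurableType d) {R : realType}.
Variable mu : {measure set T -> \bar R}.
Implicit Types (f g : T -> R[i]) (A B : set T) (c : R[i]).

Definition cmeas f := measurable_fun setT (fun x => Re (f x)) /\
  measurable_fun setT (fun x => Im (f x)).

(** Measurability is required on the whole space and only integrability on [A], so that changing [A]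
    or multiplying by an indicator raises no new measurability question. *)
Definition cintegrable A f :=
  cmeas f /\ mu.-integrable A (fun x => (cabs (f x))%:E).

Definition cint A f : R[i] :=
  (\int[mu]_(x in A) Re (f x))%R +i* (\int[mu]_(x in A) Im (f x))%R.

Lemma cmeasD f g : cmeas f -> cmeas g -> cmeas (fun x => f x + g x).
Proof.
move=> [rf jf] [rg jg]; split.
  by under eq_fun do rewrite cReD; exact: measurable_funD.
by under eq_fun do rewrite cImD; exact: measurable_funD.
Qed.

Lemma cmeasM f g : cmeas f -> cmeas g -> cmeas (fun x => f x * g x).
Proof.
move=> [rf jf] [rg jg]; split.
  by under eq_fun do rewrite cReM; apply: measurable_funB; exact: measurable_funM.
by under eq_fun do rewrite cImM; apply: measurable_funD; exact: measurable_funM.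
Qed.

Lemma cmeas_cst c : cmeas (fun=> c).
Proof. by split; exact: measurable_cst. Qed.

Lemma cmeas_real (f : T -> R) : measurable_fun setT f -> cmeas (fun x => (f x)%:C).
Proof. by move=> mf; split => //=; exact: measurable_cst. Qed.

Lemma cmeas_indic A : measurable A -> cmeas (fun x => (\1_A x)%:C).
Proof. by move=> mA; apply: cmeas_real; exact: measurable_indic. Qed.

Lemma cmeas_cabs f : cmeas f -> measurable_fun setT (fun x => cabs (f x)).
Proof.
move=> [rf jf].
apply: (measurableT_comp (continuous_measurable_fun (@sqrt_continuous R))).
by apply: measurable_funD; exact: measurable_funX.
Qed.

Lemma cintegrable_Re A f : measurable A -> cintegrable A f ->
  mu.-integrable A (EFin \o (fun x => Re (f x))).
Proof.
move=> mA [[rf jf] fi]; apply: le_integrable fi => //.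
  by apply/measurable_EFinP; exact: measurable_funTS.
by move=> x _ /=; rewrite lee_fin (le_trans (Re_le_cabs _))// ler_norm.
Qed.

Lemma cintegrable_Im A f : measurable A -> cintegrable A f ->
  mu.-integrable A (EFin \o (fun x => Im (f x))).
Proof.
move=> mA [[rf jf] fi]; apply: le_integrable fi => //.
  by apply/measurable_EFinP; exact: measurable_funTS.
by move=> x _ /=; rewrite lee_fin (le_trans (Im_le_cabs _))// ler_norm.
Qed.

Lemma cintegrable_le A f (g : T -> R) : measurable A -> cmeas f ->
  mu.-integrable A (EFin \o g) -> (forall x, A x -> cabs (f x) <= g x) ->
  cintegrable A f.
Proof.
move=> mA mf gi fg; split => //; apply: le_integrable gi => //.
  by apply/measurable_EFinP; apply: measurable_funTS; exact: cmeas_cabs.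
move=> x Ax /=; rewrite lee_fin ger0_norm ?cabs_ge0// (le_trans (fg _ Ax))//.
exact: ler_norm.
Qed.

Lemma cintegrableS A B f : measurable A -> measurable B -> B `<=` A ->
  cintegrable A f -> cintegrable B f.
Proof. by move=> mA mB BA [mf fi]; split => //; exact: integrableS fi. Qed.

Lemma cintegrableD A f g : measurable A -> cintegrable A f ->
  cintegrable A g -> cintegrable A (fun x => f x + g x).
Proof.
move=> mA [mf fi] [mg gi].
apply: (@cintegrable_le _ _ (fun x => cabs (f x) + cabs (g x))) => //.
- exact: cmeasD.
- exact: (integrableD mA fi gi).
- by move=> x _; exact: cabsD.
Qed.

Lemma cintegrableM A f g (M : R) : measurable A -> cmeas g ->
  (forall x, A x -> cabs (g x) <= M) -> cintegrable A f ->
  cintegrable A (fun x => g x * f x).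
Proof.
move=> mA mg gM [mf fi].
apply: (@cintegrable_le _ _ (fun x => M * cabs (f x))) => //.
- exact: cmeasM.
- exact: (integrableZl mA M fi).
- by move=> x Ax; rewrite cabsM ler_wpM2r ?cabs_ge0// gM.
Qed.

Lemma cintegrableZ A f c : measurable A -> cintegrable A f ->
  cintegrable A (fun x => c * f x).
Proof.
move=> mA; apply: (@cintegrableM _ _ (fun=> c) (cabs c)) => //.
Qed.

Lemma cintegrable0 A : measurable A -> cintegrable A (fun=> 0).
Proof.
move=> mA; split; first exact: cmeas_cst.
by rewrite cabs0; exact: integrable0.
Qed.

Lemma cintegrable_sum A I (s : seq I) (F : I -> T -> R[i]) : measurable A ->
  (forall i, cintegrable A (F i)) ->
  cintegrable A (fun x => \sum_(i <- s) F i x).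
Proof.
move=> mA iF; elim: s => [|i s IH].
  by under eq_fun do rewrite big_nil; exact: cintegrable0.
by under eq_fun do rewrite big_cons; exact: cintegrableD.
Qed.

Lemma cintegrable_indic A f : measurable A ->
  cintegrable A f <-> cintegrable setT (fun x => (\1_A x)%:C * f x) /\ cmeas f.
Proof.
move=> mA; have E : (fun x => (cabs ((\1_A x)%:C * f x))%:E) =
    ((fun x => (cabs (f x))%:E) \_ A).
  apply/funext => x; rewrite /patch cabsM cabs_real indicE.
  by case: (x \in A); rewrite /= ?normr1 ?normr0 ?mul1r ?mul0r.
split=> [[mf fi]|[[mf fi] mg]].
  split => //; split; first exact: cmeasM (cmeas_indic mA) mf.
  by rewrite E; apply/(integrable_mkcond _ mA).
by split => //; apply/(integrable_mkcond _ mA); rewrite -E.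
Qed.

Lemma cint_indic A f : cint A f = cint setT (fun x => (\1_A x)%:C * f x).
Proof.
rewrite /cint [in LHS]Rintegral_mkcond [X in _ +i* X = _]Rintegral_mkcond.
by congr (_ +i* _); apply: eq_Rintegral => x _;
  rewrite /patch indicE ?cReM ?cImM/=; case: ifP => _ /=;
  rewrite ?(mul1r,mul0r,mulr0,subr0,addr0).
Qed.

Lemma eq_cint A f g : (forall x, A x -> f x = g x) -> cint A f = cint A g.
Proof.
by move=> fg; congr (_ +i* _); apply: eq_Rintegral => x /set_mem Ax; rewrite fg.
Qed.

Lemma cintD A f g : measurable A -> cintegrable A f -> cintegrable A g ->
  cint A (fun x => f x + g x) = cint A f + cint A g.
Proof.
move=> mA fi gi; rewrite /cint; apply: complex_ext => /=.
  under eq_Rintegral do rewrite cReD.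
  by rewrite RintegralD//; exact: cintegrable_Re.
under eq_Rintegral do rewrite cImD.
by rewrite RintegralD//; exact: cintegrable_Im.
Qed.

Lemma cintZ A f c : measurable A -> cintegrable A f ->
  cint A (fun x => c * f x) = c * cint A f.
Proof.
move=> mA fi; have rf := cintegrable_Re mA fi; have jf := cintegrable_Im mA fi.
have zi a h : mu.-integrable A (EFin \o h) -> mu.-integrable A (EFin \o (fun x => a * h x)).
  by move=> hi; exact: (integrableZl mA a hi).
rewrite /cint; apply: complex_ext; rewrite ?cReM ?cImM /=.
  under eq_Rintegral do rewrite cReM.
  by rewrite RintegralB//; [rewrite !RintegralZl|exact: zi|exact: zi].
under eq_Rintegral do rewrite cImM.
by rewrite RintegralD//; [rewrite !RintegralZl|exact: zi|exact: zi].
Qed.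

Lemma cint0 A : cint A (fun=> 0) = 0.
Proof. by apply: complex_ext; rewrite /= /Rintegral integral0. Qed.

Lemma cint_sum A I (s : seq I) (F : I -> T -> R[i]) : measurable A ->
  (forall i, cintegrable A (F i)) ->
  cint A (fun x => \sum_(i <- s) F i x) = \sum_(i <- s) cint A (F i).
Proof.
move=> mA iF; elim: s => [|i s IH].
  rewrite big_nil -[RHS](cint0 A); apply: eq_cint => x _; exact: big_nil.
rewrite big_cons -IH -cintD//; last exact: cintegrable_sum.
by apply: eq_cint => x _; rewrite big_cons.
Qed.

Lemma cint_null A N f : measurable A -> measurable N -> mu N = 0%E ->
  cintegrable A f -> cint A f = cint (A `\` N) f.
Proof.
move=> mA mN N0 fi; congr (_ +i* _); rewrite /Rintegral; congr fine;
  apply: negligible_integral => //.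
  exact: cintegrable_Re.
exact: cintegrable_Im.
Qed.

Lemma Rintegral_dominated A (F : nat -> T -> R) (f g : T -> R) :
  measurable A -> (forall n, measurable_fun setT (F n)) ->
  measurable_fun setT f -> mu.-integrable A (EFin \o g) ->
  (forall x, A x -> (fun n => F n x) @ \oo --> f x) ->
  (forall n x, A x -> `|F n x| <= g x) ->
  (fun n => \int[mu]_(x in A) F n x) @ \oo --> \int[mu]_(x in A) f x.
Proof.
move=> mA mF mf gi Ff Fg.
have [|||||fi _ cv] := @dominated_convergence _ _ _ mu A mA
  (fun n x => (F n x)%:E) (fun x => (f x)%:E) (EFin \o g).
- by move=> n; apply/measurable_EFinP; exact: measurable_funTS.
- by apply/measurable_EFinP; exact: measurable_funTS.
- by apply: aeW => x Ax; apply: cvg_EFin; [exact: nearW|exact: Ff].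
- exact: gi.
- by apply: aeW => x n Ax; rewrite lee_fin Fg.
by apply: fine_cvg; rewrite fineK//; exact: integrable_fin_num.
Qed.

Lemma cint_dominated A (F : nat -> T -> R[i]) f (g : T -> R) : measurable A ->
  (forall n, cmeas (F n)) -> cmeas f -> mu.-integrable A (EFin \o g) ->
  (forall x, A x -> converges (fun n => F n x) (f x)) ->
  (forall n x, A x -> cabs (F n x) <= g x) ->
  converges (fun n => cint A (F n)) (cint A f).
Proof.
move=> mA mF mf gi Ff Fg; split; apply: (Rintegral_dominated (g := g)) => //.
- by move=> n; have [] := mF n.
- by have [] := mf.
- by move=> x /Ff[].
- by move=> n x /(Fg n); apply: le_trans; exact: Re_le_cabs.
- by move=> n; have [] := mF n.
- by have [] := mf.
- by move=> x /Ff[].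
- by move=> n x /(Fg n); apply: le_trans; exact: Im_le_cabs.
Qed.

End ComplexIntegral.

(** * Borel sets and null planes of R^3 *)

Section Space3.
Context {R : realType}.
Local Notation pt := (space3 R).
Local Notation mR := (measurableTypeR R).
Local Notation mpt := (mR * mR * mR)%type.

Let box (q : rat * rat * rat * nat) : set pt :=
  [set x | [/\ `|x.1.1 - ratr q.1.1.1| < q.2.+1%:R^-1,
    `|x.1.2 - ratr q.1.1.2| < q.2.+1%:R^-1 &
    `|x.2 - ratr q.1.2| < q.2.+1%:R^-1]].

Let measurable_box q : measurable (box q : set mpt).
Proof.
have mI (c e : R) : measurable ([set t : mR | `|t - c| < e]).
  rewrite (_ : [set _ | _] = `](c - e), (c + e)[%classic) ?measurable_itv//.
  by apply/seteqP; split => t /=; rewrite in_itv/= ltr_distl.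
rewrite (_ : box q = ([set t : mR | `|t - ratr q.1.1.1| < q.2.+1%:R^-1] `*`
   [set t : mR | `|t - ratr q.1.1.2| < q.2.+1%:R^-1]) `*`
   [set t : mR | `|t - ratr q.1.2| < q.2.+1%:R^-1]).
  by apply: measurableX => //; exact: measurableX.
by apply/seteqP; split => -[[a b] c] /=; [move=> [? ? ?]|move=> [[? ?] ?]].
Qed.

(** The sigma-algebra is the product one, while openness refers to the product topology. The two
    meet in the countable family of boxes with rational centres. *)
Lemma open_measurable3 (A : set pt) : open A -> measurable (A : set mpt).
Proof.
move=> oA; rewrite (_ : A = \bigcup_(q in [set q | box q `<=` A]) box q).
  rewrite bigcup_mkcond; apply: countable_bigcupT_measurable => [|q].
    exact: countableP.
  by case: ifP => // _; exact: measurable_box.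
apply/seteqP; split => [x Ax|x [q /= qA]]; last exact: qA.
have /nbhs_ballP[e /= e0 eA] := open_nbhs_nbhs (conj oA Ax).
(* The factor 2 is needed because [x] and a point of the box are compared through the rational
   centre. *)
have [n] : exists n : nat, 2 * n.+1%:R^-1 < e :> R.
  have [n _ /(_ n (leqnn n))] : \forall n \near \oo, (n.+1%:R^-1 : R) < e / 2.
    by apply: (near_infty_natSinv_lt (PosNum _)); rewrite divr_gt0.
  by exists n; rewrite mulrC -ltr_pdivlMr.
move=> ne; have n0 : 0 < n.+1%:R^-1 :> R by rewrite invr_gt0 ltr0n.
have [d dE] : exists d : R, d = n.+1%:R^-1 by eexists.
rewrite -dE in ne n0.
have rq (t : R) : exists q : rat, `|t - ratr q| < d.
  have [q] := @rat_in_itvoo R (t - d) (t + d) ltac:(lra).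
  by rewrite in_itv/= => /andP[? ?]; exists q; rewrite ltr_distlC; apply/andP; split; lra.
have [q1 h1] := rq x.1.1; have [q2 h2] := rq x.1.2; have [q3 h3] := rq x.2.
exists (q1, q2, q3, n); rewrite /box/= -dE //= => y [/= k1 k2 k3]; apply: eA.
have tr (a b c : R) : `|a - c| < d -> `|b - c| < d -> `|a - b| < e.
  by move=> ha hb; have := ler_distD c a b; rewrite (distrC c b); lra.
split => /=; last exact: tr h3 k3.
by split; [exact: tr h1 k1|exact: tr h2 k2].
Qed.

Lemma closed_measurable3 (A : set pt) : closed A -> measurable (A : set mpt).
Proof. by move/closed_openC/open_measurable3/measurableC; rewrite setCK. Qed.

Lemma continuous_measurable3 (f : pt -> R) : continuous f ->
  measurable_fun setT (f : mpt -> R).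
Proof.
move=> cf; apply: (measurability _ (RGenOpens.measurableE R)).
move=> _ [_ [a [b ->] <-]]; rewrite setTI; apply: open_measurable3.
by move/continuousP : cf; apply; exact: interval_open.
Qed.

Lemma measurable_coord1 : measurable_fun setT (fun x : mpt => x.1.1 : mR).
Proof. by apply: (measurableT_comp measurable_fst measurable_fst). Qed.
Lemma measurable_coord2 : measurable_fun setT (fun x : mpt => x.1.2 : mR).
Proof. by apply: (measurableT_comp measurable_snd measurable_fst). Qed.
Lemma measurable_coord3 : measurable_fun setT (fun x : mpt => x.2 : mR).
Proof. exact: measurable_snd. Qed.

Let I (r : R) : set mR := `[- r, r]%classic.

Let cubeE (r : R) : cube r = (I r `*` I r) `*` I r.
Proof.
by apply/seteqP; split => -[[a b] c] /=; rewrite /cube/I/= !in_itv/= -!ler_norml; [move=> [? ? ?]|move=> [[? ?] ?]].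
Qed.

Let measurable_I (r : R) : measurable (I r).
Proof. exact: measurable_itv. Qed.

Lemma measurable_cube (r : R) : measurable (cube r : set mpt).
Proof.
by rewrite cubeE; apply: measurableX => //; exact: measurableX.
Qed.

Lemma mu3_cube_lty (r : R) : (mu3 (cube r) < +oo)%E.
Proof.
have fin1 : (lebesgue_measure (I r) < +oo)%E.
  by rewrite lebesgue_measure_itv; case: ifP => // _; rewrite -EFinB ltry.
have -> : mu3 (cube r) = (mu2 (I r `*` I r) * lebesgue_measure (I r))%E.
  by rewrite cubeE; apply: product_measure1E => //; exact: measurableX.
have -> : mu2 (I r `*` I r) = (lebesgue_measure (I r) * lebesgue_measure (I r))%E.
  exact: product_measure1E.
have f2 : (lebesgue_measure (I r) * lebesgue_measure (I r) < +oo)%E.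
  by rewrite lte_mul_pinfty// ge0_fin_numE.
by rewrite lte_mul_pinfty// ?mule_ge0// ge0_fin_numE ?mule_ge0.
Qed.

Lemma mu3_plane3 (c : R) : mu3 ([set x : mpt | x.2 = c]) = 0%E.
Proof.
rewrite (_ : [set x : mpt | _] = (setT : set (mR * mR)) `*` ([set c] : set mR)).
  transitivity (mu2 (setT : set (mR * mR)) * lebesgue_measure ([set c] : set mR))%E.
    exact: product_measure1E.
  by rewrite lebesgue_measure_set1 mule0.
by apply/seteqP; split => -[[? ?] ?] /=; [|case].
Qed.

Lemma mu3_plane1 (c : R) : mu3 ([set x : mpt | x.1.1 = c]) = 0%E.
Proof.
rewrite (_ : [set x : mpt | _] = (([set c] : set mR) `*` (setT : set mR)) `*` (setT : set mR)).
  transitivity (mu2 (([set c] : set mR) `*` (setT : set mR)) * lebesgue_measure (setT : set mR))%E.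
    by apply: product_measure1E => //; exact: measurableX.
  have -> : mu2 (([set c] : set mR) `*` (setT : set mR)) =
    (lebesgue_measure ([set c] : set mR) * lebesgue_measure (setT : set mR))%E.
    exact: product_measure1E.
  by rewrite lebesgue_measure_set1 !mul0e.
by apply/seteqP; split => -[[? ?] ?] /=; [move=> ->|move=> [[]]].
Qed.

Lemma mu3_plane2 (c : R) : mu3 ([set x : mpt | x.1.2 = c]) = 0%E.
Proof.
rewrite (_ : [set x : mpt | _] = ((setT : set mR) `*` ([set c] : set mR)) `*` (setT : set mR)).
  transitivity (mu2 ((setT : set mR) `*` ([set c] : set mR)) * lebesgue_measure (setT : set mR))%E.
    by apply: product_measure1E => //; exact: measurableX.
  have -> : mu2 ((setT : set mR) `*` ([set c] : set mR)) =
    (lebesgue_measure (setT : set mR) * lebesgue_measure ([set c] : set mR))%E.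
    exact: product_measure1E.
  by rewrite lebesgue_measure_set1 mule0 mul0e.
by apply/seteqP; split => -[[? ?] ?] /=; [move=> ->|move=> [[]]].
Qed.

Lemma measurable_plane1 (c : R) : measurable ([set x : mpt | x.1.1 = c]).
Proof. by rewrite -[X in measurable X]setTI; exact: (measurable_coord1 _ (measurable_set1 c)). Qed.
Lemma measurable_plane2 (c : R) : measurable ([set x : mpt | x.1.2 = c]).
Proof. by rewrite -[X in measurable X]setTI; exact: (measurable_coord2 _ (measurable_set1 c)). Qed.
Lemma measurable_plane3 (c : R) : measurable ([set x : mpt | x.2 = c]).
Proof. by rewrite -[X in measurable X]setTI; exact: (measurable_coord3 _ (measurable_set1 c)). Qed.

Lemma measurable_cell2 : measurable (cell2 : set (mR * mR)).
Proof.
rewrite (_ : cell2 = (`](- pi), pi[ : set mR) `*` (`](- pi), pi[ : set mR)).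
  by apply: measurableX; exact: measurable_itv.
by apply/seteqP; split => -[a b] /=; rewrite /cell2/= !in_itv/=; [move/andP|move=> [-> ->]].
Qed.

Lemma measurable_Omega : measurable (Omega : set mpt).
Proof.
rewrite (_ : Omega = cell2 `*` (setT : set mR)).
  by apply: measurableX => //; exact: measurable_cell2.
by apply/seteqP; split => -[a b] /=; [|case].
Qed.

Lemma measurable_D (eps : pt -> 'M[R[i]]_3) : measurable (D eps : set mpt).
Proof.
apply: measurableI; last exact: measurable_Omega.
by apply: closed_measurable3; exact: closed_closure.
Qed.

Lemma cint_translate (v : pt) (f : pt -> R[i]) : cintegrable mu3 setT f ->
  cintegrable mu3 setT (fun x : mpt => f ((x : pt) + v)) /\
  cint mu3 setT (fun x : mpt => f ((x : pt) + v)) = cint mu3 setT f.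
Proof.
move=> fi; have [[rf jf] ni] := fi.
have mt : measurable_fun setT (fun x : mpt => ((x : pt) + v : mpt)).
  exact: measurable_translate3.
have [ri rE] := integral_translate v (cintegrable_Re measurableT fi).
have [ii iE] := integral_translate v (cintegrable_Im measurableT fi).
have [ci _] := integral_translate v ni.
split; last by rewrite /cint /Rintegral rE iE.
by split; [split; [exact: (measurableT_comp rf mt)|exact: (measurableT_comp jf mt)]|].
Qed.

End Space3.

(** * Smooth functions of one real variable *)

Section RealSmooth.
Context {R : realType}.
Implicit Types (f g : R -> R).

Definition rsmooth f :=
  forall n (x : R), derivable (iter n (fun g : R -> R => derive1 g : R -> R) f) x 1.

Lemma derive1_eq f f' : (forall x : R, is_derive x 1 f (f' x)) -> derive1 f = f'.
Proof. by move=> H; apply/funext => x; rewrite derive1E; case: (H x). Qed.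

(** Smoothness by invariance: a class of functions in which every member has a derivative in the
    class consists of smooth functions. No formula for higher derivatives is ever needed. *)
Lemma rsmooth_class (P : (R -> R) -> Prop) :
  (forall f, P f -> exists2 f', P f' & forall x : R, is_derive x 1 f (f' x)) ->
  forall f, P f -> rsmooth f.
Proof.
move=> clP f Pf n.
have : P (iter n (fun g : R -> R => derive1 g : R -> R) f) by elim: n => //= n /clP[f' Pf' /derive1_eq ->].
by move=> /clP[f' _ H] x; case: (H x).
Qed.

Lemma rsmooth_is_derive f : rsmooth f -> forall x : R, is_derive x 1 f (derive1 f x).
Proof. by move=> sf x; rewrite derive1E; apply: DeriveDef => //; exact: (sf 0%N). Qed.

Lemma rsmooth_derive1 f : rsmooth f -> rsmooth (derive1 f).
Proof. by move=> sf n x; rewrite -iterSr; exact: sf. Qed.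

Lemma rsmooth_continuous f : rsmooth f -> continuous f.
Proof.
by move=> sf x; apply: differentiable_continuous; apply/derivable1_diffP; exact: (sf 0%N).
Qed.

(** Terms built from smooth functions. The derivative of a term is again a term, so [rsmooth_class]
    gives all closure properties at once, without Leibniz or chain rules of higher order. *)
Inductive smooth_expr : (R -> R) -> Prop :=
| smooth_atom f of rsmooth f : smooth_expr f
| smooth_add f g of smooth_expr f & smooth_expr g : smooth_expr (f \+ g)
| smooth_mul f g of smooth_expr f & smooth_expr g : smooth_expr (f \* g)
| smooth_inv f of smooth_expr f & (forall x, f x != 0) :
    smooth_expr (fun x => (f x)^-1)
| smooth_comp f g of smooth_expr f & smooth_expr g : smooth_expr (f \o g).

Lemma rsmooth_cst (a : R) : rsmooth (fun=> a).
Proof.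
apply: (@rsmooth_class (fun f => exists b, f = fun=> b)); last by exists a.
move=> _ [b ->]; exists (fun=> 0); first by exists 0.
by move=> x; exact: is_derive_cst.
Qed.

Lemma smooth_expr_derive f : smooth_expr f ->
  exists2 f', smooth_expr f' & forall x : R, is_derive x 1 f (f' x).
Proof.
elim=> {f} [f sf|f g _ [f' ef' df] _ [g' eg' dg]|f g ef [f' ef' df] eg [g' eg' dg]
  |f ef [f' ef' df] f0|f g ef [f' ef' df] eg [g' eg' dg]].
- exists (derive1 f); first by apply: smooth_atom; exact: rsmooth_derive1.
  exact: rsmooth_is_derive.
- by exists (f' \+ g'); [exact: smooth_add|move=> x; exact: is_deriveD].
- exists ((f \* g') \+ (g \* f')); first by apply: smooth_add; exact: smooth_mul.
  by move=> x; exact: is_deriveM.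
- exists ((fun=> -1) \* (f' \* ((fun x => (f x)^-1) \* (fun x => (f x)^-1)))).
    apply: smooth_mul; first by apply: smooth_atom; exact: rsmooth_cst.
    by do 2 (apply: smooth_mul => //); exact: smooth_inv.
  move=> x /=; have := is_deriveV (f0 x) (df x); move/is_derive_eq; apply.
  by rewrite /GRing.scale/= expr2 invfM; ring.
- exists ((f' \o g) \* g'); first by apply: smooth_mul => //; exact: smooth_comp.
  by move=> x; exact: is_derive1_comp.
Qed.

Lemma smooth_expr_rsmooth f : smooth_expr f -> rsmooth f.
Proof. by move=> ef; apply: (rsmooth_class smooth_expr_derive). Qed.

Lemma rsmoothD f g : rsmooth f -> rsmooth g -> rsmooth (f \+ g).
Proof. by move=> ? ?; apply: smooth_expr_rsmooth; apply: smooth_add; exact: smooth_atom. Qed.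

Lemma rsmoothM f g : rsmooth f -> rsmooth g -> rsmooth (f \* g).
Proof. by move=> ? ?; apply: smooth_expr_rsmooth; apply: smooth_mul; exact: smooth_atom. Qed.

Lemma rsmoothV f : rsmooth f -> (forall x, f x != 0) -> rsmooth (fun x => (f x)^-1).
Proof. by move=> ? ?; apply: smooth_expr_rsmooth; apply: smooth_inv => //; exact: smooth_atom. Qed.

Lemma rsmooth_comp f g : rsmooth f -> rsmooth g -> rsmooth (f \o g).
Proof. by move=> ? ?; apply: smooth_expr_rsmooth; apply: smooth_comp; exact: smooth_atom. Qed.

Lemma rsmooth_id : rsmooth id.
Proof.
apply: (@rsmooth_class (fun f => f = id \/ exists b, f = fun=> b)); last by left.
move=> _ [->|[b ->]].
  by exists (fun=> 1); [right; exists 1|move=> x; exact: is_derive_id].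
by exists (fun=> 0); [right; exists 0|move=> x; exact: is_derive_cst].
Qed.

Lemma rsmooth_affine (a b : R) : rsmooth (fun x => a * x + b).
Proof.
apply: (@rsmoothD (fun x => a * x) (fun=> b)); last exact: rsmooth_cst.
by apply: (@rsmoothM (fun=> a) id); [exact: rsmooth_cst|exact: rsmooth_id].
Qed.

Lemma rsmooth_expR : rsmooth expR.
Proof.
apply: (@rsmooth_class (fun f => f = expR)) => // _ ->; exists expR => // x.
exact: is_derive_expR.
Qed.

Let trig f := exists a b : R, f = (fun x => a * sin x + b * cos x).

Let trig_derive f : trig f -> exists2 f', trig f' & forall x : R, is_derive x 1 f (f' x).
Proof.
move=> [a [b ->]]; exists (fun x => (- b) * sin x + a * cos x); first by exists (- b), a.
move=> x; have ds : is_derive x 1 (a *: (sin : R -> R)) (a *: cos x) by exact: is_deriveZ.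
have dc : is_derive x 1 (b *: (cos : R -> R)) (b *: - sin x) by exact: is_deriveZ.
have := is_deriveD ds dc; move/is_derive_eq; apply.
by rewrite /GRing.scale/=; ring.
Qed.

Lemma rsmooth_sin : rsmooth sin.
Proof.
apply: (rsmooth_class trig_derive); exists 1, 0; apply/funext => x; ring.
Qed.

Lemma rsmooth_cos : rsmooth cos.
Proof.
apply: (rsmooth_class trig_derive); exists 0, 1; apply/funext => x; ring.
Qed.

End RealSmooth.

(** * A smooth step function *)

Section SmoothStep.
Context {R : realType}.

(* The functions [t^-n exp (-1/t)], extended by 0: their span is stable under
   differentiation, so that the flat function (n = 0) is smooth. *)
Definition flat (n : nat) (t : R) : R :=
  if 0 < t then t^-1 ^+ n * expR (- t^-1) else 0.

(** From exp u >= u^(n+2) / (n+2)! at u = 1/t. The two extra powers of u give the quadratic decay by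
    which [is_derive_quadratic] finds the derivative 0 at the origin. *)
Lemma flat_le n (t : R) : `|flat n t| <= n.+2`!%:R * t ^+ 2.
Proof.
rewrite /flat; case: ifP => t0; last by rewrite normr0 mulr_ge0 ?sqr_ge0.
have u0 : 0 < t^-1 by rewrite invr_gt0.
rewrite ger0_norm ?mulr_ge0 ?expR_ge0 ?exprn_ge0 ?(ltW u0)//.
have := expR_ge1Dxn n.+1 (ltW u0); rewrite expRN => H.
have f0 : 0 < n.+2`!%:R :> R by rewrite ltr0n fact_gt0.
have H1 : t^-1 ^+ n.+2 <= n.+2`!%:R * expR t^-1.
  by rewrite mulrC -ler_pdivrMr// (le_trans _ H)// lerDr ler01.
have -> : t^-1 ^+ n = t^-1 ^+ n.+2 * t ^+ 2.
  by rewrite !exprS expr0; field; exact: lt0r_neq0.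
by rewrite mulrAC ler_wpM2r ?sqr_ge0// ler_pdivrMr ?expR_gt0.
Qed.

Lemma is_derive_quadratic (f : R -> R) (C : R) : f 0 = 0 ->
  (forall t, `|f t| <= C * t ^+ 2) -> is_derive (0 : R) 1 f 0.
Proof.
move=> f0 fC.
have H : (fun h : R => h^-1 *: ((f \o shift 0) (h *: 1) - f 0)) @ 0^' --> (0 : R).
  apply/cvgr0Pnorm_lt => e e0.
  have C0 : 0 <= C by have := fC 1; rewrite expr1n mulr1; apply: le_trans.
  have C1 : 0 < C + 1 by lra.
  have := @dnbhs0_lt R R (e / (C + 1)) (divr_gt0 e0 C1).
  apply: filterS2 (nbhs_dnbhs_neq (0 : R)) => h h0.
  rewrite ltr_pdivlMr//= addr0 [h *: 1]mulr1 f0 subr0 normrZ normfV => hC.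
  rewrite mulrC ltr_pdivrMr ?normr_gt0//.
  apply: le_lt_trans (fC h) _; rewrite -(real_normK (num_real h)) expr2 mulrA.
  rewrite ltr_pM2r ?normr_gt0//.
  by apply: le_lt_trans hC; rewrite mulrC ler_wpM2l//; lra.
by apply: DeriveDef; [apply/cvg_ex; exists 0|exact: cvg_lim].
Qed.

Lemma is_derive_flat n (t : R) :
  is_derive t 1 (flat n) ((- n%:R) * flat n.+1 t + flat n.+2 t).
Proof.
have [t0|t0|->] := ltgtP t 0.
- rewrite /flat !ifF ?(ltNge 0) ?(ltW t0)//= mulr0 addr0.
  apply: (@near_eq_is_derive _ _ _ (fun=> 0)).
  near=> s; rewrite ifF//; apply/negbTE; rewrite -leNgt ltW//.
  near: s; exact: lt_nbhsl.
- have dV : is_derive t 1 (fun s : R => s^-1) (- t ^- 2).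
    have := is_deriveV (lt0r_neq0 t0) (is_derive_id t 1); move/is_derive_eq; apply.
    by rewrite /GRing.scale/= mulr1.
  have dX := is_deriveX n dV.
  have dE : is_derive t 1 (fun s : R => expR (- s^-1)) (expR (- t^-1) * (t ^- 2)).
    apply: (@is_derive1_comp _ expR (fun s => - s^-1)).
    by have := is_deriveN dV; rewrite opprK.
  apply: (@near_eq_is_derive _ _ _ (fun s : R => s^-1 ^+ n * expR (- s^-1))).
    near=> s; rewrite /flat ifT//; near: s; exact: lt_nbhsr.
  have Xn : (fun s : R => s^-1) ^+ n = (fun s : R => s^-1 ^+ n).
    by apply/funext => s; elim: (n) => // m IH; rewrite !exprS -IH.
  rewrite Xn in dX; have := is_deriveM dX dE; move/is_derive_eq; apply.
  rewrite /flat t0 /GRing.scale/=.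
  case: (n) => [|m] /=; rewrite ?exprS ?expr0; field; exact: lt0r_neq0.
- rewrite /flat ltxx mulr0 addr0.
  apply: (@is_derive_quadratic _ n.+2`!%:R) (flat_le n).
  by rewrite /flat ltxx.
Unshelve. all: by end_near. Qed.

Lemma rsmooth_flat : rsmooth (flat 0).
Proof.
pose P f := exists (s : seq (R * nat)), f = (fun t => \sum_(p <- s) p.1 * flat p.2 t).
apply: (@rsmooth_class _ P); last first.
  by exists [:: (1, 0%N)]; apply/funext => t; rewrite big_seq1 mul1r.
move=> _ [s ->]; elim: s => [|p s [f' [s' ->] df]].
  exists (fun=> 0); first by exists [::]; apply/funext => t; rewrite big_nil.
  move=> x; rewrite (_ : (fun t => _) = fun=> 0); first exact: is_derive_cst.
  by apply/funext => t; rewrite big_nil.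
exists (fun t => p.1 * ((- p.2%:R) * flat p.2.+1 t + flat p.2.+2 t) +
    \sum_(q <- s') q.1 * flat q.2 t).
  exists [:: (- p.1 * p.2%:R, p.2.+1), (p.1, p.2.+2) & s'].
  by apply/funext => t; rewrite !big_cons/=; ring.
move=> x.
have := is_deriveD (is_deriveZ p.1 (is_derive_flat p.2 x)) (df x).
move/is_derive_eq/(_ erefl).
by congr is_derive; apply/funext => t; rewrite big_cons.
Qed.

(** Since t and 1 - t are never both nonpositive, this denominator is positive everywhere. *)
Let den (t : R) := flat 0 t + flat 0 (1 - t).

Lemma flat_ge0 (t : R) : 0 <= flat 0 t.
Proof. by rewrite /flat; case: ifP => // _; rewrite expr0 mul1r expR_ge0. Qed.

Lemma flat_gt0 (t : R) : 0 < t -> 0 < flat 0 t.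
Proof. by move=> t0; rewrite /flat t0 expr0 mul1r expR_gt0. Qed.

Let den_gt0 (t : R) : 0 < den t.
Proof.
rewrite /den; have [t0|t0] := ltP 0 t.
  by rewrite ltr_wpDr ?flat_ge0 ?flat_gt0.
by rewrite ltr_wpDl ?flat_ge0// flat_gt0//; lra.
Qed.

Definition step (t : R) : R := flat 0 t * (den t)^-1.

Lemma rsmooth_step : rsmooth step.
Proof.
apply: rsmoothM; first exact: rsmooth_flat.
apply: rsmoothV; last by move=> t; rewrite gt_eqF.
apply: rsmoothD; first exact: rsmooth_flat.
apply: (@rsmooth_comp _ (flat 0) (fun t => 1 - t)); first exact: rsmooth_flat.
have -> : (fun t : R => 1 - t) = (fun t => -1 * t + 1) by apply/funext => t; ring.
exact: rsmooth_affine.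
Qed.

Lemma step_le0 (t : R) : t <= 0 -> step t = 0.
Proof. by move=> t0; rewrite /step /flat ltNge t0/= mul0r. Qed.

Lemma step_ge1 (t : R) : 1 <= t -> step t = 1.
Proof.
move=> t1; have f0 : flat 0 (1 - t) = 0 by rewrite /flat ifF//; apply/negbTE; rewrite -leNgt; lra.
by rewrite /step /den f0 addr0 mulfV// gt_eqF// flat_gt0//; lra.
Qed.

Lemma step_ge0 (t : R) : 0 <= step t.
Proof. by rewrite mulr_ge0 ?flat_ge0// invr_ge0 ltW. Qed.

Lemma step_le1 (t : R) : step t <= 1.
Proof. by rewrite ler_pdivrMr// mul1r lerDl flat_ge0. Qed.

End SmoothStep.

(** * Complex exponentials and complex-valued smooth functions *)

Section ComplexSmooth.
Context {R : realType}.
Implicit Types (f g : R -> R[i]) (z w : R[i]).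

Lemma conjE z : Num.conj z = Re z -i* Im z.
Proof. by case: z. Qed.

Lemma cRe_conj z : Re (Num.conj z) = Re z. Proof. by rewrite conjE. Qed.
Lemma cIm_conj z : Im (Num.conj z) = - Im z. Proof. by rewrite conjE. Qed.

Lemma expiD z w : expi (z + w) = expi z * expi w.
Proof.
apply: complex_ext; rewrite ?cReM ?cImM /expi /= cReD cImD opprD expRD ?cosD ?sinD; ring.
Qed.

Lemma expi0 : expi (0 : R[i]) = 1.
Proof. by apply: complex_ext; rewrite /expi /= oppr0 expR0 ?cos0 ?sin0 ?mulr1 ?mulr0. Qed.

Lemma expi_conj z : Num.conj (expi z) = expi (- Num.conj z).
Proof.
apply: complex_ext; rewrite ?cRe_conj ?cIm_conj /expi /= cReN cImN cRe_conj cIm_conj opprK ?cosN ?sinN; ring.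
Qed.

Lemma expiK z : expi z * expi (- z) = 1.
Proof. by rewrite -expiD subrr expi0. Qed.

Lemma cabs_expi z : cabs (expi z) = expR (- Im z).
Proof.
by rewrite /cabs /expi /= !exprMn -mulrDr cos2Dsin2 mulr1 sqrtr_sqr ger0_norm.
Qed.

Definition csmooth f := rsmooth (fun t => Re (f t)) /\ rsmooth (fun t => Im (f t)).

Definition cder f : R -> R[i] := fun t =>
  derive1 (fun s => Re (f s)) t +i* derive1 (fun s => Im (f s)) t.

Definition is_cderive (x : R) f z :=
  is_derive x 1 (fun t => Re (f t)) (Re z) /\ is_derive x 1 (fun t => Im (f t)) (Im z).

Lemma is_cderive_cder x f z : is_cderive x f z -> cder f x = z.
Proof.
by move=> [[_ r] [_ i]]; apply: complex_ext; rewrite /cder /= derive1E.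
Qed.

Lemma csmooth_is_cderive f x : csmooth f -> is_cderive x f (cder f x).
Proof. by move=> [rf jf]; exact: (conj (rsmooth_is_derive rf x) (rsmooth_is_derive jf x)). Qed.

Lemma csmooth_cder f : csmooth f -> csmooth (cder f).
Proof. by move=> [rf jf]; exact: (conj (rsmooth_derive1 rf) (rsmooth_derive1 jf)). Qed.

Lemma is_cderiveD x f g z w : is_cderive x f z -> is_cderive x g w ->
  is_cderive x (fun t => f t + g t) (z + w).
Proof.
move=> [rf jf] [rg jg]; split.
  by under eq_fun do rewrite cReD; rewrite cReD; exact: is_deriveD.
by under eq_fun do rewrite cImD; rewrite cImD; exact: is_deriveD.
Qed.

Lemma is_cderiveM x f g z w : is_cderive x f z -> is_cderive x g w ->
  is_cderive x (fun t => f t * g t) (z * g x + f x * w).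
Proof.
move=> [rf jf] [rg jg]; split.
  under eq_fun do rewrite cReM; have := is_deriveB (is_deriveM rf rg) (is_deriveM jf jg).
  by move/is_derive_eq; apply; rewrite cReD !cReM /GRing.scale/=; ring.
under eq_fun do rewrite cImM; have := is_deriveD (is_deriveM rf jg) (is_deriveM jf rg).
by move/is_derive_eq; apply; rewrite cImD !cImM /GRing.scale/=; ring.
Qed.

Lemma is_cderive_cst x z : is_cderive x (fun=> z) 0.
Proof. by split; exact: is_derive_cst. Qed.

Lemma is_cderive_expi (a b : R[i]) x :
  is_cderive x (fun t => expi (a * t%:C + b)) ('i * a * expi (a * x%:C + b)).
Proof.
have dl (c d : R) : is_derive x 1 (fun t : R => c * t + d) c.
  have := is_deriveD (is_deriveZ c (is_derive_id x 1)) (is_derive_cst d x 1).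
  by move/is_derive_eq; apply; rewrite addr0 /GRing.scale/= mulr1.
pose e t := expR (- Im a * t - Im b); pose ph t := Re a * t + Re b.
have E t : a * t%:C + b = (ph t) +i* (Im a * t + Im b).
  by apply: complex_ext; rewrite ?cReD ?cImD ?cReM ?cImM /ph/=; ring.
have ee t : expR (- (Im a * t + Im b)) = e t by rewrite /e; congr expR; ring.
have de : is_derive x 1 e (e x * - Im a).
  by apply: (@is_derive1_comp _ expR (fun t => - Im a * t - Im b)).
have dc : is_derive x 1 (fun t => cos (ph t)) (- sin (ph x) * Re a).
  by apply: (@is_derive1_comp _ cos ph); exact: dl.
have ds : is_derive x 1 (fun t => sin (ph t)) (cos (ph x) * Re a).
  by apply: (@is_derive1_comp _ sin ph); exact: dl.
split.
  under eq_fun do rewrite E /expi/= ee.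
  have := is_deriveM de dc; move/is_derive_eq; apply.
  by rewrite E /expi !cReM !cImM /GRing.scale/= ee; ring.
under eq_fun do rewrite E /expi/= ee.
have := is_deriveM de ds; move/is_derive_eq; apply.
by rewrite E /expi !cImM !cReM /GRing.scale/= ee; ring.
Qed.

Lemma csmoothD f g : csmooth f -> csmooth g -> csmooth (fun t => f t + g t).
Proof.
move=> [rf jf] [rg jg]; split.
  by under eq_fun do rewrite cReD; exact: rsmoothD.
by under eq_fun do rewrite cImD; exact: rsmoothD.
Qed.

Lemma rsmoothN (h : R -> R) : rsmooth h -> rsmooth (fun t => - h t).
Proof.
move=> sh; under eq_fun do rewrite -mulN1r.
by apply: (@rsmoothM R (fun=> -1) h); [exact: rsmooth_cst|exact: sh].
Qed.

Lemma csmoothM f g : csmooth f -> csmooth g -> csmooth (fun t => f t * g t).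
Proof.
move=> [rf jf] [rg jg]; split.
  under eq_fun do rewrite cReM.
  by apply: (@rsmoothD _ (fun t => Re (f t) * Re (g t))); [exact: rsmoothM|
    apply: rsmoothN; exact: rsmoothM].
by under eq_fun do rewrite cImM; apply: rsmoothD; exact: rsmoothM.
Qed.

Lemma csmooth_cst z : csmooth (fun=> z).
Proof. by split; exact: rsmooth_cst. Qed.

Lemma csmooth_real (h : R -> R) : rsmooth h -> csmooth (fun t => (h t)%:C).
Proof. by move=> sh; by split; [exact: sh|exact: rsmooth_cst]. Qed.

Lemma is_cderive_real (h : R -> R) (x d : R) : is_derive x 1 h d ->
  is_cderive x (fun t => (h t)%:C) d%:C.
Proof. by move=> dh; split => //; exact: is_derive_cst. Qed.

Lemma csmooth_expi (a b : R[i]) : csmooth (fun t => expi (a * t%:C + b)).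
Proof.
have E t : a * t%:C + b = (Re a * t + Re b) +i* (Im a * t + Im b).
  by apply: complex_ext; rewrite ?cReD ?cImD ?cReM ?cImM /=; ring.
have H : rsmooth (fun t => expR (- (Im a * t + Im b))).
  apply: (@rsmooth_comp _ expR (fun t => - (Im a * t + Im b))).
    exact: rsmooth_expR.
  by apply: rsmoothN; exact: rsmooth_affine.
have A := @rsmooth_affine R (Re a) (Re b).
split; under eq_fun do rewrite E /expi/=.
  exact: (@rsmoothM R _ _ H (@rsmooth_comp R _ _ (@rsmooth_cos R) A)).
exact: (@rsmoothM R _ _ H (@rsmooth_comp R _ _ (@rsmooth_sin R) A)).
Qed.

Lemma cder_supp f (A : set R) : open A -> (forall t, A t -> f t = 0) ->
  forall t, A t -> cder f t = 0.
Proof.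
move=> oA f0 t At; apply: is_cderive_cder.
have nf : \near t, A t by exact: open_nbhs_nbhs.
by split; apply: near_eq_is_derive (is_derive_cst 0 t 1); apply: filterS nf => s /f0 ->.
Qed.

End ComplexSmooth.

(** * Partial derivatives of separated functions on R^3 *)

Section Space3Calculus.
Context {R : realType}.
Local Notation pt := (space3 R).
Implicit Types (a b c : R -> R[i]) (f g : pt -> R[i]) (x v : pt) (z w : R[i]).

Lemma is_derive_line (g : pt -> R) x v (d : R) :
  is_derive (0 : R) 1 (fun t : R => g (x + t *: v)) d <-> is_derive x v g d.
Proof.
have E : (fun h : R => h^-1 *: (((fun t : R => g (x + t *: v)) \o shift 0) (h *: 1) -
    (fun t : R => g (x + t *: v)) 0)) =
  (fun h : R => h^-1 *: ((g \o shift x) (h *: v) - g x)).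
  by apply/funext => h; rewrite /= addr0 scale0r addr0 [h *: 1]mulr1 (addrC x).
by split => -[dh dE]; apply: DeriveDef; move: dh dE;
  rewrite /derivable /derive ?E// -?E//.
Qed.

Definition is_partial (m : 'I_3) x f z :=
  is_derive x (unitpt m) (fun y => Re (f y)) (Re z) /\
  is_derive x (unitpt m) (fun y => Im (f y)) (Im z).

Lemma is_partialE m x f z : is_partial m x f z -> partial m f x = z.
Proof. by move=> [[_ r] [_ i]]; apply: complex_ext; rewrite /partial /=. Qed.

Lemma is_partial_line m x f z :
  is_cderive 0 (fun t => f (x + t *: unitpt m)) z -> is_partial m x f z.
Proof. by move=> [rf jf]; split; apply/is_derive_line. Qed.

Lemma is_partialD m x f g z w : is_partial m x f z -> is_partial m x g w ->
  is_partial m x (fun y => f y + g y) (z + w).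
Proof.
move=> [rf jf] [rg jg]; split.
  by under eq_fun do rewrite cReD; rewrite cReD; exact: is_deriveD.
by under eq_fun do rewrite cImD; rewrite cImD; exact: is_deriveD.
Qed.

Lemma is_partialM m x f g z w : is_partial m x f z -> is_partial m x g w ->
  is_partial m x (fun y => f y * g y) (z * g x + f x * w).
Proof.
move=> [rf jf] [rg jg]; split.
  under eq_fun do rewrite cReM; have := is_deriveB (is_deriveM rf rg) (is_deriveM jf jg).
  by move/is_derive_eq; apply; rewrite cReD !cReM /GRing.scale/=; ring.
under eq_fun do rewrite cImM; have := is_deriveD (is_deriveM rf jg) (is_deriveM jf rg).
by move/is_derive_eq; apply; rewrite cImD !cImM /GRing.scale/=; ring.
Qed.

Definition cdifferentiable x f := differentiable (fun y => Re (f y)) x /\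
  differentiable (fun y => Im (f y)) x.

Lemma cdifferentiable_partial m x f : cdifferentiable x f ->
  is_partial m x f (partial m f x).
Proof. by move=> [rf jf]; split; apply: DeriveDef => //; exact: diff_derivable. Qed.

Lemma cdifferentiableM x f g : cdifferentiable x f -> cdifferentiable x g ->
  cdifferentiable x (fun y => f y * g y).
Proof.
move=> [rf jf] [rg jg]; split.
  by under eq_fun do rewrite cReM; apply: differentiableB; exact: differentiableM.
by under eq_fun do rewrite cImM; apply: differentiableD; exact: differentiableM.
Qed.

Lemma ix_cases (m : 'I_3) : [\/ m = ix1, m = ix2 | m = ix3].
Proof.
by case: m => -[|[|[|//]]] lt3; [apply: Or31|apply: Or32|apply: Or33]; exact: val_inj.
Qed.

(** The components of the modes and of their lateral cutoffs have this separated form. A partial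
    derivative differentiates one factor and stays in the class, which reduces smoothness on R^3 to
    one variable. *)
Definition tensor a b c : pt -> R[i] := fun x => a x.1.1 * b x.1.2 * c x.2.

Definition tensor_partial (m : 'I_3) a b c : pt -> R[i] :=
  tensor (if m == ix1 then cder a else a) (if m == ix2 then cder b else b)
    (if m == ix3 then cder c else c).

Let is_cderive_shift a s : csmooth a -> is_cderive 0 (fun t => a (s + t)) (cder a s).
Proof.
move=> sa; have [ra ja] := csmooth_is_cderive s sa.
have ds : is_derive (0 : R) 1 (fun t : R => s + t) 1.
  have := is_deriveD (is_derive_cst s (0 : R) 1) (is_derive_id (0 : R) 1).
  by move/is_derive_eq; apply; rewrite add0r.
split.
  have := @is_derive1_comp _ (fun t => Re (a t)) (fun t => s + t) 0 (Re (cder a s)) 1.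
  by rewrite addr0 mulr1; apply.
have := @is_derive1_comp _ (fun t => Im (a t)) (fun t => s + t) 0 (Im (cder a s)) 1.
by rewrite addr0 mulr1; apply.
Qed.

Lemma is_partial_tensor m a b c x : csmooth a -> csmooth b -> csmooth c ->
  is_partial m x (tensor a b c) (tensor_partial m a b c x).
Proof.
move=> sa sb sc; apply: is_partial_line; rewrite /tensor_partial /tensor.
case: x => [[x1 x2] x3]; case: (ix_cases m) => ->.
- have E (t : R) : (x1, x2, x3) + t *: unitpt ix1 = ((x1 + t, x2), x3) :> pt.
    by rewrite /unitpt/=; congr (_, _, _) => /=; rewrite /GRing.scale/= ?mulr1 ?mulr0 ?addr0.
  under eq_fun do rewrite E/=.
  have := is_cderiveM (is_cderiveM (is_cderive_shift x1 sa) (is_cderive_cst 0 (b x2))) (is_cderive_cst 0 (c x3)).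
  by rewrite /= !mulr0 !addr0.
- have E (t : R) : (x1, x2, x3) + t *: unitpt ix2 = ((x1, x2 + t), x3) :> pt.
    by rewrite /unitpt/=; congr (_, _, _) => /=; rewrite /GRing.scale/= ?mulr1 ?mulr0 ?addr0.
  under eq_fun do rewrite E/=.
  have := is_cderiveM (is_cderiveM (is_cderive_cst 0 (a x1)) (is_cderive_shift x2 sb)) (is_cderive_cst 0 (c x3)).
  by rewrite /= !mul0r !mulr0 !add0r !addr0.
- have E (t : R) : (x1, x2, x3) + t *: unitpt ix3 = ((x1, x2), x3 + t) :> pt.
    by rewrite /unitpt/=; congr (_, _, _) => /=; rewrite /GRing.scale/= ?mulr1 ?mulr0 ?addr0.
  under eq_fun do rewrite E/=.
  have := is_cderiveM (is_cderive_cst 0 (a x1 * b x2)) (is_cderive_shift x3 sc).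
  by rewrite /= !mul0r !add0r.
Qed.

Lemma partial_tensor m a b c : csmooth a -> csmooth b -> csmooth c ->
  partial m (tensor a b c) = tensor_partial m a b c.
Proof. by move=> sa sb sc; apply/funext => x; apply: is_partialE; exact: is_partial_tensor. Qed.

Let differentiable_fst (U V : normedModType R) (y : U * V) : differentiable fst y.
Proof. by apply: linear_differentiable => z; exact: cvg_fst. Qed.

Let differentiable_snd (U V : normedModType R) (y : U * V) : differentiable snd y.
Proof. by apply: linear_differentiable => z; exact: cvg_snd. Qed.

Lemma cdifferentiable_tensor a b c x : csmooth a -> csmooth b -> csmooth c ->
  cdifferentiable x (tensor a b c).
Proof.
move=> [ra ja] [rb jb] [rc jc].
have d1 (h : R -> R) : rsmooth h -> differentiable (fun y : pt => h y.1.1) x.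
  move=> sh; apply: (@differentiable_comp _ _ _ _ (fun y : pt => y.1.1) h); last by apply/derivable1_diffP; exact: (sh 0%N).
  by apply: (@differentiable_comp _ _ _ _ (fun y : pt => y.1) fst); exact: differentiable_fst.
have d2 (h : R -> R) : rsmooth h -> differentiable (fun y : pt => h y.1.2) x.
  move=> sh; apply: (@differentiable_comp _ _ _ _ (fun y : pt => y.1.2) h); last by apply/derivable1_diffP; exact: (sh 0%N).
  by apply: (@differentiable_comp _ _ _ _ (fun y : pt => y.1) snd); [exact: differentiable_fst|exact: differentiable_snd].
have d3 (h : R -> R) : rsmooth h -> differentiable (fun y : pt => h y.2) x.
  move=> sh; apply: (@differentiable_comp _ _ _ _ (fun y : pt => y.2) h); last by apply/derivable1_diffP; exact: (sh 0%N).
  exact: differentiable_snd.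
apply: cdifferentiableM; last by split; [exact: (d3 _ rc)|exact: (d3 _ jc)].
apply: cdifferentiableM; first by split; [exact: (d1 _ ra)|exact: (d1 _ ja)].
by split; [exact: (d2 _ rb)|exact: (d2 _ jb)].
Qed.

Lemma smooth_tensor a b c : csmooth a -> csmooth b -> csmooth c -> smooth (tensor a b c).
Proof.
move=> sa sb sc s x.
suff [a' [b' [c' [E sa' sb' sc']]]] : exists a' b' c', [/\ foldr partial (tensor a b c) s = tensor a' b' c',
  csmooth a', csmooth b' & csmooth c'].
  by rewrite E; exact: cdifferentiable_tensor.
elim: s => [|m s [a' [b' [c' [IH sa' sb' sc']]]]]; first by exists a, b, c.
exists (if m == ix1 then cder a' else a'), (if m == ix2 then cder b' else b'),
  (if m == ix3 then cder c' else c').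
split.
- rewrite -[LHS]/(partial m (foldr partial (tensor a b c) s)) IH.
  exact: partial_tensor.
- case: (m == ix1); [exact: csmooth_cder|exact: sa'].
- case: (m == ix2); [exact: csmooth_cder|exact: sb'].
- case: (m == ix3); [exact: csmooth_cder|exact: sc'].
Qed.

End Space3Calculus.

(** * Integrals of derivatives of compactly supported functions *)

Section CompactSupport.
Context {R : realType}.
Local Notation pt := (space3 R).
Local Notation mR := (measurableTypeR R).
Local Notation mpt := (mR * mR * mR)%type.
Implicit Types (f g : pt -> R[i]) (x v : pt) (r : R).

Lemma compact_cube r : compact (cube r : set pt).
Proof.
rewrite (_ : cube r = (`[- r, r] `*` `[- r, r]) `*` `[- r, r])%classic.
  by apply: compact_setX; [apply: compact_setX|]; exact: segment_compact.
by apply/seteqP; split => -[[a b] c] /=; rewrite /cube/= !in_itv/= -!ler_norml;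
  [move=> [? ? ?]|move=> [[? ?] ?]].
Qed.

Lemma open_cubeC r : open (~` cube r : set pt).
Proof.
apply: closed_openC; apply: compact_closed; first exact: norm_hausdorff.
exact: compact_cube.
Qed.

Lemma bounded_on_cube (g : pt -> R) r : continuous g ->
  exists M, forall x, cube r x -> `|g x| <= M.
Proof.
move=> cg; have := @continuous_compact _ _ g (cube r) (continuous_subspaceT cg) (@compact_cube r).
move/compact_bounded => [M [_ HM]]; exists (M + 1) => x cx.
by apply: (HM (M + 1)); [rewrite ltrDl|exists x].
Qed.

Lemma bounded_supp (g : pt -> R) r : continuous g ->
  (forall x, ~ cube r x -> g x = 0) -> exists2 M, 0 <= M & forall x, `|g x| <= M.
Proof.
move=> cg g0; have [M HM] := bounded_on_cube r cg.
exists (Num.max 0 M); first by rewrite le_max lexx.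
move=> x; rewrite le_max; have [cx|ncx] := pselect (cube r x).
  by rewrite HM ?orbT.
by rewrite g0// normr0 lexx.
Qed.

Lemma integrable_cube_indic r (M : R) :
  mu3.-integrable (setT : set mpt) (EFin \o (fun x => M * \1_(cube r) x)).
Proof.
have mc := @measurable_cube R r.
apply: (@integrableZl _ _ _ mu3 setT measurableT M (EFin \o \1_(cube r))).
apply/integrableP; split; first exact/measurable_EFinP/measurable_indic.
have -> : (\int[mu3]_x `|(EFin \o \1_(cube r)) x| = \int[mu3]_x (\1_(cube r : set mpt) x)%:E)%E.
  by apply: eq_integral => t _ /=; rewrite ger0_norm.
by rewrite integral_indic// setIT; exact: mu3_cube_lty.
Qed.

Lemma cintegrable_supp f r (M : R) : cmeas (f : mpt -> R[i]) ->
  (forall x, cabs (f x) <= M) -> (forall x, ~ cube r x -> f x = 0) ->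
  cintegrable mu3 setT f.
Proof.
move=> mf fM f0; apply: cintegrable_le (integrable_cube_indic r M) _ => // x _.
rewrite indicE; case: (boolP (x \in cube r)) => [_|/negP nx]; first by rewrite mulr1.
by rewrite f0 ?cabs0 ?mulr0// => cx; apply: nx; rewrite inE.
Qed.

Lemma cmeas_continuous f : continuous (fun x => Re (f x)) ->
  continuous (fun x => Im (f x)) -> cmeas (f : mpt -> R[i]).
Proof. by move=> ? ?; split; exact: continuous_measurable3. Qed.

Lemma is_derive_along (g : pt -> R) x v (s : R) : differentiable g (x + s *: v) ->
  is_derive s 1 (fun t : R => g (x + t *: v)) ('D_v g (x + s *: v)).
Proof.
move=> dg; have H : is_derive (x + s *: v) v g ('D_v g (x + s *: v)).
  by apply: DeriveDef => //; exact: diff_derivable.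
move/is_derive_line : H => H.
have ds : is_derive s 1 (fun t : R => t - s) 1.
  have := is_deriveD (is_derive_id s 1) (is_derive_cst (- s) s 1).
  by move/is_derive_eq; apply; rewrite addr0.
rewrite -(subrr s) in H; have := @is_derive1_comp _ (fun t => g (x + s *: v + t *: v)) (fun t => t - s) s _ 1 H ds.
rewrite mulr1.
congr is_derive; apply/funext => t /=; congr g.
by rewrite -addrA -scalerDl [s + _]addrC subrK.
Qed.

(** Bounds all difference quotients uniformly, by the mean value theorem along a line; this is the
    domination used in [Rintegral_derive0]. *)
Lemma lipschitz_along (g : pt -> R) v (M : R) : (forall x, differentiable g x) ->
  (forall x, `|'D_v g x| <= M) ->
  forall x (t : R), 0 < t -> `|g (x + t *: v) - g x| <= M * t.
Proof.
move=> dg DM x t t0.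
have cg : continuous (fun s : R => g (x + s *: v)).
  move=> s; apply: differentiable_continuous; apply/derivable1_diffP.
  by have [] := is_derive_along (dg (x + s *: v)).
have [s _] := @MVT R (fun s => g (x + s *: v)) (fun s => 'D_v g (x + s *: v)) 0 t t0
  (fun s _ => is_derive_along (dg (x + s *: v))) (continuous_subspaceT cg).
rewrite scale0r addr0 subr0 => ->.
by rewrite normrM (gtr0_norm t0) ler_wpM2r// ltW.
Qed.

Lemma unitpt_cube m r (t : R) x : 0 <= t <= 1 -> cube r (x + t *: unitpt m) -> cube (r + 1) x.
Proof.
move=> /andP[t0 t1]; have H (a b : R) : `|b| <= 1 -> `|a + t * b| <= r -> `|a| <= r + 1.
  move=> b1 h; rewrite -[a](addrK (t * b)); apply: le_trans (ler_normB _ _) _.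
  apply: lerD => //; rewrite normrM ger0_norm//.
  by rewrite -[leRHS]mulr1 ler_pM.
have n1 (b : bool) : `|b%:R : R| <= 1 by case: b; rewrite ?normr1 ?normr0.
by move=> [/= h1 h2 h3]; split; [exact: H h1|exact: H h2|exact: H h3].
Qed.

(** Difference quotients have integral zero by translation invariance, and they converge to the
    derivative under a common integrable bound. *)
Lemma Rintegral_derive0 (g : pt -> R) (m : 'I_3) r : (forall x, differentiable g x) ->
  continuous (fun x => 'D_(unitpt m) g x) -> (forall x, ~ cube r x -> g x = 0) ->
  (\int[mu3]_x 'D_(unitpt m) g x)%R = 0.
Proof.
move=> dg cD g0; set v := unitpt m.
have D0 x : ~ cube r x -> 'D_v g x = 0.
  move=> ncx; rewrite (@near_eq_derive _ _ _ g (fun=> 0)) ?derive_cst//.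
  have : \near x, (~` cube r) x by apply: open_nbhs_nbhs; split => //; exact: open_cubeC.
  by apply: filterS => y; exact: g0.
have [M M0 HM] := bounded_supp cD D0.
have cg : continuous g by move=> x; exact: differentiable_continuous.
have mg := continuous_measurable3 cg.
(* Increments of size at most 1 keep the supports of all difference quotients in the cube of radius
   r + 1. *)
pose e (n : nat) : R := n.+1%:R^-1.
have e0 n : 0 < e n by rewrite invr_gt0.
have e1 n : e n <= 1 by rewrite invf_le1 ?ler1n.
pose G (n : nat) (x : mpt) := (e n)^-1 * (g ((x : pt) + e n *: v) - g x).
have mt n : measurable_fun setT (fun x : mpt => g ((x : pt) + e n *: v)).
  exact: (measurableT_comp mg (measurable_translate3 (e n *: v))).
have mG n : measurable_fun setT (G n).
  by apply: measurable_funM => //; exact: measurable_funB.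
have GM n x : `|G n x| <= M * \1_(cube (r + 1)) x.
  rewrite /G indicE; case: (boolP (x \in cube (r + 1))) => [_|/negP nx].
    rewrite mulr1 normrM (gtr0_norm _) ?invr_gt0// mulrC ler_pdivrMr//.
    exact: lipschitz_along.
  have ncx : ~ cube (r + 1) x by move=> cx; apply: nx; rewrite inE.
  rewrite !g0 ?subrr ?mulr0 ?normr0// => cx; apply: ncx.
    by apply: (@unitpt_cube m r 0); rewrite ?lexx ?ler01 ?scale0r ?addr0.
  by apply: unitpt_cube cx; rewrite e1 ltW.
have gint : mu3.-integrable (setT : set mpt) (EFin \o g).
  have [M' _ HM'] := bounded_supp cg g0.
  apply: le_integrable (integrable_cube_indic r M') => //.
    by apply/measurable_EFinP.
  move=> x _ /=; rewrite lee_fin indicE (le_trans _ (ler_norm _))//.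
  case: (boolP (x \in cube r)) => [_|/negP nx]; first by rewrite mulr1.
  by rewrite g0 ?normr0 ?mulr0// => cx; apply: nx; rewrite inE.
have intG n : (\int[mu3]_x G n x)%R = 0.
  have [ti tE] := integral_translate (e n *: v) gint.
  rewrite RintegralZl//.
    rewrite RintegralB// /Rintegral tE subrr mulr0//.
  exact: (integrableB measurableT ti gint).
have GD x : (fun n => G n x) @ \oo --> 'D_v g x.
  have dgx : derivable g x v by exact: diff_derivable.
  have := dgx; rewrite /derivable => /cvg_ex[l Hl].
  have lE : 'D_v g x = l by exact: cvg_lim Hl.
  rewrite lE; have he : e n @[n --> \oo] --> 0^'.
    move=> A A0; have : \forall n \near \oo, (e n != 0 -> A (e n)) := @cvg_harmonic R _ A0.
    by apply: filterS => n; apply; exact: lt0r_neq0 (e0 n).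
  have := cvg_comp _ _ he Hl; apply: cvg_trans; apply: near_eq_cvg.
  by apply: nearW => n; rewrite /G/= [x + _]addrC.
have := @Rintegral_dominated _ _ _ mu3 setT G (fun x => 'D_v g x)
  (fun x => M * \1_(cube (r + 1)) x) measurableT mG (continuous_measurable3 cD)
  (integrable_cube_indic (r + 1) M) (fun x _ => GD x) (fun n x _ => GM n x).
rewrite (_ : (fun n => _) = fun=> 0); last by apply/funext => n; exact: intG.
by move=> H; apply/esym/(cvg_unique _ (cvg_cst 0) H).
Qed.

End CompactSupport.

(** * Integration by parts for the curl *)

Section CurlCalculus.
Context {R : realType}.
Local Notation pt := (space3 R).
Local Notation mR := (measurableTypeR R).
Local Notation mpt := (mR * mR * mR)%type.
Implicit Types (f g : pt -> R[i]) (x : pt) (w phi : field3 R).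

Lemma sum3E (V : nmodType) (f : 'I_3 -> V) : \sum_m f m = f ix1 + f ix2 + f ix3.
Proof.
rewrite !big_ord_recl big_ord0 addr0 addrA.
by congr (f _ + f _ + f _); exact: val_inj.
Qed.

Lemma dotE (a b : 'cV[R[i]]_3) :
  dot a b = a ix1 0 * b ix1 0 + a ix2 0 * b ix2 0 + a ix3 0 * b ix3 0.
Proof. exact: sum3E. Qed.

Lemma vec3E (a b c : R[i]) : [/\ vec3 a b c ix1 0 = a, vec3 a b c ix2 0 = b & vec3 a b c ix3 0 = c].
Proof. by rewrite /vec3; split; rewrite mxE. Qed.

Lemma curlE w x : [/\
  curl w x ix1 0 = partial ix2 (fun y => w y ix3 0) x - partial ix3 (fun y => w y ix2 0) x,
  curl w x ix2 0 = partial ix3 (fun y => w y ix1 0) x - partial ix1 (fun y => w y ix3 0) x &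
  curl w x ix3 0 = partial ix1 (fun y => w y ix2 0) x - partial ix2 (fun y => w y ix1 0) x].
Proof. exact: vec3E. Qed.

Lemma smooth_cdifferentiable f x : smooth f -> cdifferentiable x f.
Proof. by move=> sf; exact: (sf [::] x). Qed.

Lemma smooth_partial m f : smooth f -> smooth (partial m f).
Proof. by move=> sf s x; have := sf (rcons s m) x; rewrite foldr_rcons. Qed.

Lemma cdifferentiableD x f g : cdifferentiable x f -> cdifferentiable x g ->
  cdifferentiable x (fun y => f y + g y).
Proof.
move=> [rf jf] [rg jg]; split.
  by under eq_fun do rewrite cReD; exact: differentiableD.
by under eq_fun do rewrite cImD; exact: differentiableD.
Qed.

Lemma cmeas_cdifferentiable f : (forall x, cdifferentiable x f) ->
  cmeas (f : mpt -> R[i]).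
Proof.
move=> df; apply: cmeas_continuous => x; apply: differentiable_continuous;
  by case: (df x).
Qed.

Lemma cintegrable_cdifferentiable f r : (forall x, cdifferentiable x f) ->
  (forall x, ~ cube r x -> f x = 0) -> cintegrable mu3 setT (f : mpt -> R[i]).
Proof.
move=> df f0.
have [M1 M10 HM1] : exists2 M, 0 <= M & forall x, `|Re (f x)| <= M.
  apply: (@bounded_supp _ _ r) => [x|x /f0 ->//].
  by apply: differentiable_continuous; case: (df x).
have [M2 M20 HM2] : exists2 M, 0 <= M & forall x, `|Im (f x)| <= M.
  apply: (@bounded_supp _ _ r) => [x|x /f0 ->//].
  by apply: differentiable_continuous; case: (df x).
apply: (@cintegrable_supp _ f r (M1 + M2)) => //; first exact: cmeas_cdifferentiable.
by move=> x; apply: le_trans (cabs_le _) _; exact: lerD.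
Qed.

Lemma partial_off_cube m f r x : (forall x, ~ cube r x -> f x = 0) -> ~ cube r x ->
  partial m f x = 0.
Proof.
move=> f0 ncx; apply: is_partialE.
have nx : \near x, (~` cube r) x by apply: open_nbhs_nbhs; split => //; exact: open_cubeC.
by split; apply: near_eq_is_derive (is_derive_cst 0 x (unitpt m));
  apply: filterS nx => y /f0 ->.
Qed.

Lemma cint_partial0 m f r : (forall x, cdifferentiable x f) ->
  (forall x, cdifferentiable x (partial m f)) -> (forall x, ~ cube r x -> f x = 0) ->
  cintegrable mu3 setT (partial m f : mpt -> R[i]) /\
  cint mu3 setT (partial m f : mpt -> R[i]) = 0.
Proof.
move=> df dpf f0; split.
  by apply: (@cintegrable_cdifferentiable _ r) => // x; exact: partial_off_cube.
apply: complex_ext; apply: (@Rintegral_derive0 _ _ m r).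
- by move=> x; case: (df x).
- by move=> x; apply: differentiable_continuous; case: (dpf x).
- by move=> x /f0 ->.
- by move=> x; case: (df x).
- by move=> x; apply: differentiable_continuous; case: (dpf x).
- by move=> x /f0 ->.
Qed.

(** Integration by parts; compact support of one factor is enough, as the product inherits it. *)
Lemma cint_partialM0 m f g r : smooth f -> smooth g -> (forall x, ~ cube r x -> g x = 0) ->
  cintegrable mu3 setT (fun x : mpt => partial m f x * g x + f x * partial m g x) /\
  cint mu3 setT (fun x : mpt => partial m f x * g x + f x * partial m g x) = 0.
Proof.
move=> sf sg g0.
have E : partial m (fun x => f x * g x) = (fun x => partial m f x * g x + f x * partial m g x).
  apply/funext => x; apply: is_partialE; apply: is_partialM;
  by apply: cdifferentiable_partial; exact: smooth_cdifferentiable.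
have df := fun x => smooth_cdifferentiable x sf.
have dg := fun x => smooth_cdifferentiable x sg.
have dpf := fun x => smooth_cdifferentiable x (smooth_partial m sf).
have dpg := fun x => smooth_cdifferentiable x (smooth_partial m sg).
have := @cint_partial0 m (fun x => f x * g x) r; rewrite E; apply.
- by move=> x; exact: cdifferentiableM.
- by move=> x; apply: cdifferentiableD; exact: cdifferentiableM.
- by move=> x /g0 ->; rewrite mulr0.
Qed.

Let dot_diff_ring (a b c d e f p q r : R[i]) :
  (a - b) * p + (c - d) * q + (e - f) * r =
  a * p + - 1 * (b * p) + (c * q + - 1 * (d * q)) + (e * r + - 1 * (f * r)).
Proof. by ring. Qed.

(** The identity w . curl phi = curl w . phi + div (phi x w) with the divergence expanded by the
    product rule. Unprimed letters stand for derivatives of w, primed ones for derivatives of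
    phi. *)
Let dot_curl_ring (w1 w2 w3 p1 p2 p3 a b c d e f a' b' c' d' e' f' : R[i]) :
  w1 * (a' - b') + w2 * (c' - d') + w3 * (e' - f') =
  (a - b) * p1 + (c - d) * p2 + (e - f) * p3 +
  (f * p3 + w1 * a' + - 1 * (c * p2 + w1 * b') +
   (b * p1 + w2 * c' + - 1 * (e * p3 + w2 * d')) +
   (d * p2 + w3 * e' + - 1 * (a * p1 + w3 * f'))).
Proof. by ring. Qed.

Definition zero_integral f :=
  cintegrable mu3 setT (f : mpt -> R[i]) /\ cint mu3 setT (f : mpt -> R[i]) = 0.

Lemma zero_integralD f g : zero_integral f -> zero_integral g ->
  zero_integral (fun x => f x + g x).
Proof.
by move=> [fi f0] [gi g0]; split; [exact: cintegrableD|rewrite cintD// f0 g0 addr0].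
Qed.

(** Makes smooth fields without compact support, in particular conjugated modes, admissible as test
    fields of the weak formulation. *)
Lemma weak_curl_smooth w : (forall m, smooth (fun x => w x m 0)) -> weak_curl w (curl w).
Proof.
move=> sw phi [sp [r p0]].
have p0' m x : ~ cube r x -> phi x m 0 = 0 by move/p0 => ->; rewrite mxE.
pose B m a b : mpt -> R[i] := fun x =>
  partial m (fun y => w y a 0) x * phi x b 0 + w x a 0 * partial m (fun y => phi y b 0) x.
have BI m a b : cintegrable mu3 setT (B m a b) by case: (cint_partialM0 m (sw a) (sp b) (p0' b)).
have B0 m a b : cint mu3 setT (B m a b) = 0 by case: (cint_partialM0 m (sw a) (sp b) (p0' b)).
have CI : cintegrable mu3 setT (fun x : mpt => dot (curl w x) (phi x)).
  apply: (@cintegrable_cdifferentiable _ r) => x; last first.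
    by move=> ncx; rewrite dotE !p0' // !mulr0 !addr0.
  have -> : (fun x => dot (curl w x) (phi x)) = (fun x =>
    partial ix2 (fun y => w y ix3 0) x * phi x ix1 0 + - 1 * (partial ix3 (fun y => w y ix2 0) x * phi x ix1 0) +
    (partial ix3 (fun y => w y ix1 0) x * phi x ix2 0 + - 1 * (partial ix1 (fun y => w y ix3 0) x * phi x ix2 0)) +
    (partial ix1 (fun y => w y ix2 0) x * phi x ix3 0 + - 1 * (partial ix2 (fun y => w y ix1 0) x * phi x ix3 0))).
    apply/funext => y; rewrite dotE; have [c1 c2 c3] := curlE w y.
    by rewrite c1 c2 c3; exact: dot_diff_ring.
  have dM m a b : cdifferentiable x (fun x => partial m (fun y => w y a 0) x * phi x b 0).
    apply: cdifferentiableM; apply: smooth_cdifferentiable; last exact: sp.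
    exact: smooth_partial.
  have dN m a b : cdifferentiable x (fun x => - 1 * (partial m (fun y => w y a 0) x * phi x b 0)).
    by apply: cdifferentiableM (dM m a b); split; exact: differentiable_cst.
  by do ?apply: cdifferentiableD.
transitivity (cint mu3 setT (fun x : mpt => dot (curl w x) (phi x) +
  (B ix2 ix1 ix3 x + - 1 * B ix3 ix1 ix2 x + (B ix3 ix2 ix1 x + - 1 * B ix1 ix2 ix3 x) +
  (B ix1 ix3 ix2 x + - 1 * B ix2 ix3 ix1 x)))).
  apply: eq_cint => x _; rewrite !dotE /B.
  have [c1 c2 c3] := curlE w x; have [d1 d2 d3] := curlE phi x.
  by rewrite c1 c2 c3 d1 d2 d3; exact: dot_curl_ring.
have ZN m a b : zero_integral (fun x => - 1 * B m a b x).
  by split; [exact: cintegrableZ|rewrite cintZ// B0 mulr0].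
have ZB m a b : zero_integral (B m a b) by [].
have [Zi Z0] := zero_integralD (zero_integralD
  (zero_integralD (ZB ix2 ix1 ix3) (ZN ix3 ix1 ix2))
  (zero_integralD (ZB ix3 ix2 ix1) (ZN ix1 ix2 ix3)))
  (zero_integralD (ZB ix1 ix3 ix2) (ZN ix2 ix3 ix1)).
by rewrite (cintD measurableT CI Zi) Z0 addr0.
Qed.

End CurlCalculus.

(** * The lateral cutoff to the period cell *)

Section Cutoff.
Context {R : realType}.
Local Notation pt := (space3 R).
Local Notation mR := (measurableTypeR R).
Local Notation mpt := (mR * mR * mR)%type.
Implicit Types (f g : pt -> R[i]) (x : pt) (w : field3 R).

Definition locally_cintegrable f := forall r, cintegrable mu3 (cube r : set mpt) f.

Lemma cintegrable_loc_supp f r : locally_cintegrable f ->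
  (forall x, ~ cube r x -> f x = 0) -> cintegrable mu3 setT (f : mpt -> R[i]).
Proof.
move=> lf f0; have [mf _] := lf 0.
have /(cintegrable_indic _ _ (@measurable_cube R r))[fi _] := lf r.
have E : (fun x : mpt => (\1_(cube r) x)%:C * f x) = f; last by rewrite E in fi.
apply/funext => x; rewrite indicE; case: (boolP (x \in cube r)) => [_|/negP nx].
  by rewrite mul1r.
by rewrite f0 ?mulr0// => cx; apply: nx; rewrite inE.
Qed.

Lemma locally_cintegrableM f g : locally_cintegrable f -> cmeas (g : mpt -> R[i]) ->
  (forall r, exists M, forall x, cube r x -> cabs (g x) <= M) ->
  locally_cintegrable (fun x => g x * f x).
Proof.
move=> lf mg gb r; have [M gM] := gb r.
by apply: (cintegrableM (M := M)) => //; exact: measurable_cube.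
Qed.

Lemma locally_cintegrableD f g : locally_cintegrable f -> locally_cintegrable g ->
  locally_cintegrable (fun x => f x + g x).
Proof. by move=> lf lg r; apply: cintegrableD => //; exact: measurable_cube. Qed.

Lemma bounded_cdifferentiable f : (forall x, cdifferentiable x f) ->
  forall r, exists M, forall x, cube r x -> cabs (f x) <= M.
Proof.
move=> df r.
have [M1 HM1] : exists M, forall x, cube r x -> `|Re (f x)| <= M.
  by apply: bounded_on_cube => x; apply: differentiable_continuous; case: (df x).
have [M2 HM2] : exists M, forall x, cube r x -> `|Im (f x)| <= M.
  by apply: bounded_on_cube => x; apply: differentiable_continuous; case: (df x).
exists (M1 + M2) => x cx; apply: le_trans (cabs_le _) _.
by apply: lerD; [exact: HM1|exact: HM2].
Qed.

Lemma locally_cintegrable_smoothM f g : locally_cintegrable f ->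
  (forall x, cdifferentiable x g) -> locally_cintegrable (fun x => g x * f x).
Proof.
move=> lf dg; apply: locally_cintegrableM => //; first exact: cmeas_cdifferentiable.
exact: bounded_cdifferentiable.
Qed.

Lemma Omega_cube r x : pi <= r -> Omega x -> `|x.2| <= r -> cube r x.
Proof.
move=> rp /andP[/andP[a1 a2] /andP[b1 b2]] x3; split=> //.
  by rewrite ler_norml; apply/andP; split; lra.
by rewrite ler_norml; apply/andP; split; lra.
Qed.

Lemma cabs_le_cnorm (a : 'cV[R[i]]_3) m : cabs (a m 0) <= cnorm a.
Proof.
rewrite /cnorm /cabs ler_sqrt; last by apply: sumr_ge0 => i _; rewrite addr_ge0 ?sqr_ge0.
rewrite /cnormsq (bigD1 m)//= lerDl.
by apply: sumr_ge0 => i _; rewrite addr_ge0 ?sqr_ge0.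
Qed.

(** On a bounded set, square integrability gives integrability through |w| <= 1 + |w|^2. *)
Lemma L2_cintegrable r (A : set pt) w m : measurable (A : set mpt) -> A `<=` cube r ->
  Lp_on 2 A w -> cintegrable mu3 (A : set mpt) (fun x => w x m 0).
Proof.
move=> mA Ar [mw wi].
have oi : mu3.-integrable (A : set mpt) (EFin \o (fun x => 1 * \1_(cube r) x)).
  by apply: (integrableS measurableT mA (@subsetT _ _)); exact: integrable_cube_indic.
have gi := integrableD mA oi wi.
apply: (cintegrable_le mA _ gi) => //.
- exact: mw.
- move=> x Ax; rewrite indicE mem_set ?mulr1; last exact: Ar.
  apply: le_trans (cabs_le_cnorm _ _) _.
  by have := sqr_ge0 (cnorm (w x) - 1); rewrite expr2; nra.
Qed.

Lemma L2loc_locally w m : Lp_loc 2 w -> locally_cintegrable (fun x => w x m 0).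
Proof. by move=> lw r; apply: (@L2_cintegrable r) => //; exact: measurable_cube. Qed.

(** The rise starts at -pi and the fall at pi, both to the right, so that the fall is the translate
    of the rise by one period. A cutoff symmetric about 0 would lack this property, on which
    [eta1_periodic] rests. *)
Definition theta (n : nat) (t : R) : R := step (n.+1%:R * (t + pi)) - step (n.+1%:R * (t - pi)).

Lemma theta_bounds n t : 0 <= theta n t <= 1.
Proof.
rewrite /theta; set a := _ * (t + pi); set b := _ * (t - pi).
have n0 : 1 <= n.+1%:R :> R by rewrite ler1n.
have p3 : 2 <= pi :> R by exact: pi_ge2.
have [b0|b0] := leP b 0; first by rewrite (step_le0 b0) subr0 step_ge0 step_le1.
have a1 : 1 <= a by move: b0; rewrite /a /b; nra.
by rewrite (step_ge1 a1) subr_ge0 step_le1 lerBlDr lerDl step_ge0.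
Qed.

Lemma theta_supp n t : pi + 1 < `|t| -> theta n t = 0.
Proof.
have n0 : 1 <= n.+1%:R :> R by rewrite ler1n.
have p3 : 2 <= pi :> R by exact: pi_ge2.
rewrite /theta lter_normr => /orP[h|h].
  by rewrite !step_ge1 ?subrr//; nra.
by rewrite !step_le0 ?subrr//; nra.
Qed.

(** At t = pi the value is 1 for every n, whereas the indicator of the open interval is 0 there; the
    corresponding faces are removed as a null set in [cutoff_limit]. *)
Lemma theta_cvg t : t != pi -> (fun n => theta n t) @ \oo --> ((- pi < t < pi)%R%:R : R).
Proof.
have p3 : 2 <= pi :> R by exact: pi_ge2.
have big (e : R) : 0 < e -> \forall n \near \oo, 1 <= n.+1%:R * e.
  move=> e0; have : \forall n \near \oo, (n.+1%:R^-1 : R) < e.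
    exact: (near_infty_natSinv_lt (PosNum e0)).
  by apply: filterS => n /ltW h; rewrite -ler_pdivrMl ?ltr0n// mulr1.
move=> tpi; apply: cvg_near_cst.
have [t1|t1] := leP t (- pi).
  apply: nearW => n; rewrite /theta /= !step_le0 ?subrr//.
    by rewrite mulr_ge0_le0//; lra.
  by rewrite mulr_ge0_le0//; lra.
have [t2|t2|tE] := ltgtP t pi; last by rewrite tE eqxx in tpi.
  have : 0 < t + pi by lra.
  move=> /big; apply: filterS => n h /=.
  by rewrite /theta step_ge1// step_le0 ?subr0// mulr_ge0_le0//; lra.
have /big h1 : 0 < t + pi by lra.
have /big h2 : 0 < t - pi by lra.
apply: filterS2 h1 h2 => n h1 h2 /=.
by rewrite /theta !step_ge1// subrr.
Qed.

Lemma rsmooth_theta n : rsmooth (theta n).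
Proof.
have E (a : R) : rsmooth (fun t : R => step (n.+1%:R * (t + a))).
  apply: (@rsmooth_comp _ step (fun t => n.+1%:R * (t + a))); first exact: rsmooth_step.
  have -> : (fun t : R => n.+1%:R * (t + a)) = (fun t => n.+1%:R * t + n.+1%:R * a).
    by apply/funext => t; rewrite mulrDr.
  exact: rsmooth_affine.
by apply: (@rsmoothD _ _ (fun t => - step (n.+1%:R * (t - pi)))); [exact: E|apply: rsmoothN; exact: E].
Qed.

Lemma measurable_theta1 n : measurable_fun setT (fun x : mpt => theta n x.1.1).
Proof.
exact: (measurableT_comp (continuous_measurable_fun (rsmooth_continuous (@rsmooth_theta n))) measurable_coord1).
Qed.

Lemma measurable_theta2 n : measurable_fun setT (fun x : mpt => theta n x.1.2).
Proof.
exact: (measurableT_comp (continuous_measurable_fun (rsmooth_continuous (@rsmooth_theta n))) measurable_coord2).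
Qed.

Definition eta (n : nat) x : R[i] := (theta n x.1.1 * theta n x.1.2)%:C.

Lemma cmeas_eta n : cmeas (eta n : mpt -> R[i]).
Proof. by apply: cmeas_real; apply: measurable_funM; [exact: measurable_theta1|exact: measurable_theta2]. Qed.

Lemma cabs_eta n x : cabs (eta n x) <= 1.
Proof.
rewrite cabs_real normrM; have /andP[a0 a1] := theta_bounds n x.1.1.
have /andP[b0 b1] := theta_bounds n x.1.2.
by rewrite !ger0_norm// -[leRHS]mulr1 ler_pM.
Qed.

Lemma eta_supp n r x : pi + 1 <= r -> ~ cube r x -> `|x.2| <= r -> eta n x = 0.
Proof.
move=> rp ncx x3; rewrite /eta.
have [h1|h1] := leP `|x.1.1| r; last by rewrite theta_supp ?mul0r//; lra.
have [h2|h2] := leP `|x.1.2| r; last by rewrite [theta n x.1.2]theta_supp ?mulr0//; lra.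
by case: ncx.
Qed.

(* The cutoff eta_n tends to the indicator of the period cell off the faces. *)
Lemma cutoff_limit f r : locally_cintegrable f -> (forall x, r < `|x.2| -> f x = 0) ->
  (forall n, cintegrable mu3 setT (fun x : mpt => eta n x * f x)) /\
  converges (fun n => cint mu3 setT (fun x : mpt => eta n x * f x)) (integral3 Omega f).
Proof.
(* The lateral supports of all [eta n] lie within pi + 1, so one cube serves the whole sequence and
   supplies the dominating function. *)
move=> lf f0; pose s := Num.max r (pi + 1).
have rs : r <= s by rewrite le_max lexx.
have ps : pi + 1 <= s by rewrite le_max lexx orbT.
have [mf _] := lf 0; have ms := @measurable_cube R s.
have ef0 n x : ~ cube s x -> eta n x * f x = 0.
  move=> ncx; have [x3|x3] := leP `|x.2| s; first by rewrite (@eta_supp n s)// mul0r.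
  by rewrite f0 ?mulr0//; lra.
have efi n : cintegrable mu3 setT (fun x : mpt => eta n x * f x).
  apply: (@cintegrable_loc_supp _ s); last exact: ef0.
  apply: locally_cintegrableM; [exact: lf|exact: cmeas_eta|].
  by move=> t; exists 1 => x _; exact: cabs_eta.
split; first exact: efi.
pose N : set mpt := [set x | x.1.1 = pi] `|` [set x | x.1.2 = pi].
have mN : measurable N by apply: measurableU; [exact: measurable_plane1|exact: measurable_plane2].
have N0 : mu3 N = 0%E.
  by apply: null_set_setU; [exact: measurable_plane1|exact: measurable_plane2|exact: mu3_plane1|exact: mu3_plane2].
have mO := @measurable_Omega R.
pose A : set mpt := setT `\` N.
have mA : measurable A by exact: measurableD.
have E n : cint mu3 setT (fun x : mpt => eta n x * f x) = cint mu3 A (fun x : mpt => eta n x * f x).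
  exact: cint_null.
have mof : cmeas (fun x : mpt => (\1_(Omega : set mpt) x)%:C * f x).
  by apply: cmeasM mf; exact: cmeas_indic.
have fs : mu3.-integrable setT (EFin \o (fun x : mpt => cabs ((\1_(cube s) x)%:C * f x))).
  by have /(cintegrable_indic _ _ ms)[[_ ?] _] := lf s.
have ofs : cintegrable mu3 setT (fun x : mpt => (\1_(Omega : set mpt) x)%:C * f x).
  apply: (cintegrable_le _ mof fs) => // x _.
  have [cx|ncx] := pselect (cube s x).
    rewrite [\1_(cube s) x]indicE (mem_set cx) mul1r cabsM ler_piMl ?cabs_ge0//.
    by rewrite cabs_real indicE; case: (x \in _); rewrite ?normr1 ?normr0.
  rewrite [leLHS](_ : _ = 0) ?cabs_ge0// indicE.
  case: (boolP (x \in _)) => [/set_mem Ox|_]; last by rewrite mul0r cabs0.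
  rewrite mul1r f0 ?cabs0//; apply: le_lt_trans rs _; rewrite ltNge; apply/negP => x3.
  by apply: ncx; apply: Omega_cube => //; lra.
have -> : integral3 Omega f = cint mu3 A (fun x : mpt => (\1_(Omega : set mpt) x)%:C * f x).
  rewrite /A -(cint_null measurableT mN N0 ofs) -cint_indic; reflexivity.
rewrite (_ : (fun n => _) = (fun n => cint mu3 A (fun x : mpt => eta n x * f x))); last by apply/funext => n.
apply: (@cint_dominated _ _ _ _ _ _ _ (fun x : mpt => cabs ((\1_(cube s) x)%:C * f x))).
- exact: mA.
- by move=> n; exact: cmeasM (cmeas_eta n) mf.
- exact: mof.
- exact: (integrableS measurableT mA (@subsetT _ _) fs).
- move=> x [_ /= Nx]; have x1 : x.1.1 != pi by apply/eqP => xE; apply: Nx; left.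
  have x2 : x.1.2 != pi by apply/eqP => xE; apply: Nx; right.
  have cv : (fun n => theta n x.1.1 * theta n x.1.2) @ \oo --> (\1_(Omega : set mpt) x : R).
    have <- : ((- pi < x.1.1 < pi)%R%:R * (- pi < x.1.2 < pi)%R%:R : R) = \1_(Omega : set mpt) x.
      rewrite -natrM mulnb indicE; congr (_ %:R); congr nat_of_bool.
      by apply/idP/idP => [h|/set_mem//]; apply/mem_set.
    exact: cvgM (theta_cvg x1) (theta_cvg x2).
  split.
    under eq_fun do rewrite cReM /= mul0r subr0.
    by rewrite cReM /= mul0r subr0; exact: cvgMr_tmp cv.
  under eq_fun do rewrite cImM /= mul0r addr0.
  by rewrite cImM /= mul0r addr0; exact: cvgMr_tmp cv.
- move=> n x _; have [cx|ncx] := pselect (cube s x).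
    by rewrite indicE mem_set// mul1r cabsM ler_piMl ?cabs_ge0// cabs_eta.
  by rewrite ef0// cabs0 cabs_ge0.
Qed.

End Cutoff.

(** * Lateral Fourier modes *)

Section Modes.
Context {R : realType}.
Local Notation pt := (space3 R).
Local Notation mR := (measurableTypeR R).
Local Notation mpt := (mR * mR * mR)%type.
Variables (alpha : R * R) (j : lattice).
Implicit Types (x : pt) (q : R -> 'cV[R[i]]_3) (u w : field3 R).

Lemma col3_ext (a b : 'cV[R[i]]_3) : a ix1 0 = b ix1 0 -> a ix2 0 = b ix2 0 ->
  a ix3 0 = b ix3 0 -> a = b.
Proof.
by move=> h1 h2 h3; apply/colP => m; case: (ix_cases m) => ->.
Qed.

Definition wave (a : R) (t : R) : R[i] := expi ((- a)%:C * t%:C).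

Lemma csmooth_wave a : csmooth (wave a).
Proof.
by have := csmooth_expi (- a)%:C 0; under eq_fun do rewrite addr0.
Qed.

Lemma is_cderive_wave a t : is_cderive t (wave a) ('i * (- a)%:C * wave a t).
Proof.
by have := is_cderive_expi (- a)%:C 0 t; rewrite /wave addr0; under eq_fun do rewrite addr0.
Qed.

Lemma expi_2pi_int (z : int) : expi (pi *+ 2 * z%:~R)%:C = 1 :> R[i].
Proof.
have H (n : nat) : expi (pi *+ 2 * n%:R)%:C = 1 :> R[i].
  elim: n => [|n IH]; first by rewrite mulr0 expi0.
  rewrite -natr1 mulrDr mulr1 rmorphD expiD IH mul1r.
  by apply: complex_ext; rewrite /expi /= oppr0 expR0 ?cos2pi ?sin2pi ?mulr1 ?mulr0.
case: z => n; first exact: H.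
rewrite NegzE mulrNz mulrN rmorphN /=.
by rewrite -[LHS]mul1r -[X in X * _](H n.+1) expiK.
Qed.

Lemma phaseV (l : lattice) : (phase alpha l)^-1 =
  expi (- (pi *+ 2 * (alpha.1 * l.1%:~R + alpha.2 * l.2%:~R))%:C).
Proof.
have H := expiK (pi *+ 2 * (alpha.1 * l.1%:~R + alpha.2 * l.2%:~R))%:C.
have ph0 : phase alpha l != 0.
  by apply/eqP => h; move: H; rewrite -/(phase alpha l) h mul0r => /esym/eqP; rewrite oner_eq0.
by apply: (mulfI ph0); rewrite mulfV// H.
Qed.

Lemma phase_neq0 (l : lattice) : phase alpha l != 0.
Proof.
apply/eqP => h; have := expiK (pi *+ 2 * (alpha.1 * l.1%:~R + alpha.2 * l.2%:~R))%:C.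
by rewrite -/(phase alpha l) h mul0r => /esym/eqP; rewrite oner_eq0.
Qed.

(** The conjugate of the lateral factor of a Rayleigh mode: integrating u against it over a slice of
    the cell extracts the coefficient of index [j]. *)
Definition waves x : R[i] := wave (alpha1 alpha j) x.1.1 * wave (alpha2 alpha j) x.1.2.

(** The index j adds an integer multiple of 2 pi to the phase, so all modes share the
    quasiperiodicity of alpha, here inverted because of the conjugation. *)
Lemma waves_shift (l : lattice) x : waves (x + Defs.shift l) = (phase alpha l)^-1 * waves x.
Proof.
rewrite phaseV.
rewrite /waves /wave /Defs.shift /= -!expiD.
set z1 := (X in expi X = _); set z2 := (X in _ = expi X).
have -> : z1 = z2 + (pi *+ 2 * (- (j.1 * l.1 + j.2 * l.2))%:~R)%:C.
  rewrite /z1 /z2 /alpha1 /alpha2; apply: complex_ext; rewrite !(cReD, cImD, cReN, cImN, cReM, cImM)/=.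
    rewrite mulrNz intrD !intrM; ring.
  by rewrite ?(mulr0, mul0r, addr0, oppr0, subr0).
by rewrite expiD expi_2pi_int mulr1.
Qed.

Definition mode q : field3 R := fun x => waves x *: q x.2.

Lemma mode_tensor q m : (fun x => mode q x m 0) =
  tensor (wave (alpha1 alpha j)) (wave (alpha2 alpha j)) (fun t => q t m 0).
Proof. by apply/funext => x; rewrite /mode mxE. Qed.

Definition vsmooth q := forall m, csmooth (fun t => q t m 0).

Lemma smooth_mode q m : vsmooth q -> smooth (fun x => mode q x m 0).
Proof.
by move=> sq; rewrite mode_tensor; apply: smooth_tensor; [exact: csmooth_wave|exact: csmooth_wave|exact: sq].
Qed.

(** The curl seen on profiles in x3: on a mode the lateral derivatives are multiplications by -i
    alpha_1 and -i alpha_2, which leaves an ordinary differential operator. *)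
Definition chat q : R -> 'cV[R[i]]_3 := fun t =>
  let a1 := 'i * (- alpha1 alpha j)%:C in
  let a2 := 'i * (- alpha2 alpha j)%:C in
  let d m := cder (fun s => q s m 0) t in
  vec3 (a2 * q t ix3 0 - d ix2) (d ix1 - a1 * q t ix3 0) (a1 * q t ix2 0 - a2 * q t ix1 0).

Lemma partial_mode q x b : vsmooth q -> [/\
  partial ix1 (fun y => mode q y b 0) x = waves x * ('i * (- alpha1 alpha j)%:C * q x.2 b 0),
  partial ix2 (fun y => mode q y b 0) x = waves x * ('i * (- alpha2 alpha j)%:C * q x.2 b 0) &
  partial ix3 (fun y => mode q y b 0) x = waves x * cder (fun s => q s b 0) x.2].
Proof.
move=> sq; have cw a t := is_cderive_cder (is_cderive_wave a t).
by split; rewrite mode_tensor (partial_tensor _ (csmooth_wave _) (csmooth_wave _) (sq b))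
  /tensor_partial /tensor /waves /= ?cw; ring.
Qed.

Lemma curl_mode q : vsmooth q -> curl (mode q) = mode (chat q).
Proof.
move=> sq; apply/funext => x.
have [c1 c2 c3] := curlE (mode q) x; have [v1 v2 v3] := @vec3E R
  ('i * (- alpha2 alpha j)%:C * q x.2 ix3 0 - cder (fun s => q s ix2 0) x.2)
  (cder (fun s => q s ix1 0) x.2 - 'i * (- alpha1 alpha j)%:C * q x.2 ix3 0)
  ('i * (- alpha1 alpha j)%:C * q x.2 ix2 0 - 'i * (- alpha2 alpha j)%:C * q x.2 ix1 0).
have [p11 p12 p13] := partial_mode x ix1 sq.
have [p21 p22 p23] := partial_mode x ix2 sq.
have [p31 p32 p33] := partial_mode x ix3 sq.
apply: col3_ext; rewrite ?c1 ?c2 ?c3 [RHS]mxE /chat ?v1 ?v2 ?v3 mulrBr.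
- by rewrite p32 p23.
- by rewrite p13 p31.
- by rewrite p21 p12.
Qed.

End Modes.

(** * Modes cut off laterally as test fields *)

Section WeakCurlCell.
Context {R : realType}.
Local Notation pt := (space3 R).
Local Notation mR := (measurableTypeR R).
Local Notation mpt := (mR * mR * mR)%type.
Variables (alpha : R * R) (j : lattice).
Implicit Types (x : pt) (q : R -> 'cV[R[i]]_3) (u c w : field3 R).
Local Notation mode := (mode alpha j).
Local Notation chat := (chat alpha j).

Lemma vec3_csmooth (f g h : R -> R[i]) : csmooth f -> csmooth g -> csmooth h ->
  vsmooth (fun t => vec3 (f t) (g t) (h t)).
Proof.
move=> sf sg sh m.
have E t := vec3E (f t) (g t) (h t).
case: (ix_cases m) => ->.
- by rewrite (_ : (fun t => _) = f)//; apply/funext => t; case: (E t).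
- by rewrite (_ : (fun t => _) = g)//; apply/funext => t; case: (E t).
- by rewrite (_ : (fun t => _) = h)//; apply/funext => t; case: (E t).
Qed.

Lemma csmoothN (f : R -> R[i]) : csmooth f -> csmooth (fun t => - f t).
Proof.
move=> sf; have := csmoothM (csmooth_cst (-1)) sf.
by under eq_fun do rewrite mulN1r.
Qed.

Lemma csmoothZ (a : R[i]) (f : R -> R[i]) : csmooth f -> csmooth (fun t => a * f t).
Proof. by move=> sf; exact: csmoothM (csmooth_cst a) sf. Qed.

Lemma vsmooth_chat q : vsmooth q -> vsmooth (chat q).
Proof.
move=> sq; apply: vec3_csmooth.
- by apply: csmoothD; [exact: csmoothZ (sq ix3)|apply: csmoothN; exact: csmooth_cder (sq ix2)].
- by apply: csmoothD; [exact: csmooth_cder (sq ix1)|apply: csmoothN; exact: csmoothZ (sq ix3)].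
- by apply: csmoothD; [exact: csmoothZ (sq ix2)|apply: csmoothN; exact: csmoothZ (sq ix1)].
Qed.

Definition vsupp (r : R) q := forall t, r < `|t| -> q t = 0.

Lemma open_norm_gt (r : R) : open [set t : R | r < `|t|].
Proof.
by apply: (@open_comp _ _ (@Num.norm R R) [set s : R | r < s]); [move=> t _; exact: norm_continuous|exact: open_gt].
Qed.

Lemma cder_norm_supp (f : R -> R[i]) (r : R) : (forall t, r < `|t| -> f t = 0) ->
  forall t, r < `|t| -> cder f t = 0.
Proof. by move=> f0 t rt; apply: (cder_supp (@open_norm_gt r)). Qed.

Lemma vsupp_chat r q : vsupp r q -> vsupp r (chat q).
Proof.
move=> q0 t rt; have d0 m : cder (fun s => q s m 0) t = 0.
  by apply: (cder_norm_supp (r := r)) => // s rs; rewrite q0 ?mxE.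
have qt m : q t m 0 = 0 by rewrite q0 ?mxE.
rewrite /chat !d0 !qt !mulr0 !subr0.
by have [h1 h2 h3] := @vec3E R 0 0 0; apply: col3_ext; rewrite ?h1 ?h2 ?h3 mxE.
Qed.

Lemma mode_supp r q x : vsupp r q -> r < `|x.2| -> mode q x = 0.
Proof. by move=> q0 rx; rewrite /mode q0// scaler0. Qed.

Definition cutoff n q : field3 R := fun x => eta n x *: mode q x.

Let th n (a : R) (t : R) : R[i] := (theta n t)%:C * wave a t.

Let csmooth_th n a : csmooth (th n a).
Proof.
by apply: csmoothM; [apply: csmooth_real; exact: rsmooth_theta|exact: csmooth_wave].
Qed.

Let cutoff_tensor n q m : (fun x => cutoff n q x m 0) =
  tensor (th n (alpha1 alpha j)) (th n (alpha2 alpha j)) (fun t => q t m 0).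
Proof.
apply/funext => x; rewrite /cutoff !mxE /tensor /th /waves /eta rmorphM; ring.
Qed.

Lemma test_field_cutoff n r q : vsmooth q -> vsupp r q -> test_field (cutoff n q).
Proof.
move=> sq q0; split.
  by move=> m; rewrite cutoff_tensor; apply: smooth_tensor; [exact: csmooth_th|exact: csmooth_th|exact: sq].
exists (Num.max r (pi + 1)) => x ncx; rewrite /cutoff.
have [x3|x3] := leP `|x.2| (Num.max r (pi + 1)).
  by rewrite (eta_supp _ _ ncx x3) ?scale0r// le_max lexx orbT.
by rewrite (mode_supp q0) ?scaler0//; move: x3; rewrite gt_max => /andP[].
Qed.

Definition eta1 n x : R[i] := (derive1 (theta n) x.1.1 * theta n x.1.2)%:C.
Definition eta2 n x : R[i] := (theta n x.1.1 * derive1 (theta n) x.1.2)%:C.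

Let cder_th n a t : cder (th n a) t =
  (derive1 (theta n) t)%:C * wave a t + (theta n t)%:C * ('i * (- a)%:C * wave a t).
Proof.
apply: is_cderive_cder; apply: is_cderiveM; last exact: is_cderive_wave.
by apply: is_cderive_real; apply: rsmooth_is_derive; exact: rsmooth_theta.
Qed.

Lemma partial_cutoff n q x b : vsmooth q -> [/\
  partial ix1 (fun y => cutoff n q y b 0) x =
    eta n x * partial ix1 (fun y => mode q y b 0) x + eta1 n x * mode q x b 0,
  partial ix2 (fun y => cutoff n q y b 0) x =
    eta n x * partial ix2 (fun y => mode q y b 0) x + eta2 n x * mode q x b 0 &
  partial ix3 (fun y => cutoff n q y b 0) x =
    eta n x * partial ix3 (fun y => mode q y b 0) x].
Proof.
move=> sq; have [-> -> ->] := partial_mode alpha j x b sq.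
have Em : mode q x b 0 = waves alpha j x * q x.2 b 0 by rewrite /mode mxE.
by split; rewrite ?Em cutoff_tensor (partial_tensor _ (csmooth_th _ _) (csmooth_th _ _) (sq b))
  /tensor_partial /tensor /waves /eta /eta1 /eta2 /th /= ?cder_th ?rmorphM; ring.
Qed.

Let cutoff_ring (e e1 e2 p12 p13 p21 p23 p31 p32 m1 m2 m3 u1 u2 u3 : R[i]) :
  u1 * (e * p23 + e2 * m3 - e * p32) + u2 * (e * p31 - (e * p13 + e1 * m3)) +
    u3 * (e * p12 + e1 * m2 - (e * p21 + e2 * m1)) =
  e * (u1 * (p23 - p32) + u2 * (p31 - p13) + u3 * (p12 - p21)) +
  (e1 * (u3 * m2 - u2 * m3) + e2 * (u1 * m3 - u3 * m1)).
Proof. by ring. Qed.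

(** The product rule curl (eta G) = eta curl G + grad eta x G, paired with [a]. The cutoff does not
    depend on x3, so only two components of its gradient occur. *)
Lemma dot_curl_cutoff n q x (a : 'cV[R[i]]_3) : vsmooth q ->
  dot a (curl (cutoff n q) x) = eta n x * dot a (curl (mode q) x) +
  (eta1 n x * (a ix3 0 * mode q x ix2 0 - a ix2 0 * mode q x ix3 0) +
   eta2 n x * (a ix1 0 * mode q x ix3 0 - a ix3 0 * mode q x ix1 0)).
Proof.
move=> sq; rewrite !dotE.
have [c1 c2 c3] := curlE (cutoff n q) x; have [d1 d2 d3] := curlE (mode q) x.
rewrite c1 c2 c3 d1 d2 d3.
have [p1 p2 p3] := partial_cutoff n x ix1 sq.
have [r1 r2 r3] := partial_cutoff n x ix2 sq.
have [s1 s2 s3] := partial_cutoff n x ix3 sq.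
rewrite p2 p3 r1 r3 s1 s2; exact: cutoff_ring.
Qed.

Lemma mode_shift q l x : mode q (x + Defs.shift l) = (phase alpha l)^-1 *: mode q x.
Proof.
by rewrite /mode waves_shift scalerA; congr (_ *: q _); rewrite /Defs.shift /= addr0.
Qed.

End WeakCurlCell.

(** * The cutoff derivative against periodic functions *)

Section PeriodicCutoff.
Context {R : realType}.
Local Notation pt := (space3 R).
Local Notation mR := (measurableTypeR R).
Local Notation mpt := (mR * mR * mR)%type.
Implicit Types (f : pt -> R[i]) (x : pt).

Let half n (t : R) : R := derive1 (fun s => step (n.+1%:R * s)) t.

Let rsmooth_stepn n : rsmooth (fun t : R => step (n.+1%:R * t)).
Proof.
apply: (@rsmooth_comp _ step (fun t => n.+1%:R * t)); first exact: rsmooth_step.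
by have := @rsmooth_affine R n.+1%:R 0; under eq_fun do rewrite addr0.
Qed.

Let derive1_theta n t : derive1 (theta n) t = half n (t + pi) - half n (t - pi).
Proof.
rewrite derive1E; have D (a : R) : is_derive t 1 (fun s : R => step (n.+1%:R * (s + a))) (half n (t + a)).
  have da : is_derive t 1 (fun s : R => s + a) 1.
    have := is_deriveD (is_derive_id t 1) (is_derive_cst a t 1).
    by move/is_derive_eq; apply; rewrite addr0.
  have := @is_derive1_comp _ (fun s => step (n.+1%:R * s)) (fun s => s + a) t _ 1
    (rsmooth_is_derive (@rsmooth_stepn n) (t + a)) da.
  by rewrite mulr1.
by have [_ ->] := is_deriveB (D pi) (D (- pi)).
Qed.

Let half_supp n t : 1 < `|t| -> half n t = 0.
Proof.
move=> t1; rewrite /half derive1E.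
have n0 : 1 <= n.+1%:R :> R by rewrite ler1n.
have [t0|t0] := leP t 0.
  have tn : t < -1 by move: t1; rewrite ler0_norm//; lra.
  rewrite (@near_eq_derive _ _ _ _ (fun=> 0)) ?derive_cst//.
  have : \near t, t < 0 by apply: lt_nbhsl; lra.
  by apply: filterS => s s0; rewrite step_le0// mulr_ge0_le0// ltW.
rewrite gtr0_norm// in t1.
rewrite (@near_eq_derive _ _ _ _ (fun=> 1 : R)) ?derive_cst//.
have := lt_nbhsr t1.
by apply: filterS => s s0; rewrite step_ge1//; nra.
Qed.

Let half_continuous n : continuous (half n).
Proof. exact: rsmooth_continuous (rsmooth_derive1 (@rsmooth_stepn n)). Qed.

Let half_bounded n : exists M, forall t, `|half n t| <= M.
Proof.
have := @continuous_compact _ _ (half n) `[-1, 1]%classic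
  (continuous_subspaceT (@half_continuous n)) (@segment_compact R (-1) 1).
move/compact_bounded => [M [_ HM]]; exists (Num.max 0 (M + 1)) => t; rewrite le_max.
have [t1|t1] := leP `|t| 1; last by rewrite half_supp// normr0 lexx.
rewrite (HM (M + 1)) ?orbT// ?ltrDl//; exists t => //=.
by rewrite in_itv/= -ler_norml.
Qed.

Let translate_diff0 (H : pt -> R[i]) v : cintegrable mu3 setT (H : mpt -> R[i]) ->
  zero_integral (fun x => H x + -1 * H (x + v)).
Proof.
move=> Hi; have [ti tE] := cint_translate v Hi.
have ni := cintegrableZ (-1) measurableT ti.
split; first exact: (cintegrableD measurableT Hi ni).
by rewrite (cintD measurableT Hi ni) (cintZ _ measurableT ti) tE mulN1r subrr.
Qed.

(* The derivative of the cutoff is a difference of two translates by a period,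
   so that its product with a periodic function has zero integral. *)
Lemma eta1_periodic f r n : locally_cintegrable f ->
  (forall x, r < `|x.2| -> f x = 0) ->
  (forall l x, f (x + Defs.shift l) = f x) ->
  zero_integral (fun x => eta1 n x * f x).
Proof.
move=> lf f0 fp; pose p x := half n (x.1.1 + pi) * theta n x.1.2.
have [M HM] := half_bounded n.
have mp : measurable_fun setT (p : mpt -> R).
  apply: measurable_funM; last exact: measurable_theta2.
  apply: (measurableT_comp (continuous_measurable_fun (@half_continuous n))).
  by apply: measurable_funD => //; exact: measurable_coord1.
have Hi : cintegrable mu3 setT (fun x : mpt => (p x)%:C * f x).
  apply: (@cintegrable_loc_supp _ _ (Num.max r (pi + 1))) => [|x ncx].
    apply: locally_cintegrableM; [exact: lf|exact: cmeas_real|].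
    move=> t; exists M => x _; rewrite cabs_real normrM.
    have /andP[t0 t1] := theta_bounds n x.1.2; rewrite (ger0_norm t0).
    by apply: le_trans (HM (x.1.1 + pi)); rewrite ler_piMr.
  have [x3|x3] := leP `|x.2| r; last by rewrite f0 ?mulr0.
  have [x2|x2] := leP `|x.1.2| (pi + 1); last by rewrite /p theta_supp// mulr0 mul0r.
  have [x1|x1] := leP `|x.1.1 + pi| 1; last by rewrite /p half_supp// !mul0r.
  case: ncx; split; rewrite le_max ?x3 ?x2 ?orbT//.
  have p2 : 2 <= pi :> R by exact: pi_ge2.
  by apply/orP; right; move: x1; rewrite !ler_norml => /andP[? ?]; apply/andP; split; lra.
(* Going back one period in x1 carries the derivative of the rise at -pi to that of the fall at pi,
   so the difference of the two translates is the derivative of [theta]. *)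
have [] := translate_diff0 (Defs.shift (-1, 0)) Hi.
have E : (fun x : mpt => (p x)%:C * f x + -1 * ((p (x + Defs.shift (-1, 0)))%:C * f (x + Defs.shift (-1, 0)))) =
    (fun x => eta1 n x * f x).
  apply/funext => x; rewrite fp /eta1 derive1_theta /p /Defs.shift /= mulr0 addr0.
  have -> : x.1.1 + pi *+ 2 * (-1)%:~R + pi = x.1.1 - pi by rewrite mulrN1 mulr2n; ring.
  by rewrite mulrBl rmorphB mulrBl mulN1r.
by rewrite E.
Qed.

Lemma eta2_periodic f r n : locally_cintegrable f ->
  (forall x, r < `|x.2| -> f x = 0) ->
  (forall l x, f (x + Defs.shift l) = f x) ->
  zero_integral (fun x => eta2 n x * f x).
Proof.
move=> lf f0 fp; pose p x := theta n x.1.1 * half n (x.1.2 + pi).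
have [M HM] := half_bounded n.
have mp : measurable_fun setT (p : mpt -> R).
  apply: measurable_funM; first exact: measurable_theta1.
  apply: (measurableT_comp (continuous_measurable_fun (@half_continuous n))).
  by apply: measurable_funD => //; exact: measurable_coord2.
have Hi : cintegrable mu3 setT (fun x : mpt => (p x)%:C * f x).
  apply: (@cintegrable_loc_supp _ _ (Num.max r (pi + 1))) => [|x ncx].
    apply: locally_cintegrableM; [exact: lf|exact: cmeas_real|].
    move=> t; exists M => x _; rewrite cabs_real normrM.
    have /andP[t0 t1] := theta_bounds n x.1.1; rewrite (ger0_norm t0).
    by apply: le_trans (HM (x.1.2 + pi)); rewrite ler_piMl.
  have [x3|x3] := leP `|x.2| r; last by rewrite f0 ?mulr0.
  have [x1|x1] := leP `|x.1.1| (pi + 1); last by rewrite /p theta_supp// !mul0r.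
  have [x2|x2] := leP `|x.1.2 + pi| 1; last by rewrite /p half_supp// mulr0 mul0r.
  case: ncx; split; rewrite le_max ?x3 ?x1 ?orbT//.
  have p2 : 2 <= pi :> R by exact: pi_ge2.
  by apply/orP; right; move: x2; rewrite !ler_norml => /andP[? ?]; apply/andP; split; lra.
have [] := translate_diff0 (Defs.shift (0, -1)) Hi.
have E : (fun x : mpt => (p x)%:C * f x + -1 * ((p (x + Defs.shift (0, -1)))%:C * f (x + Defs.shift (0, -1)))) =
    (fun x => eta2 n x * f x).
  apply/funext => x; rewrite fp /eta2 derive1_theta /p /Defs.shift /= mulr0 addr0.
  have -> : x.1.2 + pi *+ 2 * (-1)%:~R + pi = x.1.2 - pi by rewrite mulrN1 mulr2n; ring.
  move: (theta n _) (half n (_ + pi)) (half n (_ - pi)) (f x) => a b d z.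
  by rewrite mulrBr rmorphB; ring.
by rewrite E.
Qed.

End PeriodicCutoff.

(** * The weak formulation tested against modes *)

Section MaxwellModes.
Context {R : realType}.
Local Notation pt := (space3 R).
Local Notation mR := (measurableTypeR R).
Local Notation mpt := (mR * mR * mR)%type.
Implicit Types (x : pt) (q : R -> 'cV[R[i]]_3) (u c w : field3 R) (f : pt -> R[i]).

Lemma locally_cintegrable_dot u w : Lp_loc 2 u ->
  (forall m x, cdifferentiable x (fun y => w y m 0)) ->
  locally_cintegrable (fun x => dot (u x) (w x)).
Proof.
move=> lu dw; have E : (fun x => dot (u x) (w x)) = (fun x =>
  w x ix1 0 * u x ix1 0 + w x ix2 0 * u x ix2 0 + w x ix3 0 * u x ix3 0).
  by apply/funext => x; rewrite dotE ![w x _ _ * _]mulrC.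
have L m : locally_cintegrable (fun x => w x m 0 * u x m 0).
  exact: (locally_cintegrable_smoothM (L2loc_locally m lu) (dw m)).
rewrite E; exact: (locally_cintegrableD (locally_cintegrableD (L ix1) (L ix2)) (L ix3)).
Qed.

Lemma converges_unique (a : nat -> R[i]) (l l' : R[i]) : converges a l -> converges a l' -> l = l'.
Proof.
by move=> [r i] [r' i']; apply: complex_ext; [exact: cvg_unique r r'|exact: cvg_unique i i'].
Qed.

Lemma partial_conj m f x : cdifferentiable x f ->
  partial m (fun y => Num.conj (f y)) x = Num.conj (partial m f x).
Proof.
move=> df; apply: is_partialE; have [rf jf] := cdifferentiable_partial m df.
split; first by under eq_fun do rewrite cRe_conj; rewrite cRe_conj.
by under eq_fun do rewrite cIm_conj; rewrite cIm_conj; exact: is_deriveN.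
Qed.

Lemma smooth_conj f : smooth f -> smooth (fun x => Num.conj (f x)).
Proof.
move=> sf s x.
have E : foldr partial (fun y => Num.conj (f y)) s = (fun y => Num.conj (foldr partial f s y)).
  elim: s => //= m s ->; apply/funext => y; apply: partial_conj; exact: (sf s y).
rewrite E; have [rf jf] := sf s x; split.
  by under eq_fun do rewrite cRe_conj.
by under eq_fun do rewrite cIm_conj; exact: differentiableN.
Qed.

Lemma conjvK (a : 'cV[R[i]]_3) : conjv (conjv a) = a.
Proof. by apply/colP => m; rewrite !mxE conjCK. Qed.

Lemma curl_conjv w : (forall m x, cdifferentiable x (fun y => w y m 0)) ->
  curl (fun x => conjv (w x)) = (fun x => conjv (curl w x)).
Proof.
move=> dw; apply/funext => x.
have E m : (fun y => conjv (w y) m 0) = (fun y => Num.conj (w y m 0)).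
  by apply/funext => y; rewrite mxE.
have [c1 c2 c3] := curlE (fun x => conjv (w x)) x; have [d1 d2 d3] := curlE w x.
apply: col3_ext; rewrite ?c1 ?c2 ?c3 [RHS]mxE ?d1 ?d2 ?d3 !E.
- by rewrite (partial_conj ix2 (dw ix3 x)) (partial_conj ix3 (dw ix2 x)) rmorphB.
- by rewrite (partial_conj ix3 (dw ix1 x)) (partial_conj ix1 (dw ix3 x)) rmorphB.
- by rewrite (partial_conj ix1 (dw ix2 x)) (partial_conj ix2 (dw ix1 x)) rmorphB.
Qed.

Lemma cnorm_sq (a : 'cV[R[i]]_3) : cnorm a ^+ 2 =
  cabs (a ix1 0) ^+ 2 + cabs (a ix2 0) ^+ 2 + cabs (a ix3 0) ^+ 2.
Proof.
have h (z : R[i]) : cabs z ^+ 2 = Re z ^+ 2 + Im z ^+ 2.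
  by rewrite sqr_sqrtr// addr_ge0 ?sqr_ge0.
rewrite /cnorm sqr_sqrtr; last by apply: sumr_ge0 => i _; rewrite addr_ge0 ?sqr_ge0.
by rewrite /cnormsq sum3E !h.
Qed.

Lemma Lp_loc_cdifferentiable w : (forall m x, cdifferentiable x (fun y => w y m 0)) ->
  Lp_loc 2 w.
Proof.
move=> dw r; have mw m : cmeas (fun x : mpt => w x m 0) by exact: cmeas_cdifferentiable (dw m).
split; first by move=> m; exact: mw.
have [M1 H1] := bounded_cdifferentiable (dw ix1) r.
have [M2 H2] := bounded_cdifferentiable (dw ix2) r.
have [M3 H3] := bounded_cdifferentiable (dw ix3) r.
have mc := @measurable_cube R r.
have oi : mu3.-integrable (cube r : set mpt) (EFin \o (fun x => (M1 ^+ 2 + M2 ^+ 2 + M3 ^+ 2) * \1_(cube r) x)).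
  exact: (integrableS measurableT mc (@subsetT _ _) (integrable_cube_indic r _)).
apply: le_integrable oi => //.
  apply/measurable_EFinP; apply: measurable_funTS.
  under eq_fun do rewrite cnorm_sq.
  by apply: measurable_funD; [apply: measurable_funD|]; apply: measurable_funX; exact: cmeas_cabs.
move=> x cx /=; rewrite lee_fin ger0_norm ?exprn_ge0 ?sqrtr_ge0//.
rewrite cnorm_sq indicE mem_set// mulr1 (le_trans _ (ler_norm _))//.
have sq_le (z : R[i]) (M : R) : cabs z <= M -> cabs z ^+ 2 <= M ^+ 2.
  move=> zM; rewrite lerXn2r ?nnegrE ?cabs_ge0//.
  exact: le_trans (cabs_ge0 z) zM.
by rewrite !lerD// sq_le// ?H1 ?H2 ?H3.
Qed.

Variables (alpha : R * R) (j : lattice).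
Local Notation mode := (mode alpha j).
Local Notation chat := (chat alpha j).

Lemma dot_shift u q l x : quasiperiodic alpha u -> forall a b,
  u (x + Defs.shift l) a 0 * mode q (x + Defs.shift l) b 0 = u x a 0 * mode q x b 0.
Proof.
move=> qu a b; rewrite qu mode_shift mxE [X in _ * X]mxE mulrACA mulfV ?mul1r//.
exact: phase_neq0.
Qed.

(** Integration by parts over one period cell without lateral boundary terms. The product of u with
    the mode is periodic, since the phases cancel, so the terms with the gradient of the cutoff
    integrate to zero for every n before the limit is taken. *)
Lemma weak_curl_cell u c q r : quasiperiodic alpha u -> Lp_loc 2 u -> Lp_loc 2 c ->
  weak_curl u c -> vsmooth q -> vsupp r q ->
  integral3 Omega (fun x => dot (c x) (mode q x)) =
  integral3 Omega (fun x => dot (u x) (curl (mode q) x)).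
Proof.
move=> qu lu lc wc sq q0.
have sG := fun m => smooth_mode alpha j m sq.
have dG m x := smooth_cdifferentiable x (sG m).
have sQ := vsmooth_chat alpha j sq.
have dQ m x := smooth_cdifferentiable x (smooth_mode alpha j m sQ).
have lcG := locally_cintegrable_dot lc dG.
have luQ := locally_cintegrable_dot lu dQ.
have cG0 x : r < `|x.2| -> dot (c x) (mode q x) = 0.
  by move=> rx; rewrite (mode_supp _ _ q0 rx) dotE !mxE !mulr0 !addr0.
have uQ0 x : r < `|x.2| -> dot (u x) (mode (chat q) x) = 0.
  by move=> rx; rewrite (mode_supp _ _ (vsupp_chat alpha j q0) rx) dotE !mxE !mulr0 !addr0.
have [_ cvc] := cutoff_limit lcG cG0.
have [iu cvu] := cutoff_limit luQ uQ0.
rewrite (curl_mode alpha j sq); apply: converges_unique cvc _.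
(* It remains to match the two sequences of cut-off integrals term by term. *)
congr (converges _ _): cvu; apply/funext => n.
have lP a b d e : locally_cintegrable (fun x => u x a 0 * mode q x b 0 - u x d 0 * mode q x e 0).
  have L a' b' : locally_cintegrable (fun x => mode q x b' 0 * u x a' 0).
    exact: (locally_cintegrable_smoothM (L2loc_locally a' lu) (dG b')).
  have -> : (fun x => u x a 0 * mode q x b 0 - u x d 0 * mode q x e 0) =
    (fun x => mode q x b 0 * u x a 0 + (- mode q x e 0) * u x d 0).
    by apply/funext => x; rewrite mulNr ![mode q x _ _ * _]mulrC.
  apply: locally_cintegrableD (L a b) _.
  have -> : (fun x => - mode q x e 0 * u x d 0) = (fun x => (-1) * (mode q x e 0 * u x d 0)).
    by apply/funext => x; rewrite mulN1r mulNr.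
  by move=> t; exact: (cintegrableZ (-1) (@measurable_cube R t) (L d e t)).
have P0 a b d e x : r < `|x.2| -> u x a 0 * mode q x b 0 - u x d 0 * mode q x e 0 = 0.
  by move=> rx; rewrite (mode_supp _ _ q0 rx) !mxE !mulr0 subr0.
have Pp a b d e l x : u (x + Defs.shift l) a 0 * mode q (x + Defs.shift l) b 0 -
    u (x + Defs.shift l) d 0 * mode q (x + Defs.shift l) e 0 =
    u x a 0 * mode q x b 0 - u x d 0 * mode q x e 0.
  by rewrite !(dot_shift q l x qu).
have Z1 := eta1_periodic n (lP ix3 ix2 ix2 ix3) (P0 ix3 ix2 ix2 ix3) (Pp ix3 ix2 ix2 ix3).
have Z2 := eta2_periodic n (lP ix1 ix3 ix3 ix1) (P0 ix1 ix3 ix3 ix1) (Pp ix1 ix3 ix3 ix1).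
have [Zi Z0] := zero_integralD Z1 Z2.
have := wc (cutoff alpha j n q) (test_field_cutoff alpha j n sq q0).
have -> : integral3 setT (fun x => dot (c x) (cutoff alpha j n q x)) =
  cint mu3 setT (fun x : mpt => eta n x * dot (c x) (mode q x)).
  apply: eq_cint => x _; rewrite /cutoff !dotE !mxE; ring.
move=> <-; rewrite -[LHS]addr0 -[X in _ + X]Z0 -(cintD measurableT (iu n) Zi).
apply: eq_cint => x _; rewrite (dot_curl_cutoff alpha j n x (u x) sq).
by rewrite (curl_mode alpha j sq).
Qed.

(** The conjugated mode is an admissible test field, and [weak_curl_cell] moves the curl left on u
    over to the mode. Only u itself then has to be known on the slices, which is what the Rayleigh
    coefficients provide. *)
Lemma maxwell_mode (k : R) (eps : pt -> 'M[R[i]]_3) E u c q r :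
  maxwell k alpha eps E u c -> vsmooth q -> vsupp r q ->
  integral3 Omega (fun x => dot (u x) (mode (chat (chat q)) x)
    - (k ^+ 2)%:C * dot (u x) (mode q x)) =
  (k ^+ 2)%:C * integral3 (D eps) (fun x =>
    dot ((eps x - 1%:M) *m (u x + E x)) (mode q x)).
Proof.
move=> [[qu lu lc wc] mx] sq q0.
have sQ := vsmooth_chat alpha j sq; have sQQ := vsmooth_chat alpha j sQ.
have Q0 := vsupp_chat alpha j q0; have QQ0 := vsupp_chat alpha j Q0.
have sm q' : vsmooth q' -> forall m x, cdifferentiable x (fun y => mode q' y m 0).
  by move=> sq' m x; apply: smooth_cdifferentiable; exact: smooth_mode.
have sv m : smooth (fun x => conjv (mode q x) m 0).
  have -> : (fun x => conjv (mode q x) m 0) = (fun x => Num.conj (mode q x m 0)).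
    by apply/funext => x; rewrite mxE.
  by apply: smooth_conj; exact: smooth_mode.
have sc m : smooth (fun x => conjv (mode (chat q) x) m 0).
  have -> : (fun x => conjv (mode (chat q) x) m 0) = (fun x => Num.conj (mode (chat q) x m 0)).
    by apply/funext => x; rewrite mxE.
  by apply: smooth_conj; exact: smooth_mode.
have cvE : curl (fun x => conjv (mode q x)) = (fun x => conjv (mode (chat q) x)).
  by rewrite (curl_conjv (sm _ sq)) (curl_mode alpha j sq).
have tv : test_Hcurl alpha (fun x => conjv (mode q x)) (fun x => conjv (mode (chat q) x)).
  split; last first.
    exists (r + 1) => x rx; rewrite (mode_supp _ _ q0).
      by apply/colP => m; rewrite !mxE conjC0.
    by apply: lt_le_trans rx; rewrite ltrDl.
  split.
  - move=> l x; rewrite mode_shift; apply/colP => m; rewrite !mxE rmorphM; congr (_ * _).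
    change (Num.conj (phase alpha l)^-1 = phase alpha l).
    rewrite phaseV expi_conj; congr expi.
    by apply: complex_ext; rewrite ?cReN ?cImN ?cRe_conj ?cIm_conj ?cReN ?cImN /= ?opprK ?oppr0.
  - by apply: Lp_loc_cdifferentiable => m x; exact: smooth_cdifferentiable (sv m).
  - by apply: Lp_loc_cdifferentiable => m x; exact: smooth_cdifferentiable (sc m).
  - by rewrite -cvE; exact: weak_curl_smooth.
(* The second curl passes to the mode; this is applied to the profile [chat q], which has the same
   support bound as [q]. *)
have L1 : integral3 Omega (fun x => dot (c x) (mode (chat q) x)) =
  integral3 Omega (fun x => dot (u x) (mode (chat (chat q)) x)).
  by rewrite (weak_curl_cell qu lu lc wc sQ Q0) (curl_mode alpha j sQ).
have oint w q' : Lp_loc 2 w -> vsmooth q' -> vsupp r q' ->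
    cintegrable mu3 (Omega : set mpt) (fun x => dot (w x) (mode q' x)).
  move=> lw sq' q'0; have ll := locally_cintegrable_dot lw (sm q' sq').
  have [mf _] := ll 0.
  suff fi : cintegrable mu3 (Omega : set mpt) (fun x => (\1_(cube (Num.max r pi)) x)%:C * dot (w x) (mode q' x)).
    have oE x : Omega x -> (\1_(cube (Num.max r pi)) x)%:C * dot (w x) (mode q' x) = dot (w x) (mode q' x).
      move=> Ox; have [x3|x3] := leP `|x.2| r; last first.
        by rewrite (mode_supp _ _ q'0 x3) dotE !mxE !mulr0 !addr0 mulr0.
      have cx : cube (Num.max r pi) x.
        by apply: (Omega_cube _ Ox); rewrite le_max ?x3 ?lexx ?orbT.
      by rewrite indicE (mem_set cx) mul1r.
    have fi2 : mu3.-integrable (Omega : set mpt) (EFin \o (fun x : mpt =>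
      cabs ((\1_(cube (Num.max r pi)) x)%:C * dot (w x) (mode q' x)))) by case: fi.
    refine (cintegrable_le (@measurable_Omega R) mf fi2 _).
    move=> x Ox. rewrite (oE x Ox). exact: lexx.
  apply: (cintegrableS measurableT (@measurable_Omega R) (@subsetT _ _)).
  by have /(cintegrable_indic _ _ (@measurable_cube R _))[] := ll (Num.max r pi).
have mO := @measurable_Omega R.
have iu1 := oint _ _ lu sQQ QQ0; have iu2 := oint _ _ lu sq q0; have ic := oint _ _ lc sQ Q0.
have split_int f g : cintegrable mu3 (Omega : set mpt) f -> cintegrable mu3 (Omega : set mpt) g ->
    integral3 Omega (fun x => f x - (k ^+ 2)%:C * g x) = integral3 Omega f - (k ^+ 2)%:C * integral3 Omega g.
  move=> fi gi; have zi := cintegrableZ (- (k ^+ 2)%:C) mO gi.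
  have := cintD mO fi zi; rewrite (cintZ _ mO gi) mulNr => <-.
  by apply: eq_cint => x _; rewrite mulNr.
rewrite (split_int _ _ iu1 iu2) -L1 -(split_int _ _ ic iu2).
have := mx _ _ tv; congr (_ = _).
  by apply: eq_cint => x _; rewrite !conjvK.
by congr (_ * _); apply: eq_cint => x _; rewrite conjvK.
Qed.

End MaxwellModes.

(** * Fubini in horizontal slices *)

Section Slices.
Context {R : realType}.
Local Notation pt := (space3 R).
Local Notation mR := (measurableTypeR R).
Local Notation mpt := (mR * mR * mR)%type.
Implicit Types (f : pt -> R[i]).

Lemma cintegrable_parts d (T : measurableType d) (mu : {measure set T -> \bar R}) (f : T -> R[i]) :
  mu.-integrable setT (EFin \o (fun x => Re (f x))) ->
  mu.-integrable setT (EFin \o (fun x => Im (f x))) -> cintegrable mu setT f.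
Proof.
move=> ri ii; have mf : cmeas f.
  by split; apply/measurable_EFinP; [exact: measurable_int ri|exact: measurable_int ii].
have si := integrableD measurableT (integrable_abse ri) (integrable_abse ii).
apply: (cintegrable_le (g := fun x => `|Re (f x)| + `|Im (f x)|) measurableT mf) => [|x _].
  by apply: eq_integrable si => // x _ /=.
exact: cabs_le.
Qed.

Lemma ae_cintegrable_slice f : cintegrable mu3 setT (f : mpt -> R[i]) ->
  {ae (@lebesgue_measure R), forall t, cintegrable mu2 setT (fun q : mR * mR => f (q, t))}.
Proof.
move=> fi; have ri := ae_integrable2 (cintegrable_Re measurableT fi).
have ii := ae_integrable2 (cintegrable_Im measurableT fi).
apply: filterS2 ri ii => t rt it; exact: cintegrable_parts.
Qed.

Let Rintegral_slices (f : mpt -> R) (F : mR -> R) :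
  mu3.-integrable setT (EFin \o f) -> measurable_fun setT F ->
  {ae (@lebesgue_measure R), forall t, mu2.-integrable setT (fun q : mR * mR => (f (q, t))%:E) /\
     (\int[mu2]_q f (q, t))%R = F t} ->
  (\int[mu3]_x f x)%R = (\int[lebesgue_measure]_t F t)%R.
Proof.
move=> fi mF ae; congr fine.
rewrite -[LHS](integral21_prod_meas1 fi).
apply: ae_eq_integral => //.
- exact: measurable_fubini_G fi.
- exact/measurable_EFinP.
- apply: filterS ae => t [si <-] _; rewrite /fubini_G /Rintegral fineK//.
  exact: integrable_fin_num.
Qed.

(** [F] is a closed formula for the slice integrals. It need only match them for almost every t,
    because a slice of an integrable function may fail to be integrable on a null set of heights. *)
Lemma cint_slices f (F : R -> R[i]) : cintegrable mu3 setT (f : mpt -> R[i]) ->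
  cmeas (F : mR -> R[i]) ->
  {ae (@lebesgue_measure R), forall t, cintegrable mu2 setT (fun q : mR * mR => f (q, t)) /\
     cint mu2 setT (fun q : mR * mR => f (q, t)) = F t} ->
  cint mu3 setT (f : mpt -> R[i]) = cint lebesgue_measure setT (F : mR -> R[i]).
Proof.
move=> fi [mr mi] ae.
have aeF := ae_filter_ringOfSetsType (@lebesgue_measure R).
apply: complex_ext; apply: Rintegral_slices.
- exact: cintegrable_Re.
- exact: mr.
- by apply: (@filterS _ _ aeF _ _ _ ae) => t [si <-]; split; [exact: cintegrable_Re si|].
- exact: cintegrable_Im.
- exact: mi.
- by apply: (@filterS _ _ aeF _ _ _ ae) => t [si <-]; split; [exact: cintegrable_Im si|].
Qed.

Lemma cint_cder (P : R -> R[i]) (a b : R) : a < b -> csmooth P ->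
  cint lebesgue_measure (`[a, b] : set mR) (cder P : mR -> R[i]) = P b - P a.
Proof.
move=> ab [rP jP].
have H (p : R -> R) : rsmooth p -> (\int[lebesgue_measure]_(x in `[a, b]) derive1 p x)%R = p b - p a.
  move=> sp; have cp := rsmooth_continuous sp.
  rewrite /Rintegral (@continuous_FTC2 _ (derive1 p) p)//.
  - exact: continuous_subspaceT (rsmooth_continuous (rsmooth_derive1 sp)).
  - split.
    + by move=> x _; exact: (sp 0%N).
    + exact: cvg_at_right_filter (cp a).
    + exact: cvg_at_left_filter (cp b).
by apply: complex_ext; rewrite ?cReD ?cImD ?cReN ?cImN /= H.
Qed.

End Slices.

(** * Pairing the scattered field with a mode *)

Section ModePairing.
Context {R : realType}.
Local Notation pt := (space3 R).
Local Notation mR := (measurableTypeR R).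
Local Notation mpt := (mR * mR * mR)%type.
Variables (k : R) (alpha : R * R) (h : R) (j : lattice).
Implicit Types (x : pt) (g : R -> 'cV[R[i]]_3).
Local Notation beta := (beta k alpha j).

Lemma cdifferentiable_waves x : cdifferentiable x (waves alpha j).
Proof.
have -> : waves alpha j = tensor (wave (alpha1 alpha j)) (wave (alpha2 alpha j)) (fun=> 1).
  by apply/funext => y; rewrite /tensor mulr1.
by apply: cdifferentiable_tensor; [exact: csmooth_wave|exact: csmooth_wave|exact: csmooth_cst].
Qed.

Lemma wavesE (q : R * R) (t : R) : waves alpha j (q, t) =
  expi (- (alpha1 alpha j * q.1 + alpha2 alpha j * q.2)%:C).
Proof.
rewrite /waves /wave /= -expiD; congr expi.
by rewrite -!rmorphM -rmorphD -rmorphN; congr (_%:C); ring.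
Qed.

(** The integral defining the coefficient carries the factor exp(-i beta (t - h)), constant on the
    slice. Taking it out uses linearity, hence the integrability of the slice. *)
Lemma rayleigh_slice u up um m t : h <= t ->
  rayleigh_coefficients k alpha h u up um ->
  cintegrable mu2 (cell2 : set (mR * mR)) (fun q => waves alpha j (q, t) * u (q, t) m 0) ->
  cint mu2 (cell2 : set (mR * mR)) (fun q => waves alpha j (q, t) * u (q, t) m 0) =
  (4 * pi ^+ 2)%:C * up j m 0 * expi (beta * (t - h)%:C).
Proof.
move=> ht rc si; have [-> _] := rc t j m ht.
have mc := @measurable_cell2 R.
have -> : integral2 cell2 (fun q => u (q, t) m 0 * expi (- ((alpha1 alpha j * q.1 + alpha2 alpha j * q.2)%:C + beta * (t - h)%:C)))
  = expi (- (beta * (t - h)%:C)) * cint mu2 (cell2 : set (mR * mR)) (fun q => waves alpha j (q, t) * u (q, t) m 0).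
  rewrite -(cintZ _ mc si); apply: eq_cint => q _.
  rewrite opprD expiD wavesE; ring.
have p0 : (4 * pi ^+ 2)%:C != 0 :> R[i].
  by rewrite (inj_eq (@complexI R)) mulf_neq0// expf_neq0// gt_eqF// pi_gt0.
by rewrite [X in _ = X * _]mulrA mulfV// mul1r mulrAC [expi _ * expi _]mulrC expiK mul1r.
Qed.

Lemma rayleigh_slice_minus u up um m t : t <= - h ->
  rayleigh_coefficients k alpha h u up um ->
  cintegrable mu2 (cell2 : set (mR * mR)) (fun q => waves alpha j (q, t) * u (q, t) m 0) ->
  cint mu2 (cell2 : set (mR * mR)) (fun q => waves alpha j (q, t) * u (q, t) m 0) =
  (4 * pi ^+ 2)%:C * um j m 0 * expi (- beta * (t + h)%:C).
Proof.
move=> ht rc si; have ht' : h <= - t by lra.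
have [_] := rc (- t) j m ht'; rewrite opprK => ->.
have mc := @measurable_cell2 R.
have -> : integral2 cell2 (fun q => u (q, t) m 0 * expi (- ((alpha1 alpha j * q.1 + alpha2 alpha j * q.2)%:C - beta * (t + h)%:C)))
  = expi (beta * (t + h)%:C) * cint mu2 (cell2 : set (mR * mR)) (fun q => waves alpha j (q, t) * u (q, t) m 0).
  rewrite -(cintZ _ mc si); apply: eq_cint => q _.
  rewrite opprD opprK expiD wavesE; ring.
have p0 : (4 * pi ^+ 2)%:C != 0 :> R[i].
  by rewrite (inj_eq (@complexI R)) mulf_neq0// expf_neq0// gt_eqF// pi_gt0.
by rewrite [X in _ = X * _]mulrA mulfV// mul1r mulNr mulrAC expiK mul1r.
Qed.

(** The profile vanishes for |t| < h, so every slice that counts has a known integral. On each side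
    the resulting integrand in t has an antiderivative that vanishes far out, and only its value at
    the edge of the slab remains. *)
Lemma mode_pairing u up um g r (P Q : R -> R[i]) : 0 < h -> h < r ->
  Lp_loc 2 u -> rayleigh_coefficients k alpha h u up um ->
  vsmooth g -> vsupp r g -> (forall t, `|t| < h -> g t = 0) ->
  csmooth P -> csmooth Q -> (forall t, r < t -> P t = 0) -> (forall t, t < - r -> Q t = 0) ->
  (forall t, h <= t -> dot (up j) (g t) * expi (beta * (t - h)%:C) = cder P t) ->
  (forall t, t <= - h -> dot (um j) (g t) * expi (- beta * (t + h)%:C) = cder Q t) ->
  integral3 Omega (fun x => dot (u x) (mode alpha j g x)) =
  (4 * pi ^+ 2)%:C * (Q (- h) - P h).
Proof.
move=> h0 hr lu rc sg g0 gh sP sQ P0 Q0 dP dQ.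
(* Beyond r, so that [P] and [Q] vanish at the outer end points, and at least pi, so that the cube
   contains the part of the cell that matters. *)
pose r' := r + pi; have p2 : 2 <= pi :> R by exact: pi_ge2.
have rr' : r < r' by rewrite /r'; lra.
have pr' : pi <= r' by rewrite /r'; lra.
pose A : set mpt := Omega `&` cube r'.
have mA : measurable A by apply: measurableI; [exact: measurable_Omega|exact: measurable_cube].
pose sl m x : R[i] := (\1_A x)%:C * (waves alpha j x * u x m 0).
have wl m : locally_cintegrable (fun x => waves alpha j x * u x m 0).
  exact: locally_cintegrable_smoothM (L2loc_locally m lu) cdifferentiable_waves.
have sli m : cintegrable mu3 setT (sl m : mpt -> R[i]).
  have := cintegrableS (@measurable_cube R r') mA (@subIsetr _ _ _) (wl m r').
  by move/(cintegrable_indic _ _ mA) => [].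
have gi m : csmooth (fun t => g t m 0) by exact: sg.
pose f x := g x.2 ix1 0 * sl ix1 x + g x.2 ix2 0 * sl ix2 x + g x.2 ix3 0 * sl ix3 x.
have fE x : (\1_(Omega : set mpt) x)%:C * dot (u x) (mode alpha j g x) = f x.
  have mE m : mode alpha j g x m 0 = waves alpha j x * g x.2 m 0 by rewrite /mode mxE.
  rewrite /f /sl dotE !mE !indicE in_setI.
  case: (boolP (x \in Omega)) => [/set_mem Ox|_] /=; last by rewrite !mul0r !mulr0 !addr0.
  case: (boolP (x \in cube r')) => [_|/negP nx] /=; first by rewrite !mul1r; ring.
  have x3 : r < `|x.2|.
    rewrite ltNge; apply/negP => x3; apply: nx; apply/mem_set; apply: (Omega_cube pr' Ox).
    by apply: le_trans x3 _; exact: ltW.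
  by rewrite (g0 _ x3) !mxE !mulr0 !mul0r !addr0 mulr0.
have gm m : cintegrable mu3 setT (fun x : mpt => g x.2 m 0 * sl m x).
  have cg : forall x, cdifferentiable x (fun x : pt => g x.2 m 0).
    move=> x; have -> : (fun x : pt => g x.2 m 0) = tensor (fun=> 1) (fun=> 1) (fun t => g t m 0).
      by apply/funext => y; rewrite /tensor !mul1r.
    by apply: cdifferentiable_tensor; [exact: csmooth_cst|exact: csmooth_cst|exact: sg].
  have [M HM] := bounded_cdifferentiable cg r'.
  have := cintegrableS (@measurable_cube R r') mA (@subIsetr _ _ _)
    (locally_cintegrable_smoothM (wl m) cg r').
  move/(cintegrable_indic _ _ mA) => [+ _]; congr (cintegrable _ _ _).
  by apply/funext => x; rewrite /sl; ring.
have fi : cintegrable mu3 setT (f : mpt -> R[i]).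
  exact: (cintegrableD measurableT (cintegrableD measurableT (gm ix1) (gm ix2)) (gm ix3)).
pose IP : set mR := `[h, r']%classic; pose IQ : set mR := `[- r', - h]%classic.
have mIP : measurable IP by exact: measurable_itv.
have mIQ : measurable IQ by exact: measurable_itv.
pose FP (t : mR) : R[i] := (\1_IP t)%:C * cder P t.
pose FQ (t : mR) : R[i] := (\1_IQ t)%:C * cder Q t.
pose F (t : mR) : R[i] := (4 * pi ^+ 2)%:C * (FP t + FQ t).
have cmc (p : R -> R[i]) : csmooth p -> cmeas (cder p : mR -> R[i]).
  move=> /csmooth_cder[rp jp]; split; apply: continuous_measurable_fun;
  [exact: rsmooth_continuous rp|exact: rsmooth_continuous jp].
have mFP : cmeas FP by apply: cmeasM; [exact: cmeas_indic|exact: cmc].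
have mFQ : cmeas FQ by apply: cmeasM; [exact: cmeas_indic|exact: cmc].
have mF : cmeas F by apply: cmeasM; [exact: cmeas_cst|exact: cmeasD].
have aeF := ae_filter_ringOfSetsType (@lebesgue_measure R).
transitivity (cint lebesgue_measure setT F).
  transitivity (cint mu3 setT (f : mpt -> R[i])).
    transitivity (cint mu3 (Omega : set mpt) (fun x => dot (u x) (mode alpha j g x))); first by [].
    by rewrite cint_indic; apply: eq_cint => x _; exact: fE.
  apply: cint_slices fi mF _.
  (* Almost every height is good for all three components at once. *)
  apply: (@filterS3 _ _ aeF _ _ _ _ _ (ae_cintegrable_slice (sli ix1))
    (ae_cintegrable_slice (sli ix2)) (ae_cintegrable_slice (sli ix3))) => t s1 s2 s3.
  have si m : cintegrable mu2 setT (fun q : mR * mR => sl m (q, t)).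
    by case: (ix_cases m) => ->.
  have zi m := cintegrableZ (g t m 0) measurableT (si m).
  split; first exact: (cintegrableD measurableT (cintegrableD measurableT (zi ix1) (zi ix2)) (zi ix3)).
  rewrite /f /= (cintD measurableT (cintegrableD measurableT (zi ix1) (zi ix2)) (zi ix3)).
  rewrite (cintD measurableT (zi ix1) (zi ix2)) !(cintZ _ measurableT (si _)).
  have [tr|tr] := ltP r' `|t|.
    rewrite g0; last by apply: lt_trans tr.
    rewrite !mxE !mul0r !addr0 /F /FP /FQ !indicE /IP /IQ.
    rewrite !memNset ?mul0r ?addr0 ?mulr0//= in_itv/= => /andP[t1 t2]; move: tr; apply/negP; rewrite -leNgt ler_norml; apply/andP; split; lra.
  have [th|th] := ltP `|t| h.
    rewrite gh// !mxE !mul0r !addr0 /F /FP /FQ !indicE /IP /IQ.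
    rewrite !memNset ?mul0r ?addr0 ?mulr0//= in_itv/= => /andP[t1 t2]; move: th; apply/negP; rewrite -leNgt.
      by rewrite ler0_norm; lra.
    by rewrite ger0_norm; lra.
  have cE m : cint mu2 setT (fun q : mR * mR => sl m (q, t)) =
    cint mu2 (cell2 : set (mR * mR)) (fun q => waves alpha j (q, t) * u (q, t) m 0) /\
    cintegrable mu2 (cell2 : set (mR * mR)) (fun q => waves alpha j (q, t) * u (q, t) m 0).
    have E : (fun q : mR * mR => sl m (q, t)) =
      (fun q : mR * mR => (\1_(cell2 : set (mR * mR)) q)%:C * (waves alpha j (q, t) * u (q, t) m 0)).
      apply/funext => q; rewrite /sl !indicE in_setI.
      have -> : ((q, t) \in (Omega : set mpt)) = (q \in (cell2 : set (mR * mR))).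
        by apply/idP/idP => /set_mem Oq; apply/mem_set.
      case: (boolP (q \in (cell2 : set (mR * mR)))) => [/set_mem cq|_] //=.
      have cqt : cube r' (q, t) by exact: (Omega_cube pr').
      by rewrite (mem_set cqt).
    have := si m; rewrite E => sE; split; first by rewrite [RHS]cint_indic.
    have [[rw jw] _] := wl m 0.
    apply/(cintegrable_indic _ _ (@measurable_cell2 R)); split; first exact: sE.
    by split; [exact: (measurableT_comp rw (pair2_measurable t))|
      exact: (measurableT_comp jw (pair2_measurable t))].
  have [[c1 i1] [c2 i2] [c3 i3]] := And3 (cE ix1) (cE ix2) (cE ix3).
  rewrite c1 c2 c3 /F /FP /FQ !indicE /IP /IQ.
  have [t0|t0] := ltP 0 t.
    rewrite gtr0_norm// in th tr; rewrite (rayleigh_slice th rc i1) (rayleigh_slice th rc i2) (rayleigh_slice th rc i3).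
    have m1 : t \in `[h, r']%classic by apply/mem_set; rewrite /= in_itv/= th tr.
    have m2 : (t \in `[- r', - h]%classic) = false.
      apply/negbTE/negP => /set_mem; rewrite /= in_itv/= => /andP[_ t2].
      by move: t0; rewrite ltNge; apply/negP; rewrite negbK; apply: le_trans t2 _; rewrite oppr_le0 ltW.
    by rewrite m1 m2 mul1r mul0r addr0 -(dP t th) dotE; ring.
  rewrite ler0_norm// in th tr.
  have th' : t <= - h by rewrite lerNr.
  rewrite (rayleigh_slice_minus th' rc i1) (rayleigh_slice_minus th' rc i2) (rayleigh_slice_minus th' rc i3).
  have m1 : (t \in `[h, r']%classic) = false.
    apply/negbTE/negP => /set_mem; rewrite /= in_itv/= => /andP[t2 _].
    by move: h0; rewrite ltNge; apply/negP; rewrite negbK; exact: le_trans t2 t0.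
  have m2 : t \in `[- r', - h]%classic by apply/mem_set; rewrite /= in_itv/= th' lerNl tr.
  by rewrite m1 m2 mul1r mul0r add0r -(dQ t th') dotE; ring.
have ic (I : set mR) (a b : R) (p : R -> R[i]) : I = `[a, b]%classic -> csmooth p ->
    cintegrable lebesgue_measure (I : set mR) (cder p : mR -> R[i]).
  move=> -> sp; have [rp jp] := csmooth_cder sp.
  have mI : measurable (`[a, b]%classic : set mR) by exact: measurable_itv.
  have ci (f' : R -> R) : rsmooth f' -> lebesgue_measure.-integrable (`[a, b]%classic : set mR) (EFin \o f').
    move=> sf; apply: continuous_compact_integrable; first exact: segment_compact.
    exact: continuous_subspaceT (rsmooth_continuous sf).
  have si := integrableD mI (integrable_abse (ci _ rp)) (integrable_abse (ci _ jp)).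
  have si' : lebesgue_measure.-integrable (`[a, b]%classic : set mR)
    (EFin \o (fun x : mR => `|Re (cder p x)| + `|Im (cder p x)|)) by exact: si.
  refine (cintegrable_le mI (cmc p sp) si' _) => x _; exact: cabs_le.
have [iP _] := (cintegrable_indic lebesgue_measure _ mIP).1 (ic _ _ _ P erefl sP).
have [iQ _] := (cintegrable_indic lebesgue_measure _ mIQ).1 (ic _ _ _ Q erefl sQ).
rewrite /F (cintZ _ measurableT (cintegrableD measurableT iP iQ)) (cintD measurableT iP iQ).
rewrite -!cint_indic (cint_cder _ sP) ?(cint_cder _ sQ).
- by rewrite (P0 _ rr') (Q0 (- r')) ?ltrN2// sub0r subr0 addrC.
- by rewrite ltrN2; lra.
- by lra.
Qed.

End ModePairing.

(** * The curl on profiles with fixed directions *)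

Section Profiles.
Context {R : realType}.
Local Notation pt := (space3 R).
Variables (alpha : R * R) (j : lattice).
Implicit Types (f g : R -> R[i]) (v w : 'cV[R[i]]_3).
Local Notation a1 := ('i * (- alpha1 alpha j)%:C).
Local Notation a2 := ('i * (- alpha2 alpha j)%:C).

(** With a = (-i alpha_1, -i alpha_2, 0), [curl_tan] is the cross product a x v, and [curl_nor] is
    e3 x v: the curl of f v is f times the former plus f' times the latter. *)
Definition curl_tan v : 'cV[R[i]]_3 :=
  vec3 (a2 * v ix3 0) (- (a1 * v ix3 0)) (a1 * v ix2 0 - a2 * v ix1 0).
Definition curl_nor v : 'cV[R[i]]_3 := vec3 (- v ix2 0) (v ix1 0) 0.

(** Two terms suffice: they cover a gradient field, and also the curl of a one-term profile. *)
Definition profile f v g w : R -> 'cV[R[i]]_3 := fun t => f t *: v + g t *: w.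

Let profileE f v g w t m : profile f v g w t m 0 = f t * v m 0 + g t * w m 0.
Proof. by rewrite /profile !mxE. Qed.

Lemma vsmooth_profile f v g w : csmooth f -> csmooth g -> vsmooth (profile f v g w).
Proof.
move=> sf sg m; under eq_fun do rewrite profileE.
by apply: csmoothD; (apply: csmoothM; last exact: csmooth_cst); [exact: sf|exact: sg].
Qed.

Lemma chat_profile f v g w : csmooth f -> csmooth g ->
  chat alpha j (profile f v g w) = fun t =>
    f t *: curl_tan v + cder f t *: curl_nor v + (g t *: curl_tan w + cder g t *: curl_nor w).
Proof.
move=> sf sg; apply/funext => t.
have dE m : cder (fun s => profile f v g w s m 0) t = cder f t * v m 0 + cder g t * w m 0.
  apply: is_cderive_cder; under eq_fun do rewrite profileE.
  apply: is_cderiveD.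
    have := is_cderiveM (csmooth_is_cderive t sf) (is_cderive_cst t (v m 0)).
    by rewrite mulr0 addr0.
  have := is_cderiveM (csmooth_is_cderive t sg) (is_cderive_cst t (w m 0)).
  by rewrite mulr0 addr0.
rewrite /chat !dE !profileE.
move: (cder f t) (cder g t) (f t) (g t) => f1 g1 f0 g0.
rewrite /curl_tan /curl_nor.
by apply: col3_ext; rewrite !mxE /=; ring.
Qed.

End Profiles.

(** * Transversality of the Rayleigh coefficients *)

Section RayleighIdentity.
Context {R : realType}.
Local Notation pt := (space3 R).
Variables (k : R) (alpha : R * R) (h : R) (eps : pt -> 'M[R[i]]_3) (j : lattice).
Variables (E u c : field3 R) (up um : lattice -> 'cV[R[i]]_3).
Hypotheses (k_gt0 : 0 < k) (h_gt0 : 0 < h) (h_supp : (supp_height eps < h%:E)%E).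
Hypotheses (umax : maxwell k alpha eps E u c)
  (ucoef : rayleigh_coefficients k alpha h u up um).
Implicit Types (b : bool) (q : R -> 'cV[R[i]]_3).
Local Notation beta := (beta k alpha j).
Local Notation chat := (chat alpha j).
Local Notation mode := (mode alpha j).
Local Notation a1 := ('i * (- alpha1 alpha j)%:C).
Local Notation a2 := ('i * (- alpha2 alpha j)%:C).
Local Notation gam b := (gam k alpha b j).

Definition residual q : R -> 'cV[R[i]]_3 := fun t => chat (chat q) t - (k ^+ 2)%:C *: q t.

Definition rayleigh_coef b : 'cV[R[i]]_3 := if b then up j else um j.

Lemma D_height x : D eps x -> `|x.2| < h.
Proof.
move=> [sx _]; rewrite -lte_fin; apply: le_lt_trans h_supp.
by apply: ereal_sup_ubound; exists x.
Qed.

(** Combines [maxwell_mode] and [mode_pairing]: a profile solving the homogeneous equation for |t| <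
    h turns the weak formulation into a relation between boundary values of antiderivatives and the
    source integral. *)
Lemma rayleigh_identity q r (P Q : R -> R[i]) : h < r -> vsmooth q -> vsupp r q ->
  (forall t, `|t| < h -> residual q t = 0) ->
  csmooth P -> csmooth Q -> (forall t, r < t -> P t = 0) -> (forall t, t < - r -> Q t = 0) ->
  (forall t, h <= t -> dot (up j) (residual q t) * expi (beta * (t - h)%:C) = cder P t) ->
  (forall t, t <= - h -> dot (um j) (residual q t) * expi (- beta * (t + h)%:C) = cder Q t) ->
  (4 * pi ^+ 2)%:C * (Q (- h) - P h) = (k ^+ 2)%:C * integral3 (D eps) (fun x =>
    dot ((eps x - 1%:M) *m (u x + E x)) (mode q x)).
Proof.
move=> hr sq q0 res0 sP sQ P0 Q0 dP dQ.
have [[_ lu _ _] _] := umax.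
rewrite -(maxwell_mode j umax sq q0).
have sres : vsmooth (residual q).
  move=> m; have -> : (fun t => residual q t m 0) =
    (fun t => chat (chat q) t m 0 + - ((k ^+ 2)%:C * q t m 0)).
    by apply/funext => t; rewrite /residual !mxE.
  apply: csmoothD; first exact: (vsmooth_chat alpha j (vsmooth_chat alpha j sq)).
  by apply: csmoothN; apply: csmoothZ; exact: sq.
have res_supp : vsupp r (residual q).
  move=> t rt; rewrite /residual (vsupp_chat alpha j (vsupp_chat alpha j q0) rt) (q0 _ rt).
  by rewrite scaler0 subr0.
rewrite -(mode_pairing h_gt0 hr lu ucoef sres res_supp res0 sP sQ P0 Q0 dP dQ).
apply: eq_cint => x _; rewrite !dotE /mode /residual !mxE; ring.
Qed.

(* The argument of the step is such that the profile vanishes near the slab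
   [|t| <= h] and is supported on the side of the sign [pm b]. *)
Let arg b (t : R) : R := @pm R b * t + (- h - 1).

Let is_derive_arg b (t : R) : is_derive t 1 (arg b) (@pm R b).
Proof.
have := is_deriveD (is_deriveZ (@pm R b) (is_derive_id t 1)) (is_derive_cst (- h - 1) t 1).
by move/is_derive_eq; apply; rewrite addr0 /GRing.scale/= mulr1.
Qed.

Let is_cderive_step_arg (p : R -> R) b (t : R) : rsmooth p ->
  is_cderive t (fun s => (p (arg b s))%:C) (derive1 p (arg b t) * @pm R b)%:C.
Proof.
move=> sp; apply: is_cderive_real.
exact: (@is_derive1_comp _ p (arg b) t _ _ (rsmooth_is_derive sp (arg b t)) (is_derive_arg b t)).
Qed.

Let csmooth_arg (p : R -> R) b : rsmooth p -> csmooth (fun t => (p (arg b t))%:C).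
Proof.
by move=> sp; apply: csmooth_real; apply: (@rsmooth_comp _ p (arg b)) => //; exact: rsmooth_affine.
Qed.

Let bump : R -> R := derive1 step.
Let sbump : rsmooth bump. Proof. exact: rsmooth_derive1 rsmooth_step. Qed.

Lemma derive1_step_out (t : R) : t < 0 \/ 1 < t -> derive1 step t = 0 :> R.
Proof.
rewrite derive1E => -[t0|t1].
  rewrite (@near_eq_derive _ _ _ _ (fun=> 0)) ?derive_cst//.
  by apply: filterS (lt_nbhsl t0) => s s0; rewrite step_le0// ltW.
rewrite (@near_eq_derive _ _ _ _ (fun=> 1 : R)) ?derive_cst//.
by apply: filterS (lt_nbhsr t1) => s s0; rewrite step_ge1// ltW.
Qed.

Lemma pm_sq b : @pm R b * @pm R b = 1.
Proof. by case: b; rewrite /pm ?mulr1 ?mulrNN ?mulr1. Qed.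

(** The test field is the gradient of a separated function supported in h + 1 <= pm b x3 <= h + 2.
    Its curl is zero and the source does not meet its support, so the integral of u against it
    vanishes; this is the weak form of div u = 0 outside the medium. *)
Lemma rayleigh_divergence_free b : dot (gam b) (rayleigh_coef b) = 0.
Proof.
set U := rayleigh_coef b; set s := @pm R b.
(* Chosen inverse to the Rayleigh exponential on the side [b], so that the integrand in t contains
   only the bump and its derivative. *)
pose psi (t : R) := expi ((- (beta * s%:C)) * t%:C + beta * h%:C).
pose f (t : R) := psi t * (bump (arg b t))%:C.
have spsi : csmooth psi by exact: csmooth_expi.
have sf : csmooth f by apply: csmoothM; [exact: spsi|exact: csmooth_arg].
have fE t : cder f t = psi t * ('i * - (beta * s%:C) * (bump (arg b t))%:C +
    (derive1 bump (arg b t) * s)%:C).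
  apply: is_cderive_cder.
  have := is_cderiveM (is_cderive_expi (- (beta * s%:C)) (beta * h%:C) t) (is_cderive_step_arg b t sbump).
  by congr (is_cderive _ _ _); rewrite /psi; ring.
(* The profile of a gradient: lateral derivatives in the direction [v], the derivative of [f] in the
   direction [w]. *)
pose v := vec3 a1 a2 0; pose w : 'cV[R[i]]_3 := vec3 0 0 1.
pose q := profile f v (cder f) w.
have sq : vsmooth q by apply: vsmooth_profile; [exact: sf|exact: csmooth_cder].
have cq0 : chat q = fun=> 0.
  rewrite /q (chat_profile _ _ _ _ sf (csmooth_cder sf)); apply/funext => t.
  move: (f t) (cder f t) (cder (cder f) t) => f0 f1 f2.
  by apply: col3_ext; rewrite !mxE /= /v /w ?mxE /= ?mxE /=; ring.
have ccq0 : chat (chat q) = fun=> 0.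
  rewrite cq0; apply/funext => t.
  (* With the bound -1 the support condition concerns every t, so [vsupp_chat] applies to the zero
     profile everywhere. *)
  have z0 : vsupp (-1) (fun _ : R => 0 : 'cV[R[i]]_3) by [].
  by apply: (vsupp_chat alpha j z0); rewrite (lt_le_trans _ (normr_ge0 t))// ltrN10.
have resE t : residual q t = - (k ^+ 2)%:C *: q t.
  by rewrite /residual ccq0 sub0r scaleNr.
have qz (t : R) : arg b t < 0 \/ 1 < arg b t -> q t = 0.
  move=> at0.
  have ft : f t = 0 by rewrite /f /bump (derive1_step_out at0) mulr0.
  have cft : cder f t = 0.
    rewrite fE /bump (derive1_step_out at0).
    have -> : derive1 (derive1 step) (arg b t) = 0 :> R; last by rewrite mul0r !mulr0 addr0 mulr0.
    rewrite derive1E (@near_eq_derive _ _ _ _ (fun=> 0)) ?derive_cst//.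
    case: at0 => [a0|a1'].
      by apply: filterS (lt_nbhsl a0) => z z0; apply: derive1_step_out; left.
    by apply: filterS (lt_nbhsr a1') => z z0; apply: derive1_step_out; right.
  by rewrite /q /profile ft cft !scale0r addr0.
have ssgn : s = 1 \/ s = -1 by rewrite /s /pm; case: (b); [left|right].
have q_small t : `|t| < h + 1 -> q t = 0.
  move=> th; apply: qz; left; rewrite /arg -/s.
  by move: th; rewrite ltr_norml => /andP[? ?]; case: ssgn => ->; lra.
have q_large : vsupp (h + 2) q.
  move=> t ht; apply: qz; rewrite /arg -/s.
  move: ht; rewrite lter_normr => /orP[ht|ht]; case: ssgn => ->; have h0 := h_gt0;
    [right|left|left|right]; lra.
(* This is -i times the wave vector paired with [U], the quantity to be shown zero. *)
pose kap := a1 * U ix1 0 + a2 * U ix2 0 + 'i * - (beta * s%:C) * U ix3 0.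
(* The bump integrates to 1. The constant -1 makes the antiderivative vanish beyond the bump, so
   that on the slab side it equals k^2 kap times the sign of the side. *)
pose P t := - (k ^+ 2)%:C * (kap * (s%:C * ((step (arg b t))%:C - 1)) +
    U ix3 0 * (bump (arg b t))%:C).
have sP : csmooth P.
  apply: csmoothZ; apply: csmoothD; apply: csmoothZ; last exact: csmooth_arg.
  apply: csmoothZ; apply: csmoothD; last exact: csmooth_cst.
  by apply: csmooth_arg; exact: rsmooth_step.
have PE t : cder P t = - (k ^+ 2)%:C * (kap * (bump (arg b t))%:C +
    U ix3 0 * (derive1 bump (arg b t) * s)%:C).
  apply: is_cderive_cder.
  have d1 := is_cderiveD (is_cderive_step_arg b t rsmooth_step) (is_cderive_cst t (-1)).
  have d2 := is_cderiveM (is_cderive_cst t s%:C) d1.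
  have d3 := is_cderiveM (is_cderive_cst t kap) d2.
  have d4 := is_cderiveM (is_cderive_cst t (U ix3 0)) (is_cderive_step_arg b t sbump).
  have := is_cderiveM (is_cderive_cst t (- (k ^+ 2)%:C)) (is_cderiveD d3 d4).
  congr (is_cderive _ _ _).
  rewrite !mul0r !add0r addr0 -/bump -/s; congr (_ * (kap * _ + _)).
  by rewrite -rmorphM mulrCA -{1}/s pm_sq mulr1.
have psi_inv t : psi t * expi (beta * (s * t - h)%:C) = 1.
  rewrite /psi -expiD -[RHS]expi0; congr expi.
  by rewrite rmorphB rmorphM; ring.
have pairE t : dot U (residual q t) * expi (beta * (s * t - h)%:C) = cder P t.
  rewrite PE resE dotE /q /profile fE /f !mxE /= /v /w ?mxE /=.
  move: (psi_inv t) => pe.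
  rewrite /kap; move: (bump _)%:C (_ * s)%:C => B B'.
  rewrite -[RHS]mulr1 -[X in _ = _ * X]pe. ring.
have P_out (t : R) : 1 < arg b t -> P t = 0.
  move=> at1; rewrite /P step_ge1; last exact: ltW.
  by rewrite /bump derive1_step_out ?subrr ?mulr0 ?addr0 ?mulr0//; right.
have P_in (t : R) : arg b t < 0 -> P t = (k ^+ 2)%:C * (kap * s%:C).
  move=> at0; rewrite /P step_le0; last exact: ltW.
  by rewrite /bump derive1_step_out ?mulr0 ?addr0; [ring|left].
have rhs0 : integral3 (D eps) (fun x => dot ((eps x - 1%:M) *m (u x + E x)) (mode q x)) = 0.
  have -> : integral3 (D eps) (fun x => dot ((eps x - 1%:M) *m (u x + E x)) (mode q x)) =
    cint mu3 (D eps) (fun=> 0); last exact: cint0.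
  apply: eq_cint => x Dx; have hx := D_height Dx.
  rewrite /mode (q_small x.2) ?scaler0 ?dotE ?mxE ?mulr0 ?addr0//.
  by apply: lt_trans hx _; rewrite ltrDl.
have hr : h < h + 2 by rewrite ltrDl.
have res0 t : `|t| < h -> residual q t = 0.
  by move=> th; rewrite resE q_small ?scaler0//; apply: lt_trans th _; rewrite ltrDl.
have s0 := csmooth_cst (0 : R[i]).
have c0 t : cder (fun=> 0 : R[i]) t = 0 by apply: is_cderive_cder; exact: is_cderive_cst.
have p0 : (4 * pi ^+ 2)%:C != 0 :> R[i].
  by rewrite (inj_eq (@complexI R)) mulf_neq0// expf_neq0// gt_eqF// pi_gt0.
have k0 : (k ^+ 2)%:C != 0 :> R[i].
  by rewrite (inj_eq (@complexI R)) expf_neq0// gt_eqF.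
have resz t : s * t < h + 1 -> residual q t = 0.
  move=> st; rewrite resE qz ?scaler0//; left; rewrite /arg -/s.
  by move: st; rewrite -subr_lt0 opprD addrA.
have dot0 (a : 'cV[R[i]]_3) z : dot a 0 * z = 0 by rewrite dotE !mxE !mulr0 !addr0 mul0r.
have argh (t : R) : s * t < h + 1 -> arg b t < 0.
  by move=> st; rewrite /arg -/s; move: st; rewrite -subr_lt0 opprD addrA.
have arg_gt (t : R) : h + 2 < s * t -> 1 < arg b t.
  by move=> st; rewrite /arg -/s -subr_gt0; have := st; rewrite -subr_gt0; congr (_ < _); ring.
have hh : h < h + 1 by rewrite ltrDl.
have h0 := h_gt0.
have kapP (z : R[i]) : (k ^+ 2)%:C * (kap * s%:C) = 0 -> kap = 0.
  have sn : s%:C != 0 :> R[i].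
    by rewrite (inj_eq (@complexI R)); case: ssgn => ->; rewrite ?oppr_eq0 oner_eq0.
  by move/eqP; rewrite !mulf_eq0 (negbTE k0) (negbTE sn) orbF => /eqP.
have kap0 : kap = 0.
  apply: (kapP 0).
  case: (boolP b) => bE.
    have sE : s = 1 by rewrite /s /pm bE.
    have UE : U = up j by rewrite /U /rayleigh_coef bE.
    have := @rayleigh_identity q (h + 2) P (fun=> 0) hr sq q_large res0 sP s0.
    rewrite rhs0 mulr0 sub0r (P_in h) ?sE ?mul1r; last by apply: argh; rewrite sE mul1r.
    move=> H; have {H} : (4 * pi ^+ 2)%:C * - ((k ^+ 2)%:C * (kap * 1)) = 0 :> R[i].
      apply: H => [t ht|//|t ht|t ht].
      - by apply: P_out; apply: arg_gt; rewrite sE mul1r.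
      - by rewrite -pairE UE sE mul1r.
      - by rewrite c0 resz ?dot0// sE mul1r; lra.
    by move/eqP; rewrite mulf_eq0 (negbTE p0) oppr_eq0 => /eqP.
  have sE : s = -1 by rewrite /s /pm (negbTE bE).
  have UE : U = um j by rewrite /U /rayleigh_coef (negbTE bE).
  have := @rayleigh_identity q (h + 2) (fun=> 0) P hr sq q_large res0 s0 sP.
  rewrite rhs0 mulr0 subr0 (P_in (- h)) ?sE; last by apply: argh; rewrite sE mulrNN mul1r.
  move=> H; have {H} : (4 * pi ^+ 2)%:C * ((k ^+ 2)%:C * (kap * (-1)%:C)) = 0 :> R[i].
    apply: H => [//|t ht|t ht|t ht].
    - by apply: P_out; apply: arg_gt; rewrite sE mulN1r ltrNr.
    - by rewrite c0 resz ?dot0// sE mulN1r; lra.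
    - rewrite -pairE UE sE; congr (_ * expi _).
      by rewrite mulN1r mulNr -mulrN -rmorphN opprD.
  by move/eqP; rewrite mulf_eq0 (negbTE p0) => /eqP.
rewrite dotE /Defs.gam !mxE /= -/s.
have -> : (alpha1 alpha j)%:C * U ix1 0 + (alpha2 alpha j)%:C * U ix2 0 + s%:C * beta * U ix3 0 = 'i * kap.
  rewrite /kap !rmorphN.
  have i2 : 'i * 'i = -1 :> R[i] by rewrite -expr2 sqr_i.
  transitivity (- ('i * 'i) * ((alpha1 alpha j)%:C * U ix1 0 + (alpha2 alpha j)%:C * U ix2 0 + s%:C * beta * U ix3 0)).
    by rewrite i2 opprK mul1r.
  ring.
by rewrite kap0 mulr0.
Qed.

End RayleighIdentity.

(** * The Rayleigh coefficients as source integrals *)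

Section RayleighFormula.
Context {R : realType}.
Local Notation pt := (space3 R).
Local Notation mR := (measurableTypeR R).
Local Notation mpt := (mR * mR * mR)%type.
Variables (k : R) (alpha : R * R) (h : R) (eps : pt -> 'M[R[i]]_3) (j : lattice).
Variables (E u c : field3 R) (up um : lattice -> 'cV[R[i]]_3).
Hypotheses (k_gt0 : 0 < k) (h_gt0 : 0 < h) (h_supp : (supp_height eps < h%:E)%E).
Hypotheses (umax : maxwell k alpha eps E u c)
  (ucoef : rayleigh_coefficients k alpha h u up um).
Hypotheses (eps_medium : medium eps) (E_L2 : Lp_on 2 (D eps) E).
Implicit Types (b : bool) (q : R -> 'cV[R[i]]_3) (v : 'cV[R[i]]_3).
Local Notation beta := (beta k alpha j).
Local Notation chat := (chat alpha j).
Local Notation mode := (mode alpha j).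
Local Notation a1 := ('i * (- alpha1 alpha j)%:C).
Local Notation a2 := ('i * (- alpha2 alpha j)%:C).
Local Notation gam b := (gam k alpha b j).
Local Notation residual := (residual k alpha j).
Local Notation rayleigh_coef := (rayleigh_coef j up um).

Definition source x := (eps x - 1%:M) *m (u x + E x).

Lemma D_cube : D eps `<=` cube (Num.max pi h).
Proof.
move=> x Dx; apply: (Omega_cube _ Dx.2); first by rewrite le_max lexx.
by rewrite le_max (ltW (D_height h_supp Dx)) orbT.
Qed.

Lemma cintegrable_source m : cintegrable mu3 (D eps : set mpt) (fun x => source x m 0).
Proof.
have mD := @measurable_D R eps; have mc := @measurable_cube R (Num.max pi h).
have [[_ lu _ _] _] := umax.
have iu n : cintegrable mu3 (D eps : set mpt) (fun x => u x n 0).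
  exact: (cintegrableS mc mD D_cube (L2loc_locally n lu _)).
have iE n : cintegrable mu3 (D eps : set mpt) (fun x => E x n 0).
  exact: (L2_cintegrable n mD D_cube E_L2).
have [me [M HM] _ _] := eps_medium.
have ieE n : cintegrable mu3 (D eps : set mpt)
    (fun x => (eps x - 1%:M) m n * (u x n 0 + E x n 0)).
  apply: (@cintegrableM _ _ _ _ _ _ _ (M + 1) mD).
  - have -> : (fun x => (eps x - 1%:M) m n) = (fun x => eps x m n + - (m == n)%:R).
      by apply/funext => x; rewrite !mxE.
    by apply: cmeasD; [exact: me|exact: cmeas_cst].
  - move=> x _; rewrite !mxE; apply: le_trans (cabsD _ _) _; apply: lerD.
      by have := HM x m n; rewrite normE lecR.
    by rewrite cabsN; case: (m == n); rewrite ?cabs0 ?ler01// /cabs /= expr1n expr0n addr0 sqrtr1.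
  - exact: (cintegrableD mD (iu n) (iE n)).
have -> : (fun x => source x m 0) = (fun x =>
    (eps x - 1%:M) m ix1 * (u x ix1 0 + E x ix1 0) + (eps x - 1%:M) m ix2 * (u x ix2 0 + E x ix2 0) +
    (eps x - 1%:M) m ix3 * (u x ix3 0 + E x ix3 0)).
  apply/funext => x; rewrite /source mxE sum3E.
  by congr (_ * _ + _ * _ + _ * _); rewrite mxE.
exact: (cintegrableD mD (cintegrableD mD (ieE ix1) (ieE ix2)) (ieE ix3)).
Qed.

Lemma cintegrable_source_smooth (g : pt -> R[i]) v : (forall x, cdifferentiable x g) ->
  cintegrable mu3 (D eps : set mpt) (fun x => g x * dot (source x) v).
Proof.
move=> dg; have mD := @measurable_D R eps.
have [M HM] := bounded_cdifferentiable dg (Num.max pi h).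
apply: (@cintegrableM _ _ _ _ _ _ _ M mD).
- exact: cmeas_cdifferentiable.
- by move=> x /D_cube; exact: HM.
have -> : (fun x => dot (source x) v) = (fun x =>
    v ix1 0 * source x ix1 0 + v ix2 0 * source x ix2 0 + v ix3 0 * source x ix3 0).
  by apply/funext => x; rewrite dotE ![source x _ _ * _]mulrC.
have zi m := cintegrableZ (v m 0) mD (cintegrable_source m).
exact: (cintegrableD mD (cintegrableD mD (zi ix1) (zi ix2)) (zi ix3)).
Qed.

(** The two branches in the definition of beta are square roots of the same real number; later
    algebra uses only this. *)
Lemma beta_sq : beta ^+ 2 = (k ^+ 2 - (alpha1 alpha j ^+ 2 + alpha2 alpha j ^+ 2))%:C.
Proof.
have a0 : 0 <= alpha1 alpha j ^+ 2 + alpha2 alpha j ^+ 2 by rewrite addr_ge0 ?sqr_ge0.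
have an2 : alpha_norm alpha j ^+ 2 = alpha1 alpha j ^+ 2 + alpha2 alpha j ^+ 2.
  by rewrite /alpha_norm sqr_sqrtr.
rewrite /Defs.beta -an2; case: ifP => ak.
  have k2 : 0 <= k ^+ 2 - alpha_norm alpha j ^+ 2.
    by rewrite subr_ge0 lerXn2r ?nnegrE ?sqrtr_ge0// ltW.
  apply: complex_ext; rewrite expr2 ?cReM ?cImM /= ?mulr0 ?mul0r ?subr0 ?addr0//.
  by rewrite -expr2 sqr_sqrtr.
have k2 : 0 <= alpha_norm alpha j ^+ 2 - k ^+ 2.
  rewrite subr_ge0 lerXn2r ?nnegrE ?sqrtr_ge0 ?(ltW k_gt0)//.
  by move/negbT: ak; rewrite -ltNge => /ltW.
apply: complex_ext; rewrite expr2 ?cReM ?cImM /= ?mulr0 ?mul0r ?add0r//.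
by rewrite -expr2 sqr_sqrtr// opprB.
Qed.

(** Equal to 1 for |t| <= h + 1 and to 0 for |t| >= h + 2. The plateau extends beyond the slab, so
    the derivatives of the cutoff vanish on it, including at its edges. *)
Let chi (t : R) : R := step (-1 * t + (h + 2)) * step (1 * t + (h + 2)).

Let rsmooth_chi : rsmooth chi.
Proof.
apply: rsmoothM; (apply: (@rsmooth_comp _ step); [exact: rsmooth_step|exact: rsmooth_affine]).
Qed.

Let chi_in (t : R) : `|t| < h + 1 -> chi t = 1.
Proof. by rewrite ltr_norml => /andP[t1 t2]; rewrite /chi !step_ge1 ?mul1r//; lra. Qed.

Let chi_out (t : R) : h + 2 < `|t| -> chi t = 0.
Proof.
rewrite lter_normr => /orP[ht|ht]; rewrite /chi.
  by rewrite (@step_le0 _ (-1 * t + _)) ?mul0r//; lra.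
by rewrite [X in _ * X]step_le0 ?mulr0//; lra.
Qed.

Let X (t : R) : R[i] := (chi t)%:C.
Let sX : csmooth X. Proof. exact: csmooth_real rsmooth_chi. Qed.

Let X_in (t : R) : `|t| < h + 1 -> X t = 1. Proof. by move=> ?; rewrite /X chi_in. Qed.
Let X_out (t : R) : h + 2 < `|t| -> X t = 0. Proof. by move=> ?; rewrite /X chi_out. Qed.

Let open_in : open [set t : R | `|t| < h + 1].
Proof. by apply: (@open_comp _ _ (@Num.norm R R) [set s : R | s < h + 1]); [move=> t _; exact: norm_continuous|exact: open_lt]. Qed.

Let X1_in (t : R) : `|t| < h + 1 -> cder X t = 0.
Proof.
move=> th; have nf : \near t, `|t| < h + 1 by exact: open_nbhs_nbhs.
apply: is_cderive_cder; split; apply: near_eq_is_derive (is_derive_cst _ t 1);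
  by apply: filterS nf => s hs; rewrite X_in.
Qed.

Let X1_out (t : R) : h + 2 < `|t| -> cder X t = 0.
Proof. exact: cder_norm_supp X_out t. Qed.

Let X2_in (t : R) : `|t| < h + 1 -> cder (cder X) t = 0.
Proof. by move=> th; apply: (cder_supp open_in X1_in th). Qed.

Section FixedSign.
Variables (b : bool) (v : 'cV[R[i]]_3).
Hypothesis gam_v : dot (gam b) v = 0.
Let s : R := pm b.
Let b3 : R[i] := 'i * - (beta * s%:C).
(** The x3-factor of exp(-i gam . x). Against the Rayleigh exponential of the side [b] it leaves the
    constant exp(-i beta h). *)
Let psi (t : R) : R[i] := expi (- (beta * s%:C) * t%:C + 0).
Let f (t : R) : R[i] := psi t * X t.
Let q := profile f v (fun=> 0) 0.

Let csmooth_psi : csmooth psi. Proof. exact: csmooth_expi. Qed.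
Let sf : csmooth f. Proof. exact: csmoothM csmooth_psi sX. Qed.

Let is_cderive_psi t : is_cderive t psi (b3 * psi t).
Proof. exact: is_cderive_expi. Qed.

Let fE t : cder f t = psi t * (b3 * X t + cder X t).
Proof.
apply: is_cderive_cder; have := is_cderiveM (is_cderive_psi t) (csmooth_is_cderive t sX).
by congr (is_cderive _ _ _); ring.
Qed.

Let ffE t : cder (cder f) t =
  psi t * (b3 * b3 * X t + 2 * b3 * cder X t + cder (cder X) t).
Proof.
have -> : cder f = fun t => psi t * (b3 * X t + cder X t) by apply/funext => z; exact: fE.
apply: is_cderive_cder.
have d1 := is_cderiveM (is_cderive_cst t b3) (csmooth_is_cderive t sX).
have d2 := is_cderiveD d1 (csmooth_is_cderive t (csmooth_cder sX)).
have := is_cderiveM (is_cderive_psi t) d2.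
by congr (is_cderive _ _ _); ring.
Qed.

Let s_sq : s%:C * s%:C = 1 :> R[i].
Proof. by rewrite -rmorphM pm_sq. Qed.

Let i_sq : 'i * 'i = -1 :> R[i]. Proof. by rewrite -expr2 sqr_i. Qed.

Let dispersion : a1 * a1 + a2 * a2 + b3 * b3 + (k ^+ 2)%:C = 0.
Proof.
have bs := beta_sq.
have -> : b3 * b3 = ('i * 'i) * beta ^+ 2 * (s%:C * s%:C) by rewrite /b3; ring.
rewrite s_sq i_sq bs; move: (alpha1 alpha j) (alpha2 alpha j) => A1 A2.
rewrite !rmorphN rmorphB rmorphD !rmorphXn /=.
transitivity (('i * 'i + 1) * (A1%:C ^+ 2 + A2%:C ^+ 2)); first by ring.
by rewrite i_sq addNr mul0r.
Qed.

Let transverse : a1 * v ix1 0 + a2 * v ix2 0 + b3 * v ix3 0 = 0.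
Proof.
have := gam_v; rewrite dotE /Defs.gam !mxE /= => gv.
transitivity (- 'i * ((alpha1 alpha j)%:C * v ix1 0 + (alpha2 alpha j)%:C * v ix2 0 + s%:C * beta * v ix3 0)).
  by rewrite /b3 !rmorphN; ring.
by rewrite gv mulr0.
Qed.

(** Without the cutoff the wave solves the homogeneous equation, by [dispersion] and [transverse].
    What is left are commutator terms with derivatives of the cutoff. *)
Let residualE t : residual q t = psi t *: vec3
  (- cder (cder X) t * v ix1 0 + cder X t * (a1 * v ix3 0 - 2 * b3 * v ix1 0))
  (- cder (cder X) t * v ix2 0 + cder X t * (a2 * v ix3 0 - 2 * b3 * v ix2 0))
  (- b3 * cder X t * v ix3 0).
Proof.
have z0 : csmooth (fun _ : R => 0 : R[i]) by exact: csmooth_cst.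
have cz : cder (fun _ : R => 0 : R[i]) = fun=> 0.
  by apply/funext => z; apply: is_cderive_cder; exact: is_cderive_cst.
have cq : chat q = profile f (curl_tan alpha j v) (cder f) (curl_nor v).
  rewrite /q (chat_profile alpha j _ _ sf z0) cz; apply/funext => z.
  by rewrite /profile !scale0r !addr0.
have ccq : chat (chat q) t = f t *: curl_tan alpha j (curl_tan alpha j v) +
    cder f t *: curl_nor (curl_tan alpha j v) +
    (cder f t *: curl_tan alpha j (curl_nor v) + cder (cder f) t *: curl_nor (curl_nor v)).
  by rewrite cq (chat_profile alpha j _ _ sf (csmooth_cder sf)).
have qE : q t = f t *: v by rewrite /q /profile scaler0 addr0.
have tv := transverse; have dsp := dispersion.
have resE : residual q t = f t *: curl_tan alpha j (curl_tan alpha j v) +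
    cder f t *: curl_nor (curl_tan alpha j v) +
    (cder f t *: curl_tan alpha j (curl_nor v) + cder (cder f) t *: curl_nor (curl_nor v)) -
    (k ^+ 2)%:C *: (f t *: v).
  by rewrite -ccq -qE.
rewrite resE ffE fE /f.
move: (psi t) (X t) (cder X t) (cder (cder X) t) => p x0 x1 x2.
move: b3 tv dsp => b3' tv dsp.
apply: col3_ext; rewrite /curl_tan /curl_nor !mxE /=.
- transitivity (p * (- x2 * v ix1 0 + x1 * (a1 * v ix3 0 - 2 * b3' * v ix1 0)) +
    p * x0 * (a1 * (a1 * v ix1 0 + a2 * v ix2 0 + b3' * v ix3 0) -
      v ix1 0 * (a1 * a1 + a2 * a2 + b3' * b3' + (k ^+ 2)%:C))); first by ring.
  by rewrite tv dsp !mulr0 subr0 mulr0 addr0.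
- transitivity (p * (- x2 * v ix2 0 + x1 * (a2 * v ix3 0 - 2 * b3' * v ix2 0)) +
    p * x0 * (a2 * (a1 * v ix1 0 + a2 * v ix2 0 + b3' * v ix3 0) -
      v ix2 0 * (a1 * a1 + a2 * a2 + b3' * b3' + (k ^+ 2)%:C))); first by ring.
  by rewrite tv dsp !mulr0 subr0 mulr0 addr0.
- transitivity (p * (- b3' * x1 * v ix3 0) +
    p * (x1 * (a1 * v ix1 0 + a2 * v ix2 0 + b3' * v ix3 0) +
     x0 * (b3' * (a1 * v ix1 0 + a2 * v ix2 0 + b3' * v ix3 0) -
      v ix3 0 * (a1 * a1 + a2 * a2 + b3' * b3' + (k ^+ 2)%:C)))); first by ring.
  by rewrite tv dsp !mulr0 subr0 mulr0 addr0 mulr0 addr0.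
Qed.

Let sg (b' : bool) : R := pm b'.
Let ph (b' : bool) (t : R) : R[i] :=
  expi ((beta * (sg b' - s)%:C) * t%:C + - (beta * h%:C)).
(** The antiderivative on the side [b']. For b' = b the phase is constant and a term proportional to
    the cutoff itself survives up to the slab. On the opposite side the phase has derivative 2 b3
    times itself, which makes the pairing the derivative of a multiple of the cutoff derivative,
    zero at the slab. This separates the two coefficients. *)
Let boundary (b' : bool) (t : R) : R[i] := ph b' t *
  (- cder X t * (rayleigh_coef b' ix1 0 * v ix1 0 + rayleigh_coef b' ix2 0 * v ix2 0) -
   (b' == b)%:R * (2 * b3 * dot (rayleigh_coef b') v) * X t).

Let csmooth_boundary b' : csmooth (boundary b').
Proof.
apply: csmoothM; first exact: csmooth_expi.
apply: csmoothD; last by apply: csmoothN; apply: csmoothZ; exact: sX.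
apply: csmoothM; last exact: csmooth_cst.
by apply: csmoothN; exact: csmooth_cder sX.
Qed.

Let boundaryE b' t : cder (boundary b') t = ph b' t *
  ('i * (beta * (sg b' - s)%:C) * (- cder X t * (rayleigh_coef b' ix1 0 * v ix1 0 + rayleigh_coef b' ix2 0 * v ix2 0) -
   (b' == b)%:R * (2 * b3 * dot (rayleigh_coef b') v) * X t) +
  (- cder (cder X) t * (rayleigh_coef b' ix1 0 * v ix1 0 + rayleigh_coef b' ix2 0 * v ix2 0) -
   (b' == b)%:R * (2 * b3 * dot (rayleigh_coef b') v) * cder X t)).
Proof.
apply: is_cderive_cder.
have d0 := csmooth_is_cderive t sX.
have d1 := csmooth_is_cderive t (csmooth_cder sX).
have dN := is_cderiveM (is_cderive_cst t (-1)) d1.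
have dA := is_cderiveM dN (is_cderive_cst t (rayleigh_coef b' ix1 0 * v ix1 0 + rayleigh_coef b' ix2 0 * v ix2 0)).
have dB := is_cderiveM (is_cderive_cst t (- ((b' == b)%:R * (2 * b3 * dot (rayleigh_coef b') v)))) d0.
have := is_cderiveM (is_cderive_expi (beta * (sg b' - s)%:C) (- (beta * h%:C)) t) (is_cderiveD dA dB).
congr (is_cderive _ _ _).
  by apply/funext => z; rewrite /boundary /ph; congr (_ * _); ring.
by rewrite /ph; ring.
Qed.

Let coef_transverse b' :
  a1 * rayleigh_coef b' ix1 0 + a2 * rayleigh_coef b' ix2 0 +
  'i * - (beta * (sg b')%:C) * rayleigh_coef b' ix3 0 = 0.
Proof.
have := rayleigh_divergence_free j k_gt0 h_gt0 h_supp umax ucoef b'.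
rewrite dotE /Defs.gam !mxE /= => gv.
transitivity (- 'i * ((alpha1 alpha j)%:C * rayleigh_coef b' ix1 0 + (alpha2 alpha j)%:C * rayleigh_coef b' ix2 0 +
   (sg b')%:C * beta * rayleigh_coef b' ix3 0)).
  by rewrite !rmorphN; ring.
by rewrite gv mulr0.
Qed.

(** The normal component of the residual is traded for the tangential ones by the transversality of
    the coefficient. *)
Let pairing b' t : dot (rayleigh_coef b') (residual q t) * expi (beta * (sg b' * t - h)%:C) =
  cder (boundary b') t.
Proof.
rewrite residualE boundaryE !dotE !mxE /=.
have pe : psi t * expi (beta * (sg b' * t - h)%:C) = ph b' t.
  rewrite /psi /ph -expiD; congr expi.
  by rewrite !rmorphB rmorphM; ring.
have ct := coef_transverse b'.
rewrite -pe; move: (expi (beta * (sg b' * t - h)%:C)) (psi t) => ee p.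
move: (X t) (cder X t) (cder (cder X) t) => x0 x1 x2.
have [bE|bE] := eqVneq b' b.
  have b3E : 'i * - (beta * (sg b')%:C) = b3 by rewrite bE.
  rewrite b3E in ct; rewrite bE subrr mulr0 mulr0 mul0r add0r mul1r.
  rewrite bE in ct.
  move: (rayleigh_coef b) ct => U ct; move: b3 ct => b3' ct.
  transitivity (p * ee * (- x2 * (U ix1 0 * v ix1 0 + U ix2 0 * v ix2 0) -
    2 * b3' * (U ix1 0 * v ix1 0 + U ix2 0 * v ix2 0 + U ix3 0 * v ix3 0) * x1) +
    p * ee * x1 * v ix3 0 * (a1 * U ix1 0 + a2 * U ix2 0 + b3' * U ix3 0)); first by ring.
  by rewrite ct mulr0 addr0.
have sE : sg b' = - s.
  by rewrite /sg /s; move: bE; case: (b'); case: (b) => // _; rewrite /pm ?opprK.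
have b3E : 'i * - (beta * (sg b')%:C) = - b3 by rewrite sE /b3 rmorphN; ring.
have bbE : 'i * (beta * (sg b' - s)%:C) = 2 * b3.
  by rewrite sE /b3 rmorphB rmorphN; ring.
rewrite b3E in ct; rewrite bbE.
move: (rayleigh_coef b') ct => U ct; move: b3 ct => b3' ct.
rewrite mul0r mul0r subr0 mul0r subr0.
transitivity (p * ee * (2 * b3' * (- x1 * (U ix1 0 * v ix1 0 + U ix2 0 * v ix2 0)) +
    - x2 * (U ix1 0 * v ix1 0 + U ix2 0 * v ix2 0)) +
    p * ee * x1 * v ix3 0 * (a1 * U ix1 0 + a2 * U ix2 0 + - b3' * U ix3 0)); first by ring.
by rewrite ct mulr0 addr0.
Qed.

(** At the edges of the slab the cutoff is 1 with zero derivative, so the side [b] alone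
    contributes. The sign of [b3] and the orientation of the side compensate, and both cases give -2
    i beta. *)
Let boundary_diff : boundary false (- h) - boundary true h =
  expi (- (beta * h%:C)) * (- (2 * 'i * beta)) * dot (rayleigh_coef b) v.
Proof.
have nh : `|h| < h + 1 by rewrite gtr0_norm// ltrDl.
have nh' : `|- h| < h + 1 by rewrite normrN.
have ph0 (b' : bool) : b' = b -> ph b' ((sg b') * h) = expi (- (beta * h%:C)).
  by move=> ->; rewrite /ph /sg /s subrr mulr0 mul0r add0r.
rewrite /boundary (X1_in nh) (X1_in nh') (X_in nh) (X_in nh').
rewrite oppr0 !mul0r !sub0r !mulr1.
have b3s : b3 = - ('i * beta) * s%:C by rewrite /b3; ring.
case bE : b; rewrite /= ?mul0r ?mul1r ?oppr0 ?mulr0 ?sub0r ?subr0.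
  have := @ph0 true (esym bE); rewrite /sg /= mul1r => ->.
  rewrite b3s /s bE /=; ring.
have := @ph0 false (esym bE); rewrite /sg /= mulN1r => ->.
by rewrite b3s /s bE /= rmorphN rmorph1; ring.
Qed.

Let q_smooth : vsmooth q.
Proof. by apply: vsmooth_profile; [exact: sf|exact: csmooth_cst]. Qed.

Let qE t : q t = (psi t * X t) *: v.
Proof. by rewrite /q /profile scaler0 addr0. Qed.

Let formula_identity : (4 * pi ^+ 2)%:C *
  (expi (- (beta * h%:C)) * (- (2 * 'i * beta)) * dot (rayleigh_coef b) v) =
  (k ^+ 2)%:C * cint mu3 (D eps : set mpt) (fun x => waves alpha j x * psi x.2 * dot (source x) v).
Proof.
rewrite -boundary_diff.
have hr : h < h + 2 by rewrite ltrDl.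
have q0 : vsupp (h + 2) q by move=> t ht; rewrite qE X_out// mulr0 scale0r.
have in_in (t : R) : `|t| < h -> `|t| < h + 1 by move=> th; apply: lt_trans th _; rewrite ltrDl.
have res0 t : `|t| < h -> residual q t = 0.
  move=> /in_in th; rewrite residualE X1_in// X2_in// oppr0 !mul0r !mulr0 !mul0r !addr0.
  by apply: col3_ext; rewrite !mxE /= mulr0.
have h0 := h_gt0.
have bout b' (t : R) : h + 2 < `|t| -> boundary b' t = 0.
  by move=> ht; rewrite /boundary X_out// X1_out// oppr0 mul0r mulr0 subr0 mulr0.
have -> := rayleigh_identity h_gt0 umax ucoef hr q_smooth q0 res0
  (csmooth_boundary true) (csmooth_boundary false).
- congr (_ * _); apply: eq_cint => x Dx; have hx := D_height h_supp Dx.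
  rewrite /source /mode qE X_in; last exact: in_in.
  by rewrite mulr1 !dotE !mxE; ring.
- by move=> t ht; apply: bout; rewrite gtr0_norm//; lra.
- by move=> t ht; apply: bout; rewrite ltr0_norm; lra.
- by move=> t _; rewrite -pairing /sg /= mul1r.
- move=> t _; rewrite -pairing /sg /=; congr (_ * expi _).
  by rewrite mulN1r mulNr -mulrN -rmorphN opprD.
Qed.

(** Division of [formula_identity] by 4 pi^2 (-2 i beta) exp(-i beta h) produces the factor i / (8
    pi^2 beta) exp(i beta h) of [rcoef]. *)
Lemma rayleigh_formula : beta != 0 -> dot (rayleigh_coef b) v =
  (k ^+ 2)%:C * cint mu3 (D eps : set mpt)
    (fun x => rcoef k alpha h b j x * dot (source x) v).
Proof.
move=> b0; set Uv := dot _ _.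
pose C0 : R[i] := 'i / ((8 * pi ^+ 2)%:C * beta) * expi (beta * h%:C).
have rE x : rcoef k alpha h b j x = C0 * (waves alpha j x * psi x.2).
  rewrite /C0 /rcoef -!mulrA; congr (_ * (_ * _)).
  rewrite /waves /wave /psi addr0 -!expiD; congr expi.
  by rewrite rmorphB rmorphM !rmorphN !rmorphM /s; ring.
have dg x : cdifferentiable x (fun x => waves alpha j x * psi x.2).
  have -> : (fun x : pt => waves alpha j x * psi x.2) =
    tensor (wave (alpha1 alpha j)) (wave (alpha2 alpha j)) psi by [].
  by apply: cdifferentiable_tensor; [exact: csmooth_wave|exact: csmooth_wave|exact: csmooth_psi].
have mD := @measurable_D R eps.
have gi := cintegrable_source_smooth v dg.
have -> : cint mu3 (D eps : set mpt) (fun x => rcoef k alpha h b j x * dot (source x) v) =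
   C0 * cint mu3 (D eps : set mpt) (fun x => waves alpha j x * psi x.2 * dot (source x) v).
  by rewrite -(cintZ _ mD gi); apply: eq_cint => x _; rewrite rE; ring.
rewrite mulrCA -formula_identity -/Uv /C0.
have ee := expiK (beta * h%:C).
have p0 : (8 * pi ^+ 2)%:C != 0 :> R[i].
  by rewrite (inj_eq (@complexI R)) mulf_neq0// expf_neq0// gt_eqF// pi_gt0.
have p8 : (8 * pi ^+ 2)%:C = 2 * (4 * pi ^+ 2)%:C :> R[i].
  have -> : 8 * pi ^+ 2 = 2 * (4 * pi ^+ 2) :> R by ring.
  by rewrite rmorphM rmorph_nat.
transitivity (- ('i * 'i) * (expi (beta * h%:C) * expi (- (beta * h%:C))) * Uv).
  by rewrite ee i_sq opprK !mul1r.
have p40 : (4 * pi ^+ 2)%:C != 0 :> R[i].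
  by apply: contra_neq p0 => p4; rewrite p8 p4 mulr0.
clear ee; rewrite p8; move: (expi (beta * h%:C)) (expi (- (beta * h%:C))) Uv ((4 * pi ^+ 2)%:C) p40 beta b0 => e1 e2 U p4 p40 B B0.
by field; rewrite p40 B0.
Qed.

End FixedSign.
End RayleighFormula.


(** * Finite lattice sums and propagating modes *)

Section FiniteLatticeSums.
Context {R : realType}.
Implicit Types (a : lattice -> R[i]).

Lemma lattice_has_sum_eq a l : lattice_has_sum a l -> lattice_sum a = l.
Proof.
move=> [ra ia]; apply: complex_ext; rewrite /lattice_sum /=.
  exact: (cvg_lim (@Rhausdorff R) ra).
exact: (cvg_lim (@Rhausdorff R) ia).
Qed.

(** The partial sums are constant on all finite sets containing [P]. *)
Lemma lattice_has_sum_finite a (P : {fset lattice}) :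
  (forall j, j \notin P -> a j = 0) -> lattice_has_sum a (\sum_(j <- P) a j).
Proof.
move=> a0.
have nP : \forall A \near summability.totally, summability.partial_sum a A = \sum_(j <- P) a j.
  exists P => // A PA.
  have AE : summability.partial_sum a A = \sum_(j <- A) a j by rewrite (big_seq_fsetE _ _ predT a).
  by rewrite AE; symmetry; apply: (big_fset_incl +%R PA) => j _; exact: a0.
by split; apply: cvg_near_cst; apply: filterS nP => A ->.
Qed.

Lemma lattice_has_sumD a b l m : lattice_has_sum a l -> lattice_has_sum b m ->
  lattice_has_sum (fun j => a j + b j) (l + m).
Proof.
move=> [ra ia] [rb ib].
have E A : summability.partial_sum (fun j => a j + b j) A =
  summability.partial_sum a A + summability.partial_sum b A by exact: big_split.
by split; [under eq_fun do rewrite E cReD; rewrite cReD; exact: cvgD ra rb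
          |under eq_fun do rewrite E cImD; rewrite cImD; exact: cvgD ia ib].
Qed.

Variables (k : R) (alpha : R * R).

(** Each component of alpha_j is bounded by its norm, which confines both indices. The lemma serves
    at the wave number k and also at k + 1, in the convergence proof for the Green's function. *)
Lemma propagating_finite : exists P : {fset lattice},
  forall j, (j \in P) = (alpha_norm alpha j <= k).
Proof.
pose B := `|k| + `|alpha.1| + `|alpha.2|.
have B0 : 0 <= B by rewrite !addr_ge0.
pose M := Num.bound B.
have bM (x : R) (z : int) : `|x| <= `|alpha.1| + `|alpha.2| -> `|x + z%:~R| <= k -> (`|z| <= M)%N.
  move=> xB xz; have kn : k <= `|k| by exact: ler_norm.
  have zB : `|z%:~R : R| <= B.
    have -> : z%:~R = (x + z%:~R) - x :> R by rewrite addrC addKr.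
    apply: le_trans (ler_normB _ _) _; rewrite /B -addrA; apply: lerD => //.
    exact: le_trans xz kn.
  rewrite -(ler_nat R); apply: ltW; have := archi_boundP B0; apply: le_lt_trans.
  by apply: le_trans zB; rewrite -intr_norm natr_absz.
pose ints := [seq (n%:Z - M%:Z) | n <- iota 0 (M + M).+1].
have mints (z : int) : (`|z| <= M)%N -> z \in ints.
  move=> zM; apply/mapP; exists (absz (z + M%:Z)); last by rewrite gez0_abs; lia.
  by rewrite mem_iota; lia.
exists [fset j in [seq j <- [seq (x, y) | x <- ints, y <- ints] | alpha_norm alpha j <= k]]%fset.
move=> j; rewrite inE mem_filter; case: (boolP (_ <= k)) => // jk; rewrite andTb.
have an (x y : R) : Num.sqrt (x ^+ 2 + y ^+ 2) <= k -> `|x| <= k /\ `|y| <= k.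
  move=> h; have := Re_le_cabs (x +i* y); have := Im_le_cabs (x +i* y).
  by rewrite /cabs /= => h1 h2; split; [exact: le_trans h2 h|exact: le_trans h1 h].
have [j1 j2] := an _ _ jk.
apply/allpairsP; exists (j.1, j.2); split; last by case: (j).
  by apply: mints; apply: bM j1; rewrite lerDl.
by apply: mints; apply: bM j2; rewrite lerDr.
Qed.

End FiniteLatticeSums.


Local Open Scope sesquilinear_scope.

(** * Algebra of the imaging terms *)

Section ImagingAlgebra.
Context {R : realType}.
Local Notation pt := (space3 R).
Variables (k : R) (alpha : R * R) (h : R) (j : lattice).
Hypothesis k_gt0 : 0 < k.
Local Notation beta := (beta k alpha j).
Local Notation gam b := (gam k alpha b j).
Local Notation gmat b := (gmat k alpha h b j).
Implicit Types (b : bool) (z : pt) (m : 'I_3).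

Lemma beta_conj : Num.conj beta = beta \/ Num.conj beta = - beta.
Proof.
rewrite /Defs.beta; case: ifP => _; [left|right];
  by apply: complex_ext; rewrite ?cRe_conj ?cIm_conj ?cReN ?cImN /= ?oppr0.
Qed.

Lemma gam_sq b : dot (gam b) (gam b) = (k ^+ 2)%:C.
Proof.
rewrite dotE /Defs.gam !mxE /=.
have := beta_sq alpha j k_gt0; have := pm_sq (R := R) b.
move: (pm b) (alpha1 alpha j) (alpha2 alpha j) beta => s A1 A2 B ss BB.
have -> : A1%:C * A1%:C + A2%:C * A2%:C + s%:C * B * (s%:C * B) =
  (A1 ^+ 2 + A2 ^+ 2)%:C + (s * s)%:C * B ^+ 2 :> R[i].
  by rewrite rmorphD !rmorphXn rmorphM /=; ring.
by rewrite ss mul1r BB -rmorphD; congr (_%:C); ring.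
Qed.

Lemma conj_real (a : R) : Num.conj (a%:C : R[i]) = a%:C.
Proof. by apply: complex_ext; rewrite ?cRe_conj ?cIm_conj /= ?oppr0. Qed.

Lemma conj_mul (a b : R[i]) : Num.conj (a * b) = Num.conj a * Num.conj b.
Proof. exact: rmorphM. Qed.

Lemma gmat_conj b z n m : Num.conj (gmat b z n m) =
  ((n == m)%:R - Num.conj (gam b n 0) * Num.conj (gam b m 0) / (k ^+ 2)%:C) *
  Num.conj (rcoef k alpha h b j z).
Proof.
rewrite /Defs.gmat mxE; move: (rcoef _ _ _ _ _ _) (gam b n 0) (gam b m 0) => r x y.
by rewrite rmorphM rmorphB rmorph_nat -{2}(conj_real (k ^+ 2)) -rmorphM -fmorph_div.
Qed.

Let K_neq0 : (k ^+ 2)%:C != 0 :> R[i].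
Proof. by rewrite (inj_eq (@complexI R)) expf_neq0// gt_eqF. Qed.

Lemma gamE b : [/\ gam b ix1 0 = (alpha1 alpha j)%:C, gam b ix2 0 = (alpha2 alpha j)%:C &
  gam b ix3 0 = (pm b)%:C * beta].
Proof. by rewrite /Defs.gam !mxE. Qed.

(* For an evanescent mode conjugation replaces beta by - beta: the h-terms then
   do not vanish by transversality alone, but cancel the u_3-terms. *)
Lemma cross_terms b (U : 'cV[R[i]]_3) z m : dot (gam b) U = 0 ->
  Num.conj (gmat b z ix3 m) * (\sum_n Num.conj (gam b n 0) * U n 0) +
  U ix3 0 * (\sum_n Num.conj (gmat b z n m) * gam b n 0) = 0.
Proof.
have [g1 g2 g3] := gamE b; have gg := gam_sq b; have K0 := K_neq0.
rewrite !dotE in gg *; rewrite !sum3E !gmat_conj.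
have cgE : [/\ Num.conj (gam b ix1 0) = (alpha1 alpha j)%:C,
    Num.conj (gam b ix2 0) = (alpha2 alpha j)%:C &
    Num.conj (gam b ix3 0) = gam b ix3 0 \/ Num.conj (gam b ix3 0) = - gam b ix3 0].
  rewrite g1 g2 g3 conj_mul !conj_real; split=> //.
  by have [->|->] := beta_conj; [left|right; rewrite mulrN].
have [c1 c2 c3] := cgE; rewrite c1 c2.
rewrite g1 g2 in gg *.
move: (Num.conj (rcoef _ _ _ _ _ _)) => r.
have e3 : Num.conj (gam b m 0) = if m == ix1 then (alpha1 alpha j)%:C else
  if m == ix2 then (alpha2 alpha j)%:C else Num.conj (gam b ix3 0).
  by have [->|->|->] := ix_cases m.
rewrite e3.
move: ((k ^+ 2)%:C) K0 gg => K K0 gg.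
move: (gam b ix3 0) (Num.conj (gam b ix3 0)) c3 gg => T T' c3 gg gu.
move: (alpha1 alpha j)%:C (alpha2 alpha j)%:C (U ix1 0) (U ix2 0) (U ix3 0) gu gg
  => A1 A2 u1 u2 u3 gu gg.
(* Real beta: the first summand vanishes by transversality of [U], the second because the columns of
   g are bilinearly orthogonal to gam. *)
case: c3 => ->.
  rewrite gu mulr0 add0r; apply/eqP; rewrite mulf_eq0; apply/orP; right; apply/eqP.
  have [mE|mE|mE] := ix_cases m; rewrite mE /=.
  - transitivity (r * A1 * (1 - (A1 * A1 + A2 * A2 + T * T) / K)); first by ring.
    by rewrite gg divff// subrr mulr0.
  - transitivity (r * A2 * (1 - (A1 * A1 + A2 * A2 + T * T) / K)); first by ring.
    by rewrite gg divff// subrr mulr0.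
  - transitivity (r * T * (1 - (A1 * A1 + A2 * A2 + T * T) / K)); first by ring.
    by rewrite gg divff// subrr mulr0.
(* Imaginary beta: conjugation flips the third component [T], and both pairings with the flipped
   vector are reduced to multiples of [T] by transversality and by gam . gam = k^2. *)
have d : A1 * u1 + A2 * u2 + - T * u3 = - (2 * T * u3).
  by rewrite -[RHS](addr0) -gu; ring.
have e : A1 * A1 + A2 * A2 - T * T = K - 2 * (T * T) by rewrite -gg; ring.
rewrite d; have [mE|mE|mE] := ix_cases m; rewrite mE /=.
- transitivity (r * u3 * ((T * A1 / K) * - (2 * T) + (A1 - A1 * (A1 * A1 + A2 * A2 - T * T) / K))); first by ring.
  by rewrite e; field.
- transitivity (r * u3 * ((T * A2 / K) * - (2 * T) + (A2 - A2 * (A1 * A1 + A2 * A2 - T * T) / K))); first by ring.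
  by rewrite e; field.
- transitivity (r * u3 * ((1 - T * T / K) * - (2 * T) + (T + T * (A1 * A1 + A2 * A2 - T * T) / K))); first by ring.
  by rewrite e; field.
Qed.

(** The image of e_m under I - gam gam^T / k^2. As gam . gam = k^2, this matrix is the projection
    along gam onto its bilinear orthogonal complement. *)
Definition polarization b m : 'cV[R[i]]_3 :=
  \col_n ((n == m)%:R - gam b n 0 * gam b m 0 / (k ^+ 2)%:C).

Lemma polarizationE b m n : polarization b m n 0 =
  (n == m)%:R - gam b n 0 * gam b m 0 / (k ^+ 2)%:C.
Proof. by rewrite mxE. Qed.

Lemma polarization_orthogonal b m : dot (gam b) (polarization b m) = 0.
Proof.
have gg := gam_sq b; have K0 := K_neq0; rewrite !dotE in gg *; rewrite !polarizationE.
move: ((k ^+ 2)%:C) K0 gg => K K0 gg.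
have gmE : gam b m 0 = gam b ix1 0 * (ix1 == m)%:R + gam b ix2 0 * (ix2 == m)%:R +
  gam b ix3 0 * (ix3 == m)%:R.
  by have [->|->|->] := ix_cases m; rewrite /= ?mulr1 ?mulr0 ?addr0 ?add0r.
rewrite gmE; move: (gam b ix1 0) (gam b ix2 0) (gam b ix3 0) gg => A1 A2 T gg.
move: (ix1 == m)%:R (ix2 == m)%:R (ix3 == m)%:R => d1 d2 d3.
transitivity ((A1 * d1 + A2 * d2 + T * d3) * (1 - (A1 * A1 + A2 * A2 + T * T) / K)); first by ring.
by rewrite gg divff// subrr mulr0.
Qed.

Let adj_entry (H G : 'M[R[i]]_3) (g U : 'cV[R[i]]_3) (a : R) m (x : R[i]) :
  (forall n, H n m = g n 0 * x) ->
  ((H + a%:C *: G)^t* *m U) m 0 = Num.conj x * (\sum_n Num.conj (g n 0) * U n 0) +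
    a%:C * (\sum_n Num.conj (G n m) * U n 0).
Proof.
move=> HE; rewrite mxE !big_distrr -big_split /=; apply: eq_bigr => n _.
have -> : ((H + a%:C *: G)^t*) m n = Num.conj (g n 0 * x + a%:C * G n m).
  by rewrite 2!mxE [in LHS]mxE HE; congr (Num.conj (_ + _)); rewrite mxE.
have conjD (y y' : R[i]) : Num.conj (y + y') = Num.conj y + Num.conj y' by exact: rmorphD.
by rewrite conjD !conj_mul conj_real; ring.
Qed.

Let adj_scaled (G : 'M[R[i]]_3) (g : 'cV[R[i]]_3) m (x : R[i]) :
  (x *: (G^t* *m g)) m 0 = x * \sum_n Num.conj (G n m) * g n 0.
Proof. by rewrite mxE; congr (_ * _); rewrite mxE; apply: eq_bigr => n _; rewrite !mxE. Qed.

(** By [cross_terms] only the terms with 2 Re beta remain. The sign conventions for h^+ and h^- give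
    both sides of the medium the same sign. *)
Lemma imaging_termE (up um : lattice -> 'cV[R[i]]_3) z m :
  dot (gam true) (up j) = 0 -> dot (gam false) (um j) = 0 ->
  imaging_term k alpha h up um z j m 0 = - (2 * Re beta)%:C *
    (\sum_n Num.conj (gmat true z n m) * up j n 0 +
     \sum_n Num.conj (gmat false z n m) * um j n 0).
Proof.
move=> /(cross_terms z m) Yt /(cross_terms z m) Yf.
rewrite /imaging_term.
have gt : vec3 (alpha1 alpha j)%:C (alpha2 alpha j)%:C beta = gam true.
  by rewrite /Defs.gam /= mul1r.
have gf : vec3 (alpha1 alpha j)%:C (alpha2 alpha j)%:C (- beta) = gam false.
  by rewrite /Defs.gam /= rmorphN mulN1r.
rewrite gt gf.
have hE b n : hmat k alpha h b j z n m = gam b n 0 * gmat b z ix3 m by rewrite mxE.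
have eE (A B C' D' : 'cV[R[i]]_3) : (A + B - C' - D') m 0 = A m 0 + B m 0 - C' m 0 - D' m 0.
  by rewrite !mxE.
have neg : hmat k alpha h true j z - (2 * Re beta)%:C *: gmat true z =
    hmat k alpha h true j z + (- (2 * Re beta))%:C *: gmat true z.
  by rewrite rmorphN scaleNr.
rewrite eE neg !adj_scaled (adj_entry _ _ _ (hE true)) (adj_entry _ _ _ (hE false)).
have nE : (- (2 * Re beta))%:C = - (2 * Re beta)%:C :> R[i] by exact: rmorphN.
rewrite nE; move: (2 * Re beta)%:C Yt Yf => rb.
move: (Num.conj (gmat true z ix3 m) * _) (Num.conj (gmat false z ix3 m) * _) => Y1 Y2.
move: (up j ix3 0 * _) (um j ix3 0 * _) => Z1 Z2 /eqP; rewrite addr_eq0 => /eqP ->.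
by move=> /eqP; rewrite addr_eq0 => /eqP ->; ring.
Qed.

Lemma propagating_gmat b (U : 'cV[R[i]]_3) z m : alpha_norm alpha j <= k ->
  \sum_n Num.conj (gmat b z n m) * U n 0 =
  Num.conj (rcoef k alpha h b j z) * dot U (polarization b m).
Proof.
move=> jk.
have bc : Num.conj beta = beta.
  by rewrite /Defs.beta jk; apply: complex_ext; rewrite ?cRe_conj ?cIm_conj /= ?oppr0.
have [g1 g2 g3] := gamE b.
have gc n : Num.conj (gam b n 0) = gam b n 0.
  by have [->|->|->] := ix_cases n; rewrite ?g1 ?g2 ?g3 ?conj_mul ?bc !conj_real.
rewrite /dot big_distrr /=; apply: eq_bigr => n _.
by rewrite gmat_conj !gc polarizationE; ring.
Qed.

End ImagingAlgebra.

(** * The imaging functional as a finite sum of integrals *)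

Section ImagingIntegral.
Context {R : realType}.
Local Notation pt := (space3 R).
Local Notation mR := (measurableTypeR R).
Local Notation mpt := (mR * mR * mR)%type.
Variables (k : R) (alpha : R * R) (h : R) (eps : pt -> 'M[R[i]]_3).
Implicit Types (b : bool) (x y z : pt) (m : 'I_3) (j : lattice).

(** The prefactor is that of the Green's function, i / (8 pi^2 beta), divided by 2 i. *)
Definition planewave b j x y : R[i] := ((16 * pi ^+ 2)%:C * beta k alpha j)^-1 *
  expi ((alpha1 alpha j * (x.1.1 - y.1.1) + alpha2 alpha j * (x.1.2 - y.1.2))%:C +
        beta k alpha j * (pm b * (x.2 - y.2))%:C).

(** The exponential of an affine form with complex coefficients: the common shape of [rcoef] and
    [planewave], for which derivatives are computed once. *)
Definition pexp (a : 'cV[R[i]]_3) (d : R[i]) x : R[i] :=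
  expi (a ix1 0 * x.1.1%:C + a ix2 0 * x.1.2%:C + a ix3 0 * x.2%:C + d).

Lemma pexp_tensor a d : pexp a d = tensor (fun t => expi (a ix1 0 * t%:C + d))
  (fun t => expi (a ix2 0 * t%:C + 0)) (fun t => expi (a ix3 0 * t%:C + 0)).
Proof.
by apply/funext => x; rewrite /pexp /tensor -!expiD; congr expi; ring.
Qed.

Lemma is_partial_pexp m a d x : is_partial m x (pexp a d) ('i * a m 0 * pexp a d x).
Proof.
have eE (c e : R[i]) : cder (fun t => expi (c * t%:C + e)) = fun t => 'i * c * expi (c * t%:C + e).
  by apply/funext => t; apply: is_cderive_cder; exact: is_cderive_expi.
rewrite pexp_tensor.
have -> : 'i * a m 0 * tensor (fun t => expi (a ix1 0 * t%:C + d))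
    (fun t => expi (a ix2 0 * t%:C + 0)) (fun t => expi (a ix3 0 * t%:C + 0)) x =
  tensor_partial m (fun t => expi (a ix1 0 * t%:C + d))
    (fun t => expi (a ix2 0 * t%:C + 0)) (fun t => expi (a ix3 0 * t%:C + 0)) x.
  by rewrite /tensor_partial !eE /tensor; have [->|->|->] := ix_cases m => /=; ring.
by apply: is_partial_tensor; exact: csmooth_expi.
Qed.

Lemma cdifferentiable_pexp a d x : cdifferentiable x (pexp a d).
Proof.
by rewrite pexp_tensor; apply: cdifferentiable_tensor; exact: csmooth_expi.
Qed.

Lemma rcoef_pexp b j x : rcoef k alpha h b j x =
  'i / ((8 * pi ^+ 2)%:C * beta k alpha j) *
  pexp (- gam k alpha b j) (beta k alpha j * h%:C) x.
Proof.
have [g1 g2 g3] := gamE k alpha j b.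
have gN m : (- gam k alpha b j) m 0 = - gam k alpha b j m 0 by rewrite mxE.
rewrite /rcoef /pexp !gN g1 g2 g3; congr (_ * expi _).
by rewrite rmorphB !rmorphM /=; ring.
Qed.

(** Here beta is real, so exp(i beta h) cancels against its conjugate and h disappears. The equality
    2 beta / (8 pi^2 beta)^2 = 1 / (2 pi^2) . 1 / (16 pi^2 beta) is the origin of the constant k^2 /
    (2 pi^2) in the theorem. *)
Lemma rcoef_planewave b j z y : alpha_norm alpha j <= k -> beta k alpha j != 0 ->
  2 * beta k alpha j * Num.conj (rcoef k alpha h b j z) * rcoef k alpha h b j y =
  (2 * pi ^+ 2)%:C^-1 * planewave b j z y.
Proof.
move=> jk b0.
have bc : Num.conj (beta k alpha j) = beta k alpha j.
  by rewrite /Defs.beta jk; apply: complex_ext; rewrite ?cRe_conj ?cIm_conj /= ?oppr0.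
rewrite /rcoef /planewave.
move: (beta k alpha j) (alpha1 alpha j) (alpha2 alpha j) b0 bc => B A1 A2 B0 bc.
set ez := expi (_ + B * (h - pm b * z.2)%:C); set ey := expi (_ + B * (h - pm b * y.2)%:C).
have pE : expi ((A1 * (z.1.1 - y.1.1) + A2 * (z.1.2 - y.1.2))%:C + B * (pm b * (z.2 - y.2))%:C) =
    Num.conj ez * ey.
  rewrite expi_conj -expiD; congr expi.
  have cD (u v : R[i]) : Num.conj (u + v) = Num.conj u + Num.conj v by exact: rmorphD.
  have cN (u : R[i]) : Num.conj (- u) = - Num.conj u by exact: rmorphN.
  rewrite !(cD, cN, conj_mul, conj_real) bc.
  move: (pm b) z.1.1 z.1.2 z.2 y.1.1 y.1.2 y.2 => s z1 z2 z3 y1 y2 y3.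
  by rewrite !(rmorphB, rmorphD, rmorphM) /=; ring.
have p0 : (pi : R)%:C != 0 :> R[i] by rewrite (inj_eq (@complexI R)) gt_eqF ?pi_gt0.
have ic : Num.conj ('i : R[i]) = - 'i.
  by apply: complex_ext; rewrite ?cRe_conj ?cIm_conj /= ?oppr0.
have cV : Num.conj (((8 * pi ^+ 2)%:C * B)^-1) = ((8 * pi ^+ 2)%:C * B)^-1.
  by rewrite fmorphV /= conj_mul conj_real bc.
rewrite pE {pE} !conj_mul ic cV.
have i2 : 'i * 'i = -1 :> R[i] by rewrite -expr2 sqr_i.
have n8 : (8 * pi ^+ 2)%:C = 8 * pi%:C ^+ 2 :> R[i] by rewrite rmorphM rmorphXn rmorph_nat.
have n2 : (2 * pi ^+ 2)%:C = 2 * pi%:C ^+ 2 :> R[i] by rewrite rmorphM rmorphXn rmorph_nat.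
have n16 : (16 * pi ^+ 2)%:C = 16 * pi%:C ^+ 2 :> R[i] by rewrite rmorphM rmorphXn rmorph_nat.
rewrite n8 n2 n16; move: (pi%:C) p0 (Num.conj ez) ey => p p0 e1 e2.
transitivity (- ('i * 'i) * (2 * B / (8 * p ^+ 2 * B) / (8 * p ^+ 2 * B)) * (e1 * e2)); first by ring.
by rewrite i2 opprK mul1r; field; rewrite p0 B0.
Qed.

(** Off [P] the real part of beta is 0 and the term vanishes, so the lattice series is a finite sum.
    The polarization vectors are transversal, as [rayleigh_formula] requires. The overall minus sign
    is invisible to the norm in the theorem. *)
Lemma imaging_integral E u c (up um : lattice -> 'cV[R[i]]_3) (P : {fset lattice}) z m :
  0 < k -> 0 < h -> (supp_height eps < h%:E)%E -> medium eps -> Lp_on 2 (D eps) E ->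
  maxwell k alpha eps E u c -> rayleigh_coefficients k alpha h u up um ->
  (forall j, beta k alpha j != 0) -> (forall j, (j \in P) = (alpha_norm alpha j <= k)) ->
  lattice_sum (fun j => imaging_term k alpha h up um z j m 0) =
  - ((k ^+ 2 / (2 * pi ^+ 2))%:C * \sum_(j <- P) \sum_(b : bool)
    cint mu3 (D eps : set mpt) (fun y => planewave b j z y *
      dot (source eps E u y) (polarization k alpha j b m))).
Proof.
move=> k0 h0 hs med EL2 umax ucoef b0 PE.
have divfree := rayleigh_divergence_free _ k0 h0 hs umax ucoef.
have tE j : imaging_term k alpha h up um z j m 0 = - (2 * Re (beta k alpha j))%:C *
    (\sum_n Num.conj (gmat k alpha h true j z n m) * up j n 0 +
     \sum_n Num.conj (gmat k alpha h false j z n m) * um j n 0).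
  exact: (imaging_termE _ k0 _ _ (divfree j true) (divfree j false)).
have t0 j : j \notin P -> imaging_term k alpha h up um z j m 0 = 0.
  rewrite PE => /negbTE jk; rewrite tE.
  have -> : Re (beta k alpha j) = 0 by rewrite /Defs.beta jk /=.
  by rewrite mulr0 oppr0 mul0r.
rewrite (lattice_has_sum_eq (lattice_has_sum_finite t0)).
rewrite big_distrr -sumrN; apply: eq_big_seq => j /=; rewrite PE => jk.
have bE : (2 * Re (beta k alpha j))%:C = 2 * beta k alpha j.
  by rewrite /Defs.beta jk rmorphM rmorph_nat.
have tb b : 2 * beta k alpha j * (\sum_n Num.conj (gmat k alpha h b j z n m) *
      rayleigh_coef j up um b n 0) =
    (k ^+ 2 / (2 * pi ^+ 2))%:C * cint mu3 (D eps : set mpt) (fun y => planewave b j z y *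
      dot (source eps E u y) (polarization k alpha j b m)).
  rewrite propagating_gmat//.
  rewrite (rayleigh_formula k0 h0 hs umax ucoef med EL2 (polarization_orthogonal alpha j k0 b m) (b0 j)).
  have mD := @measurable_D R eps.
  have dr x : cdifferentiable x (rcoef k alpha h b j).
    have -> : rcoef k alpha h b j = fun x => 'i / ((8 * pi ^+ 2)%:C * beta k alpha j) *
        pexp (- gam k alpha b j) (beta k alpha j * h%:C) x.
      by apply/funext => y; exact: rcoef_pexp.
    by apply: cdifferentiableM; [split; exact: differentiable_cst|exact: cdifferentiable_pexp].
  have gi := cintegrable_source_smooth hs umax med EL2 (polarization k alpha j b m) dr.
  have pE y : planewave b j z y * dot (source eps E u y) (polarization k alpha j b m) =
      ((2 * pi ^+ 2)%:C * (2 * beta k alpha j * Num.conj (rcoef k alpha h b j z))) *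
      (rcoef k alpha h b j y * dot (source eps E u y) (polarization k alpha j b m)).
    have pi0 : (2 * pi ^+ 2)%:C != 0 :> R[i].
      by rewrite (inj_eq (@complexI R)) mulf_neq0// expf_neq0// gt_eqF// pi_gt0.
    have := rcoef_planewave b z y jk (b0 j).
    move: (rcoef k alpha h b j y) (Num.conj _) (dot _ _) (planewave _ _ _ _) => r cr d p rE.
    by rewrite -[p](mulVKf pi0) -rE; ring.
  under [in RHS]eq_cint do rewrite pE.
  have KE : (k ^+ 2 / (2 * pi ^+ 2))%:C = (k ^+ 2)%:C / (2 * pi ^+ 2)%:C :> R[i].
    by rewrite rmorphM fmorphV.
  rewrite (cintZ _ mD gi) KE.
  have pi0 : (2 * pi ^+ 2)%:C != 0 :> R[i].
    by rewrite (inj_eq (@complexI R)) mulf_neq0// expf_neq0// gt_eqF// pi_gt0.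
  move: (cint _ _ _) ((2 * pi ^+ 2)%:C) pi0 (Num.conj _) (beta k alpha j) ((k ^+ 2)%:C) =>
    I p p0 cr B K.
  by field.
rewrite tE bE mulNr mulrDr big_bool [in RHS]mulrDr.
by congr (- (_ + _)); [exact: (tb true)|exact: (tb false)].
Qed.

End ImagingIntegral.

(** * Absolute summability over the lattice *)

Section LatticeSummability.
Context {R : realType}.
Implicit Types (a : lattice -> R) (s : seq lattice).

Lemma sum_subset_le (T : eqType) (F : T -> R) (s t : seq T) : (forall x, 0 <= F x) ->
  uniq s -> {subset s <= t} -> \sum_(x <- s) F x <= \sum_(x <- t) F x.
Proof.
move=> F0; elim: s t => [|x s IH] t; first by rewrite big_nil => _ _; exact: sumr_ge0.
move=> /= /andP[xs us] st; have xt : x \in t by apply: st; rewrite inE eqxx.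
rewrite big_cons (big_rem x xt) /= lerD2l; apply: IH => // y ys.
have yt : y \in t by apply: st; rewrite inE ys orbT.
have := perm_mem (perm_to_rem xt) y; rewrite yt inE => /esym /orP[/eqP yx|//].
by move: xs; rewrite -yx ys.
Qed.

(** A finite set lies in a square of indices, over which the sum factors into two one-dimensional
    sums, each at most twice a geometric series. *)
Lemma geometric_lattice_bound (q : R) (A : {fset lattice}) : 0 <= q < 1 ->
  \sum_(j <- A) q ^+ (absz j.1 + absz j.2) <= (2 / (1 - q)) ^+ 2.
Proof.
move=> /andP[q0 q1].
have [N HN] : exists N : nat, forall j, j \in (A : seq lattice) -> (absz j.1 < N)%N /\ (absz j.2 < N)%N.
  elim: (A : seq lattice) => [|j s [N IH]]; first by exists 0%N.
  exists (maxn N (maxn (absz j.1).+1 (absz j.2).+1)) => i; rewrite inE !leq_max => /orP[/eqP ->|/IH[h1 h2]].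
    by rewrite !leqnn !orbT.
  by rewrite h1 h2.
(* The integer 0 is listed twice, which is harmless for an upper bound. *)
pose ints := [seq Posz n | n <- iota 0 N] ++ [seq - Posz n | n <- iota 0 N].
have mints (z : int) : (absz z < N)%N -> z \in ints.
  move=> zN; rewrite mem_cat; have [z0|z0] := lerP 0 z.
    by apply/orP; left; apply/mapP; exists (absz z); [rewrite mem_iota; lia|rewrite gez0_abs].
  by apply/orP; right; apply/mapP; exists (absz z); [rewrite mem_iota; lia|rewrite ltz0_abs ?opprK].
have S0 : \sum_(z <- ints) q ^+ absz z <= 2 / (1 - q).
  have g : \sum_(n <- iota 0 N) q ^+ n <= (1 - q)^-1.
    rewrite -[X in iota _ X]subn0 -/(index_iota 0 N) big_mkord -[leRHS]mul1r ler_pdivlMr ?subr_gt0//.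
    have := subrX1 q N; rewrite -opprB -[X in _ = X * _]opprB mulNr => /oppr_inj.
    by rewrite mulrC => <-; rewrite lerBlDr lerDl exprn_ge0.
  rewrite big_cat !big_map /=.
  under [X in _ + X]eq_bigr do rewrite abszN.
  by rewrite mulr_natl mulr2n; apply: lerD.
apply: le_trans (_ : \sum_(j <- [seq (x, y) | x <- ints, y <- ints]) q ^+ (absz j.1 + absz j.2) <= _).
  apply: sum_subset_le; [by move=> j; exact: exprn_ge0|exact: fset_uniq|].
  move=> [j1 j2] jA; have [/= h1 h2] := HN _ jA.
  by apply/allpairsP; exists (j1, j2); split => //; exact: mints.
rewrite big_allpairs /=.
under eq_bigr do under eq_bigr do rewrite exprD.
under eq_bigr do rewrite -big_distrr /=.
rewrite -big_distrl /= -expr2 ler_sqr ?nnegrE ?divr_ge0 ?subr_ge0 ?(ltW q1)//.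
by apply: sumr_ge0 => z _; exact: exprn_ge0.
Qed.

Let psum a (A : {fset lattice}) : R := \sum_(j <- A) a j.

Let psum_mono a (A B : {fset lattice}) : (forall j, 0 <= a j) -> (A `<=` B)%fset -> psum a A <= psum a B.
Proof.
by move=> a0 /fsubsetP AB; apply: sum_subset_le => //; exact: fset_uniq.
Qed.

(** Partial sums of nonnegative terms increase along inclusion, so the net converges to their
    supremum. *)
Let nonneg_cvg a M : (forall j, 0 <= a j) -> (forall A, psum a A <= M) ->
  cvg (psum a @ summability.totally).
Proof.
move=> a0 aM; pose E := range (psum a).
have hE : has_sup E by split; [exists (psum a fset0); exists fset0|exists M => _ [A _ <-]].
apply/cvg_ex; exists (sup E); apply/cvgrPdist_le => e e0.
have [_ [A _ <-] HA] := sup_adherent e0 hE.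
exists A => // B /= AB; have BE : psum a B <= sup E by apply: ub_le_sup; [exact: hE.2|exists B].
rewrite ger0_norm ?subr_ge0//; have AB2 := psum_mono a0 AB; lra.
Qed.

(** Writes a as the difference of the nonnegative families a + |a| and |a|. *)
Lemma abs_bounded_cvg a M : (forall A : {fset lattice}, \sum_(j <- A) `|a j| <= M) ->
  cvg ((fun A : {fset lattice} => \sum_(j <- A) a j) @ summability.totally).
Proof.
move=> aM; have c1 := @nonneg_cvg (fun j => `|a j|) M (fun j => normr_ge0 _) aM.
have c2 : cvg (psum (fun j => a j + `|a j|) @ summability.totally).
  apply: (@nonneg_cvg _ (M + M)) => [j|A].
    have := ler_norm (- a j); rewrite normrN; lra.
  rewrite /psum big_split; apply: lerD => //; apply: le_trans (aM A).
  by apply: ler_sum => j _; exact: ler_norm.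
have -> : (fun A : {fset lattice} => \sum_(j <- A) a j) = psum (fun j => a j + `|a j|) \- psum (fun j => `|a j|).
  by apply/funext => A; rewrite /psum /= -sumrB; apply: eq_bigr => j _; rewrite addrK.
exact: is_cvgB.
Qed.

Lemma lattice_summable (a : lattice -> R[i]) M :
  (forall A : {fset lattice}, \sum_(j <- A) cabs (a j) <= M) ->
  exists l, lattice_has_sum a l.
Proof.
move=> aM.
have sE (f : R[i] -> R) : {morph f : x y / x + y} -> f 0 = 0 ->
    (fun A => f (summability.partial_sum a A)) = fun A : {fset lattice} => \sum_(j <- A) f (a j).
  move=> fD f0; apply/funext => A; rewrite (big_seq_fsetE _ _ predT (fun j => f (a j))) /=.
  by rewrite /summability.partial_sum (big_morph _ fD f0).
have rc : cvg ((fun A : {fset lattice} => \sum_(j <- A) Re (a j)) @ summability.totally).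
  apply: (@abs_bounded_cvg _ M) => A; apply: le_trans (aM A); apply: ler_sum => j _.
  exact: Re_le_cabs.
have ic : cvg ((fun A : {fset lattice} => \sum_(j <- A) Im (a j)) @ summability.totally).
  apply: (@abs_bounded_cvg _ M) => A; apply: le_trans (aM A); apply: ler_sum => j _.
  exact: Im_le_cabs.
move: rc ic => /cvg_ex[/= r rc] /cvg_ex[/= i ic]; exists (r +i* i); split.
  by rewrite (sE (@complex.Re R))//; exact: cReD.
by rewrite (sE (@complex.Im R))//; exact: cImD.
Qed.

End LatticeSummability.

(** * Limits of complex sequences *)

Section ComplexLimits.
Context {R : realType}.
Implicit Types (u v : nat -> R[i]).

Lemma convergesD u v l m : converges u l -> converges v m -> converges (fun n => u n + v n) (l + m).
Proof.
move=> [ru iu] [rv iv]; split.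
  by under eq_fun do rewrite cReD; rewrite cReD; exact: cvgD.
by under eq_fun do rewrite cImD; rewrite cImD; exact: cvgD.
Qed.

Lemma convergesZ u l c : converges u l -> converges (fun n => c * u n) (c * l).
Proof.
move=> [ru iu]; split.
  under eq_fun do rewrite cReM; rewrite cReM.
  by apply: cvgB; apply: cvgMr.
under eq_fun do rewrite cImM; rewrite cImM.
by apply: cvgD; apply: cvgMr.
Qed.

Lemma converges_conj u l : converges u l -> converges (fun n => Num.conj (u n)) (Num.conj l).
Proof.
move=> [ru iu]; split; first by under eq_fun do rewrite cRe_conj; rewrite cRe_conj.
by under eq_fun do rewrite cIm_conj; rewrite cIm_conj; exact: cvgN.
Qed.

Lemma converges_near u v l : (\forall n \near \oo, u n = v n) -> converges v l -> converges u l.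
Proof.
move=> uv [rv iv]; have vu : \forall n \near \oo, v n = u n by apply: filterS uv => n ->.
by split; apply: cvg_trans; [|exact: rv| |exact: iv];
  apply: near_eq_cvg; apply: filterS vu => n ->.
Qed.

Lemma clim_eq u l : converges u l -> clim u = l.
Proof.
by move=> [r i]; apply: complex_ext; rewrite /clim /=; exact: (cvg_lim (@Rhausdorff R)).
Qed.

Lemma lattice_has_sum_conj (a : lattice -> R[i]) l : lattice_has_sum a l ->
  lattice_has_sum (fun j => Num.conj (a j)) (Num.conj l).
Proof.
move=> [ra ia].
have E A : summability.partial_sum (fun j => Num.conj (a j)) A = Num.conj (summability.partial_sum a A).
  by rewrite /summability.partial_sum rmorph_sum.
split; first by under eq_fun do rewrite E cRe_conj; rewrite cRe_conj.
by under eq_fun do rewrite E cIm_conj; rewrite cIm_conj; exact: cvgN.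
Qed.

End ComplexLimits.

(** * The skew part of the Green's function *)

Section GreenImaginaryPart.
Context {R : realType}.
Local Notation pt := (space3 R).
Variables (k : R) (alpha : R * R).
Hypotheses (k_gt0 : 0 < k) (beta_neq0 : forall j, beta k alpha j != 0).
Implicit Types (b : bool) (x y : pt) (j : lattice).

Let gterm x y j : R[i] := (beta k alpha j)^-1 *
  expi ((alpha1 alpha j * (x.1.1 - y.1.1) + alpha2 alpha j * (x.1.2 - y.1.2))%:C
        + beta k alpha j * `|x.2 - y.2|%:C).

(** Collects the losses in |alpha_j| - k >= (|j1| + |j2|) / 2 - C0. *)
Let C0 : R := k + (`|alpha.1| + `|alpha.2|) / 2.

Let alpha_norm_ge j : ((absz j.1)%:R + (absz j.2)%:R) / 2 - (`|alpha.1| + `|alpha.2|) / 2 <=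
  alpha_norm alpha j.
Proof.
have a1 : `|alpha1 alpha j| <= alpha_norm alpha j.
  exact: (Re_le_cabs (alpha1 alpha j +i* alpha2 alpha j)).
have a2 : `|alpha2 alpha j| <= alpha_norm alpha j.
  exact: (Im_le_cabs (alpha1 alpha j +i* alpha2 alpha j)).
have H (a : R) (z : int) : (absz z)%:R - `|a| <= `|a + z%:~R|.
  by rewrite natr_absz intr_norm lerBlDr -[X in `|X| <= _](addKr a) addrC; apply: le_trans (ler_normD _ _) _; rewrite normrN addrC.
have := H alpha.1 j.1; have := H alpha.2 j.2; rewrite -/(alpha1 alpha j) -/(alpha2 alpha j); lra.
Qed.

(** The threshold k + 1 serves twice: |beta| >= |alpha_j| - k >= 1 bounds the reciprocal by 1, and
    the same inequality yields geometric decay at a rate set by the distance of the heights. *)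
Let gterm_bound x y j : k + 1 < alpha_norm alpha j ->
  cabs (gterm x y j) <= expR (C0 * `|x.2 - y.2|) *
    expR (- (`|x.2 - y.2| / 2)) ^+ (absz j.1 + absz j.2).
Proof.
move=> kj; have k0 := k_gt0; set t := `|x.2 - y.2|.
set an := alpha_norm alpha j; have bE : beta k alpha j = 0 +i* Num.sqrt (an ^+ 2 - k ^+ 2).
  by rewrite /Defs.beta leNgt (lt_trans _ kj)// ltrDl.
set sg := Num.sqrt _ in bE.
have sg_ge : an - k <= sg.
  rewrite -(@ler_pXn2r _ 2)// ?nnegrE ?sqrtr_ge0//; last by rewrite -/an in kj; lra.
  by rewrite sqr_sqrtr; rewrite -/an in kj; nra.
have sg1 : 1 <= sg by apply: le_trans sg_ge; rewrite -/an in kj; lra.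
have cbV : cabs (beta k alpha j)^-1 <= 1.
  have : cabs (beta k alpha j) * cabs (beta k alpha j)^-1 = 1.
    rewrite -cabsM mulfV ?beta_neq0//; by rewrite /cabs /= expr1n expr0n addr0 sqrtr1.
  have -> : cabs (beta k alpha j) = sg.
    by rewrite bE /cabs /= expr0n add0r sqrtr_sqr ger0_norm// (le_trans ler01).
  have c0 : 0 <= cabs (beta k alpha j)^-1 by exact: sqrtr_ge0.
  nra.
rewrite /gterm cabsM cabs_expi -/t.
rewrite -expRM_natl -expRD -[leRHS]mul1r; apply: ler_pM => //; first exact: sqrtr_ge0.
rewrite ler_expR bE cImD cImM /= mul0r !add0r.
have t0 : 0 <= t by exact: normr_ge0.
have := alpha_norm_ge j; rewrite -/an natrD /C0 => anb.
have : ((`|j.1|%:R + `|j.2|%:R) / 2 - (`|alpha.1| + `|alpha.2|) / 2 - k) * t <= sg * t.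
  by apply: ler_wpM2r => //; lra.
move: (absz j.1)%:R (absz j.2)%:R => n1 n2; lra.
Qed.

(** A finite part plus a geometrically dominated one. Convergence must be known before the limit
    that defines [lattice_sum] can be manipulated; for equal heights the geometric ratio would be
    1. *)
Lemma green_has_sum x y : x.2 != y.2 ->
  lattice_has_sum (gterm x y) (lattice_sum (gterm x y)).
Proof.
move=> xy; have [P' P'E] := propagating_finite (k + 1) alpha.
pose near_part j := if j \in P' then gterm x y j else 0.
pose far_part j := if j \in P' then 0 else gterm x y j.
have t0 : 0 < `|x.2 - y.2| by rewrite normr_gt0 subr_eq0.
set q := expR (- (`|x.2 - y.2| / 2)).
have q01 : 0 <= q < 1.
  by rewrite expR_ge0/= -expR0 ltr_expR oppr_lt0 divr_gt0.
have [l far_sum] : exists l, lattice_has_sum far_part l.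
  apply: (@lattice_summable _ _ (expR (C0 * `|x.2 - y.2|) * (2 / (1 - q)) ^+ 2)) => A.
  apply: (@le_trans _ _ (\sum_(j <- A) expR (C0 * `|x.2 - y.2|) * q ^+ (absz j.1 + absz j.2))).
    apply: ler_sum => j _; rewrite /far_part P'E; case: (lerP (alpha_norm alpha j)) => [_|kj]; last exact: gterm_bound.
    by rewrite cabs0 mulr_ge0 ?exprn_ge0 ?expR_ge0.
  by rewrite -big_distrr /= ler_wpM2l ?expR_ge0//; exact: geometric_lattice_bound.
have near_sum : lattice_has_sum near_part (\sum_(j <- P') near_part j).
  by apply: lattice_has_sum_finite => j; rewrite /near_part => /negbTE ->.
have := lattice_has_sumD near_sum far_sum.
have -> : (fun j => near_part j + far_part j) = gterm x y.
  by apply/funext => j; rewrite /near_part /far_part; case: ifP => _; rewrite ?addr0 ?add0r.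
by move=> hs; rewrite (lattice_has_sum_eq hs).
Qed.

(** The prefactor i is conjugated to -i, so the difference of the two functions is a sum of series.
    Conjugation sends beta to -beta on evanescent modes, where the terms cancel, and fixes it on
    propagating ones. *)
Lemma green_skew (P : {fset lattice}) x y : (forall j, (j \in P) = (alpha_norm alpha j <= k)) ->
  x.2 != y.2 ->
  green k alpha x y - Num.conj (green k alpha y x) =
  2 * 'i * \sum_(j <- P) \sum_(b : bool) planewave k alpha b j x y.
Proof.
move=> PE xy; have yx : y.2 != x.2 by rewrite eq_sym.
have hs := lattice_has_sumD (green_has_sum xy) (lattice_has_sum_conj (green_has_sum yx)).
have conj_term j : Num.conj (gterm y x j) = (Num.conj (beta k alpha j))^-1 *
  expi ((alpha1 alpha j * (x.1.1 - y.1.1) + alpha2 alpha j * (x.1.2 - y.1.2))%:C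
        - Num.conj (beta k alpha j) * `|x.2 - y.2|%:C).
  rewrite /gterm conj_mul expi_conj fmorphV; congr (_ * expi _).
  have conjD (u v : R[i]) : Num.conj (u + v) = Num.conj u + Num.conj v by exact: rmorphD.
  rewrite conjD conj_mul !conj_real opprD (distrC y.2) -rmorphN; congr (_%:C - _); ring.
have off j : j \notin P -> gterm x y j + Num.conj (gterm y x j) = 0.
  rewrite PE => /negbTE jk; rewrite conj_term.
  have -> : Num.conj (beta k alpha j) = - beta k alpha j.
    by rewrite /Defs.beta jk; apply: complex_ext; rewrite ?cRe_conj ?cIm_conj ?cReN ?cImN /= ?oppr0.
  by rewrite invrN mulNr mulNr opprK subrr.
have := lattice_has_sum_eq hs; rewrite (lattice_has_sum_eq (lattice_has_sum_finite off)) => sE.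
have onP j : j \in P -> gterm x y j + Num.conj (gterm y x j) =
    (16 * pi ^+ 2)%:C * \sum_(b : bool) planewave k alpha b j x y.
  rewrite PE => jk; rewrite conj_term.
  have -> : Num.conj (beta k alpha j) = beta k alpha j.
    by rewrite /Defs.beta jk; apply: complex_ext; rewrite ?cRe_conj ?cIm_conj /= ?oppr0.
  rewrite /gterm big_bool /planewave /= mul1r mulN1r rmorphN mulrN.
  have p0 : (16 * pi ^+ 2)%:C != 0 :> R[i].
    by rewrite (inj_eq (@complexI R)) mulf_neq0// expf_neq0// gt_eqF// pi_gt0.
  move: (_%:C) (beta k alpha j) (beta_neq0 j) => A B B0.
  move: p0; move: ((16 * pi ^+ 2)%:C) => p p0.
  (* The sign of x3 - y3 only decides which of the two exponentials belongs to which plane wave. *)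
  have [t0|t0] := lerP 0 (x.2 - y.2); last first.
    rewrite ltr0_norm// rmorphN mulrN opprK addrC.
    by move: (expi _) (expi _) => e1 e2; field; rewrite ?p0 ?B0.
  by rewrite ger0_norm//; move: (expi _) (expi _) => e1 e2; field; rewrite ?p0 ?B0.
have i2 : 'i * 'i = -1 :> R[i] by rewrite -expr2 sqr_i.
have pE : (16 * pi ^+ 2)%:C = 2 * (8 * pi ^+ 2)%:C :> R[i].
  by rewrite -(rmorph_nat (real_complex R) 2) -rmorphM; congr (_%:C); ring.
have p0 : (8 * pi ^+ 2)%:C != 0 :> R[i].
  by rewrite (inj_eq (@complexI R)) mulf_neq0// expf_neq0// gt_eqF// pi_gt0.
have ic : Num.conj ('i : R[i]) = - 'i.
  by apply: complex_ext; rewrite ?cRe_conj ?cIm_conj /= ?oppr0.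
have PS : \sum_(j <- P) (gterm x y j + Num.conj (gterm y x j)) =
    (16 * pi ^+ 2)%:C * \sum_(j <- P) \sum_(b : bool) planewave k alpha b j x y.
  by rewrite big_distrr; apply: eq_big_seq => j /onP.
rewrite PS in sE; move: sE.
have cV : Num.conj ((8 * pi ^+ 2)%:C^-1 : R[i]) = (8 * pi ^+ 2)%:C^-1.
  by rewrite -fmorphV conj_real.
rewrite /green conj_mul conj_mul ic cV.
rewrite -/(gterm x y) -/(gterm y x) pE.
move: (lattice_sum (gterm x y)) (Num.conj (lattice_sum (gterm y x))) => G G'.
move: (\sum_(j <- P) _) ((8 * pi ^+ 2)%:C) p0 => F p p0 sE.
transitivity ('i / p * (G + G')); first by ring.
by rewrite -sE; field.
Qed.

End GreenImaginaryPart.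

(** * The kernel F in plane waves *)

Section QuasiperiodicKernel.
Context {R : realType}.
Local Notation pt := (space3 R).
Variables (k : R) (alpha : R * R) (S : nat -> {fset lattice}) (P : {fset lattice}).
Hypotheses (k_gt0 : 0 < k) (beta_neq0 : forall j, beta k alpha j != 0).
Hypothesis S_repr : lattice_representation k alpha S.
Hypothesis PE : forall j, (j \in P) = (alpha_norm alpha j <= k).
Implicit Types (b : bool) (x y : pt) (j : lattice).

Lemma pnormN x : pnorm (- x) = pnorm x.
Proof. by rewrite /pnorm /= !sqrrN. Qed.

Lemma phaseN j : phase alpha (- j) = (phase alpha j)^-1.
Proof. by rewrite phaseV /phase /= !mulrNz !mulrN -opprD mulrN rmorphN. Qed.

Lemma shiftN j : Defs.shift (- j) = - Defs.shift j :> pt.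
Proof.
rewrite /Defs.shift; apply/eqP; rewrite !xpair_eqE /=; apply/andP; split.
  by rewrite !mulrNz !mulrN !eqxx.
by rewrite oppr0.
Qed.

Lemma symmetric_sum (A : {fset lattice}) (f : lattice -> R[i]) :
  (forall j, (- j \in A) = (j \in A)) -> \sum_(j <- A) f (- j) = \sum_(j <- A) f j.
Proof.
move=> AN; rewrite -(big_map (fun j => - j) predT f); apply: perm_big.
apply: uniq_perm; [by rewrite map_inj_uniq; [exact: fset_uniq|exact: oppr_inj]|exact: fset_uniq|].
move=> j; apply/mapP/idP => [[i iA ->]|jA]; first by have := AN i; rewrite iA => ->.
by exists (- j); rewrite ?opprK//; have := AN j; rewrite jA => ->.
Qed.

Let rho x y j : R := pnorm (x - y + Defs.shift j).

Let rhoN x y j : rho y x (- j) = rho x y j.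
Proof. by rewrite /rho shiftN -[RHS]pnormN opprD opprB. Qed.

Let rho_neq0 x y j : x.2 != y.2 -> rho x y j != 0.
Proof.
move=> xy; rewrite /rho /pnorm sqrtr_eq0 -ltNge /= addr0.
by rewrite ltr_wpDl ?addr_ge0 ?sqr_ge0// exprn_even_gt0//= subr_eq0.
Qed.

Let sinc_term x y j : R[i] := k%:C * (phase alpha j)^-1 / (4 * pi)%:C * (j0 (k * rho x y j))%:C.

(* The reflected and conjugated spherical wave differs from the original by
   the sign of i k rho only. *)
Let sinc_sum x y (A : {fset lattice}) : (forall j, (- j \in A) = (j \in A)) -> x.2 != y.2 ->
  \sum_(j <- A) sinc_term x y j = (2 * 'i)^-1 *
   (\sum_(j <- A) (phase alpha j)^-1 * (expi (k * rho x y j)%:C / (4 * pi * rho x y j)%:C) -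
    Num.conj (\sum_(j <- A) (phase alpha j)^-1 * (expi (k * rho y x j)%:C / (4 * pi * rho y x j)%:C))).
Proof.
move=> AN xy.
rewrite -(symmetric_sum (fun j => (phase alpha j)^-1 * (expi (k * rho y x j)%:C / _)) AN).
rewrite rmorph_sum -sumrB big_distrr; apply: eq_bigr => j _ /=.
rewrite rhoN phaseN !conj_mul expi_conj conj_real.
have cp : Num.conj ((phase alpha j)^-1^-1) = (phase alpha j)^-1.
  by rewrite invrK phaseV /phase expi_conj conj_real.
have cV : Num.conj ((4 * pi * rho x y j)%:C^-1 : R[i]) = (4 * pi * rho x y j)%:C^-1.
  by rewrite -fmorphV conj_real.
rewrite cp cV /sinc_term.
have r0 := rho_neq0 j xy; have k0 : k != 0 by rewrite gt_eqF.
have sE : expi (k * rho x y j)%:C - expi (- (k * rho x y j)%:C) = 2 * 'i * (sin (k * rho x y j))%:C.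
  apply: complex_ext; rewrite /expi ?cReD ?cImD ?cReN ?cImN ?cReM ?cImM /= ?oppr0 ?expR0 ?cosN ?sinN; ring.
rewrite /j0 mulf_eq0 (negbTE k0) (negbTE r0) /=.
have i0 : 'i != 0 :> R[i] by rewrite neq0Ci.
have c0 (a : R) : a != 0 -> a%:C != 0 :> R[i] by move=> a0; rewrite (inj_eq (@complexI R)).
have [kc rc] := (c0 _ k0, c0 _ r0).
have pc : (4 * pi)%:C != 0 :> R[i] by rewrite c0// mulf_neq0// gt_eqF// pi_gt0.
have sV : (sin (k * rho x y j) / (k * rho x y j))%:C =
    (sin (k * rho x y j))%:C / (k%:C * (rho x y j)%:C) :> R[i].
  by rewrite rmorphM fmorphV rmorphM.
have dE : (4 * pi * rho x y j)%:C = (4 * pi)%:C * (rho x y j)%:C :> R[i] by rewrite rmorphM.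
rewrite sV dE.
move: (expi _) (expi _) (phase alpha j)^-1 (sin _)%:C sE => e2 e1 ph s sE.
move: ((4 * pi)%:C) pc (k%:C) kc ((rho x y j)%:C) rc => p p0 kk kk0 r rr0.
transitivity ((2 * 'i)^-1 * (ph * (e1 - e2) / (p * r))); last by ring.
by rewrite sE; field; rewrite ?p0 ?kk0 ?rr0 ?i0.
Qed.

(** Both spherical-wave series converge along [S] by admissibility, hence so does their combination,
    the sinc series; [clim] then returns the value given by [green_skew]. *)
Lemma Fker_planewaves x y : x.2 != y.2 ->
  Fker k alpha S x y = \sum_(j <- P) \sum_(b : bool) planewave k alpha b j x y.
Proof.
move=> xy; have [[Smono Sex Ssym] Srep] := S_repr.
have yx : y.2 != x.2 by rewrite eq_sym.
have i0 : 2 * 'i != 0 :> R[i] by rewrite mulf_neq0// neq0Ci.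
have cv : converges (fun n => \sum_(j <- S n) sinc_term x y j)
    (\sum_(j <- P) \sum_(b : bool) planewave k alpha b j x y).
  have -> : (fun n => \sum_(j <- S n) sinc_term x y j) = fun n => (2 * 'i)^-1 *
     (\sum_(j <- S n) (phase alpha j)^-1 * (expi (k * rho x y j)%:C / (4 * pi * rho x y j)%:C) +
      - 1 * Num.conj (\sum_(j <- S n) (phase alpha j)^-1 * (expi (k * rho y x j)%:C / (4 * pi * rho y x j)%:C))).
    by apply/funext => n; rewrite (sinc_sum (Ssym n) xy) mulN1r.
  have -> : \sum_(j <- P) \sum_(b : bool) planewave k alpha b j x y =
      (2 * 'i)^-1 * (green k alpha x y + - 1 * Num.conj (green k alpha y x)).
    by rewrite mulN1r (green_skew k_gt0 beta_neq0 PE xy) mulKf.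
  apply: convergesZ; apply: convergesD; first exact: Srep.
  by apply: convergesZ; apply: converges_conj; exact: Srep.
(* The kernel keeps the term j = 0 outside the limit; it is put back for all n with 0 in [S n], that
   is, eventually. *)
have [n0 n0S] := Sex 0.
have SN n : (n0 <= n)%N -> 0 \in S n.
  by move=> /subnK <-; elim: (n - n0)%N => [//|d IH]; rewrite addSn; exact: (fsubsetP (Smono _)).
have s0 : sinc_term x y 0 = (k / (4 * pi) * j0 (k * pnorm (x - y)))%:C.
  rewrite /sinc_term /rho /phase /Defs.shift /= !mulr0 addr0 mulr0 expi0 invr1 mulr1.
  have -> : x - y + (0, 0, 0) = x - y by rewrite addr0.
  have kE : (k / (4 * pi))%:C = k%:C / (4 * pi)%:C :> R[i] by rewrite rmorphM fmorphV.
  by rewrite -kE -rmorphM.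
rewrite /Fker -s0.
have -> : clim (fun n => \sum_(j <- S n | j != 0) k%:C * (phase alpha j)^-1 / (4 * pi)%:C *
    (j0 (k * pnorm (x - y + Defs.shift j)))%:C) =
  \sum_(j <- P) \sum_(b : bool) planewave k alpha b j x y + - sinc_term x y 0.
  apply: clim_eq; apply: (@converges_near _ _ (fun n => \sum_(j <- S n) sinc_term x y j + - sinc_term x y 0)).
    exists n0 => // n /= n0n.
    have n0' := SN n n0n.
    by rewrite [in RHS](bigD1_seq 0 n0' (fset_uniq _)) /= [RHS]addrC addKr.
  by apply: convergesD => //; split; exact: cvg_cst.
by rewrite addrC subrK.
Qed.

End QuasiperiodicKernel.

(** * The dyadic kernel in plane waves *)

Section DyadicKernel.
Context {R : realType}.
Local Notation pt := (space3 R).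
Variables (k : R) (alpha : R * R) (S : nat -> {fset lattice}) (P : {fset lattice}).
Hypotheses (k_gt0 : 0 < k) (beta_neq0 : forall j, beta k alpha j != 0).
Hypothesis S_repr : lattice_representation k alpha S.
Hypothesis PE : forall j, (j \in P) = (alpha_norm alpha j <= k).
Implicit Types (b : bool) (x y z : pt) (j : lattice) (m n : 'I_3).

Lemma partial_near m (f g : pt -> R[i]) x : (\near x, f x = g x) ->
  partial m f x = partial m g x.
Proof.
move=> fg; rewrite /partial; congr (_ +i* _).
  by apply: near_eq_derive; apply: filterS fg => t ->.
by apply: near_eq_derive; apply: filterS fg => t ->.
Qed.

Lemma is_partialZ m x (c : R[i]) (f : pt -> R[i]) d : is_partial m x f d ->
  is_partial m x (fun t => c * f t) (c * d).
Proof.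
move=> df; have dc : is_partial m x (fun=> c) 0 by split; exact: is_derive_cst.
by have := is_partialM dc df; rewrite mul0r add0r.
Qed.

Lemma is_partial_sum m x (I : Type) (s : seq I) (f : I -> pt -> R[i]) (d : I -> R[i]) :
  (forall i, is_partial m x (f i) (d i)) ->
  is_partial m x (fun t => \sum_(i <- s) f i t) (\sum_(i <- s) d i).
Proof.
move=> df; elim: s => [|i s IH].
  under eq_fun do rewrite big_nil; rewrite big_nil.
  by split; exact: is_derive_cst.
under eq_fun do rewrite big_cons; rewrite big_cons.
exact: is_partialD.
Qed.

Let planewave_pexp b j x y : planewave k alpha b j x y =
  ((16 * pi ^+ 2)%:C * beta k alpha j)^-1 * pexp (gam k alpha b j)
  (- (dot (gam k alpha b j) (vec3 y.1.1%:C y.1.2%:C y.2%:C))) x.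
Proof.
have [g1 g2 g3] := gamE k alpha j b.
have [v1 v2 v3] := vec3E (y.1.1%:C : R[i]) y.1.2%:C y.2%:C.
rewrite /planewave /pexp dotE g1 g2 g3 v1 v2 v3; congr (_ * expi _).
rewrite rmorphD !rmorphM !rmorphB /=.
by ring.
Qed.

Lemma is_partial_planewave m b j x y :
  is_partial m x (fun t => planewave k alpha b j t y)
    ('i * gam k alpha b j m 0 * planewave k alpha b j x y).
Proof.
have -> : (fun t => planewave k alpha b j t y) = fun t =>
  ((16 * pi ^+ 2)%:C * beta k alpha j)^-1 * pexp (gam k alpha b j)
  (- (dot (gam k alpha b j) (vec3 y.1.1%:C y.1.2%:C y.2%:C))) t.
  by apply/funext => t; exact: planewave_pexp.
have := is_partialZ ((16 * pi ^+ 2)%:C * beta k alpha j)^-1 (is_partial_pexp m (gam k alpha b j)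
  (- (dot (gam k alpha b j) (vec3 y.1.1%:C y.1.2%:C y.2%:C))) x).
by rewrite planewave_pexp; move: (_^-1) (pexp _ _) => d f; rewrite mulrCA.
Qed.

Let off_plane z y : z.2 != y.2 -> \near z, z.2 != y.2.
Proof.
move=> zy; suff o : open [set x : pt | x.2 != y.2] by exact: open_nbhs_nbhs.
have -> : [set x : pt | x.2 != y.2] = snd @^-1` (~` [set y.2]).
  by apply/seteqP; split => x /= /eqP.
apply: open_comp; first by move=> x _; exact: cvg_snd.
by rewrite openC; exact: closed_eq.
Qed.

(** The expansion of F holds on the open set x3 <> y3 and can be differentiated there. Each
    derivative brings a factor i gam, so the operator I + grad div / k^2 acts on a plane wave as the
    polarization matrix. *)
Lemma FFker_planewaves z y m n : z.2 != y.2 ->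
  FFker k alpha S z y m n =
  \sum_(j <- P) \sum_(b : bool) planewave k alpha b j z y * polarization k alpha j b m n 0.
Proof.
move=> zy.
(* [G None] is the kernel near the point and [G (Some n')] its derivative in direction n'. *)
pose G i x := \sum_(j <- P) \sum_(b : bool)
  (if i is Some n' then 'i * gam k alpha b j n' 0 * planewave k alpha b j x y
   else planewave k alpha b j x y).
have nG x : x.2 != y.2 -> \near x, Fker k alpha S x y = G None x.
  move=> xy; apply: filterS (off_plane xy) => t ty.
  exact: (Fker_planewaves k_gt0 beta_neq0 S_repr PE ty).
have p1 n' x : partial n' (G None) x = G (Some n') x.
  apply: is_partialE; apply: is_partial_sum => j; apply: is_partial_sum => b.
  exact: is_partial_planewave.
have p2 : partial m (G (Some n)) z = \sum_(j <- P) \sum_(b : bool)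
    'i * gam k alpha b j n 0 * ('i * gam k alpha b j m 0 * planewave k alpha b j z y).
  apply: is_partialE; apply: is_partial_sum => j; apply: is_partial_sum => b.
  exact: (is_partialZ ('i * gam k alpha b j n 0) (is_partial_planewave m b j z y)).
have nd : nabla_div (fun x => Fker k alpha S x y) z m n = \sum_(j <- P) \sum_(b : bool)
    'i * gam k alpha b j n 0 * ('i * gam k alpha b j m 0 * planewave k alpha b j z y).
  rewrite -p2 mxE; apply: partial_near; apply: filterS (off_plane zy) => t ty.
  by rewrite -p1; apply: partial_near; exact: nG.
have -> : FFker k alpha S z y m n = Fker k alpha S z y * (m == n)%:R +
    (k ^+ 2)%:C^-1 * nabla_div (fun x => Fker k alpha S x y) z m n.
  by rewrite /FFker !mxE mulr_natr.
rewrite nd (Fker_planewaves k_gt0 beta_neq0 S_repr PE zy) big_distrl big_distrr -big_split.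
apply: eq_bigr => j _ /=; rewrite big_distrl big_distrr -big_split; apply: eq_bigr => b _ /=.
have i2 : 'i * 'i = -1 :> R[i] by rewrite -expr2 sqr_i.
rewrite polarizationE eq_sym.
move: (planewave _ _ _ _ _ _) (gam k alpha b j m 0) (gam k alpha b j n 0) => p gm gn.
transitivity (p * ((n == m)%:R + ('i * 'i) * gn * gm / (k ^+ 2)%:C)); first by ring.
by rewrite i2; ring.
Qed.

End DyadicKernel.

(** * Integrals modified on a null set *)

Section NullModification.
Context {d : measure_display} {T : measurableType d} {R : realType}.
Variables (mu : {measure set T -> \bar R}).
Import HBNNSimple.
Local Open Scope ereal_scope.

(* f and g may fail to be measurable: the integral of a nonnegative function is
   a supremum over the simple functions below it, and these can be set to 0 on
   the null set. *)
Lemma integral_eq_off_null (A N : set T) (f g : T -> \bar R) : measurable N -> mu N = 0 ->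
  (forall x, A x -> ~ N x -> f x = g x) -> \int[mu]_(x in A) f x = \int[mu]_(x in A) g x.
Proof.
move=> mN N0 fg.
have ge0_le (p q : T -> \bar R) : (forall x, 0 <= p x) -> (forall x, 0 <= q x) ->
    (forall x, ~ N x -> p x = q x) -> \int[mu]_x p x <= \int[mu]_x q x.
  move=> p0 q0 pq; rewrite !ge0_integralTE//.
  apply: ge_ereal_sup => _ [h hp <-]; apply: ereal_sup_ubound.
  pose h' : {nnsfun T >-> R} := mul_nnsfun h (indic_nnsfun R (measurableC mN)).
  have h'E (x : T) : h' x = (h x * \1_(~` N) x)%R by [].
  exists h'.
    move=> x; rewrite h'E indicE; have [xN|xN] := boolP (x \in ~` N).
      have Nx : ~ N x by move: xN; rewrite inE.
      by rewrite mulr1 -(pq x Nx); exact: hp.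
    by rewrite mulr0.
  rewrite -!integralT_nnsfun; apply: ge0_ae_eq_integral => //.
  - by apply/measurable_EFinP; exact: measurable_funP.
  - by apply/measurable_EFinP; exact: measurable_funP.
  - by move=> x _; rewrite lee_fin.
  - by move=> x _; rewrite lee_fin.
  exists N; split => // x /= nx; apply: contrapT => xN; apply: nx => _.
  by transitivity (h' x)%:E => //; rewrite h'E indicE mem_set// mulr1.
have ge0_eq (p q : T -> \bar R) : (forall x, 0 <= p x) -> (forall x, 0 <= q x) ->
    (forall x, ~ N x -> p x = q x) -> \int[mu]_x p x = \int[mu]_x q x.
  by move=> p0 q0 pq; apply/eqP; rewrite eq_le !ge0_le// => x /pq.
rewrite integral_mkcond [RHS]integral_mkcond integralE [RHS]integralE.
have eq_off x : ~ N x -> (f \_ A) x = (g \_ A) x.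
  by move=> Nx; rewrite !patchE; case: ifPn => // /set_mem Ax; exact: fg.
by congr (_ - _); apply: ge0_eq => [x|x|x Nx]; rewrite ?funepos_ge0 ?funeneg_ge0 ?funeposE ?funenegE ?(eq_off x Nx).
Qed.

End NullModification.

(** * The kernel integral and the conclusion *)

Section KernelIntegral.
Context {R : realType}.
Local Notation pt := (space3 R).
Local Notation mR := (measurableTypeR R).
Local Notation mpt := (mR * mR * mR)%type.
Variables (k : R) (alpha : R * R) (h : R) (eps : pt -> 'M[R[i]]_3).
Variables (S : nat -> {fset lattice}) (P : {fset lattice}).
Implicit Types (b : bool) (x y z : pt) (j : lattice) (m n : 'I_3).

Lemma cint_eq_off_null (A N : set mpt) (f g : mpt -> R[i]) : measurable N -> mu3 N = 0%E ->
  (forall x, A x -> ~ N x -> f x = g x) -> cint mu3 A f = cint mu3 A g.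
Proof.
move=> mN N0 fg; apply: complex_ext; rewrite /cint /=; congr fine;
  by apply: (integral_eq_off_null mN) => // x Ax Nx; rewrite /= (fg x Ax Nx).
Qed.

Lemma cdifferentiable_planewave b j z y : cdifferentiable y (planewave k alpha b j z).
Proof.
have -> : planewave k alpha b j z = fun y => ((16 * pi ^+ 2)%:C * beta k alpha j)^-1 *
    pexp (- gam k alpha b j) (dot (gam k alpha b j) (vec3 z.1.1%:C z.1.2%:C z.2%:C)) y.
  apply/funext => t; have [g1 g2 g3] := gamE k alpha j b.
  have [v1 v2 v3] := vec3E (z.1.1%:C : R[i]) z.1.2%:C z.2%:C.
  have gN m : (- gam k alpha b j) m 0 = - gam k alpha b j m 0 by rewrite mxE.
  rewrite /planewave /pexp dotE !gN g1 g2 g3 v1 v2 v3; congr (_ * expi _).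
  rewrite rmorphD !rmorphM !rmorphB /=.
  by ring.
by apply: cdifferentiableM; [split; exact: differentiable_cst|exact: cdifferentiable_pexp].
Qed.

(** On the plane y3 = z3 no expansion of [FFker] is at hand and even its measurability is open;
    [cint_eq_off_null] replaces the integrand without asking for it. The sums can then leave the
    integral, as every plane-wave term is integrable. *)
Lemma kernel_integral E u c z m : 0 < k -> 0 < h -> (supp_height eps < h%:E)%E -> medium eps ->
  Lp_on 2 (D eps) E -> maxwell k alpha eps E u c -> (forall j, beta k alpha j != 0) ->
  lattice_representation k alpha S -> (forall j, (j \in P) = (alpha_norm alpha j <= k)) ->
  cint mu3 (D eps : set mpt) (fun y => (FFker k alpha S z y *m source eps E u y) m 0) =
  \sum_(j <- P) \sum_(b : bool) cint mu3 (D eps : set mpt) (fun y => planewave k alpha b j z y *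
      dot (source eps E u y) (polarization k alpha j b m)).
Proof.
move=> k0 h0 hs med EL2 umax b0 Srep PE.
have mD := @measurable_D R eps.
have gi j b : cintegrable mu3 (D eps : set mpt) (fun y => planewave k alpha b j z y *
      dot (source eps E u y) (polarization k alpha j b m)).
  by apply: (cintegrable_source_smooth hs umax med EL2) => y; exact: cdifferentiable_planewave.
transitivity (cint mu3 (D eps : set mpt) (fun y => \sum_(j <- P) \sum_(b : bool)
    planewave k alpha b j z y * dot (source eps E u y) (polarization k alpha j b m))).
  apply: (cint_eq_off_null (measurable_plane3 z.2) (mu3_plane3 z.2)) => y _ /eqP yz.
  have zy : z.2 != y.2 by rewrite eq_sym.
  rewrite mxE.
  under eq_bigr do rewrite (FFker_planewaves k0 b0 Srep PE _ _ zy) big_distrl.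
  rewrite exchange_big; apply: eq_bigr => j _ /=.
  under eq_bigr do rewrite big_distrl.
  rewrite exchange_big; apply: eq_bigr => b _ /=.
  by rewrite big_distrr; apply: eq_bigr => n _ /=; rewrite -mulrA [X in _ * X = _]mulrC.
rewrite cint_sum//; last by move=> j; exact: cintegrable_sum.
by apply: eq_bigr => j _; rewrite cint_sum.
Qed.

End KernelIntegral.

Lemma cnormN (R : realType) (a : 'cV[R[i]]_3) : cnorm (- a) = cnorm a.
Proof.
rewrite /cnorm /cnormsq; congr Num.sqrt; apply: eq_bigr => m _.
by rewrite mxE cReN cImN !sqrrN.
Qed.

Lemma vintegral3_opp (R : realType) (a : R[i]) (A : set (space3 (measurableTypeR R)))
  (w : field3 R) m :
  (- (a *: vintegral3 A w)) m 0 = - (a * cint mu3 A (fun x => w x m 0)).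
Proof. by rewrite 3!mxE. Qed.

Theorem theorem3 (R : realType) (k : R) (alpha : R * R) (h : R)
    (eps : space3 R -> 'M[R[i]]_3) (N : nat)
    (Ein J u : 'I_N -> field3 R)
    (up um : 'I_N -> lattice -> 'cV[R[i]]_3)
    (S : nat -> {fset lattice}) (p : R)
    (k_gt0 : 0 < k)
    (eps_medium : medium eps)
    (h_gt0 : 0 < h)
    (h_supp : (supp_height eps < h%:E)%E)
    (beta_neq0 : forall j, beta k alpha j != 0)
    (direct_well_posed : well_posed k alpha h eps)
    (S_representation : lattice_representation k alpha S)
    (Ein_incident : forall l, incident k alpha eps (Ein l) (J l))
    (u_scattered : forall l, scattered k alpha h eps (Ein l) (u l) (up l) (um l))
    (p_gt0 : 0 < p) :
  forall z, Omega z ->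
    imaging k alpha h up um p z =
    \sum_(l < N)
      cnorm ((k ^+ 2 / (2 * pi ^+ 2))%:C *:
        vintegral3 (D eps) (fun y =>
          FFker k alpha S z y *m ((eps y - 1%:M) *m (Ein l y + u l y)))) `^ p.
Proof.
move=> z _; have [P PE] := propagating_finite k alpha.
rewrite /imaging; apply: eq_bigr => l _; congr (_ `^ _).
have [[c umax] _ ucoef] := u_scattered l.
have EL2 := incident_L2 (Ein_incident l).
have -> : (fun y => FFker k alpha S z y *m ((eps y - 1%:M) *m (Ein l y + u l y))) =
    fun y => FFker k alpha S z y *m source eps (Ein l) (u l) y.
  by apply/funext => y; rewrite /source (addrC (u l y)).
(* The imaging sum equals minus the integral, so the sign is first absorbed in the norm and the
   vectors are then compared entrywise. *)
rewrite -[RHS]cnormN; congr cnorm; apply/colP => m.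
rewrite mxE (imaging_integral z m k_gt0 h_gt0 h_supp eps_medium EL2 umax ucoef beta_neq0 PE).
rewrite -(kernel_integral z m k_gt0 h_gt0 h_supp eps_medium EL2 umax beta_neq0 S_representation PE).
exact/esym/vintegral3_opp.
Qed.
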